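(* Let $G$ be an $n$-vertex planar triconnected cubic graph. Every minimal graph story $\mathcal{S}=(G,5,\tau)$ is realizable. Moreover, a sequence $\langle\phi_5,\phi_6,\dots,\phi_n\rangle$ of planar embeddings of $G_5,\dots,G_n$ in which $\phi_{i-1}$ and $\phi_i$ are compatible for every $6\le i\le n$ can be computed in $O(n)$ time.
   Context: A graph story is a tuple $\mathcal{S}=(G,\omega,k,\tau)$ where $G=(V,E)$ is an $n$-vertex graph, $\omega\le n$ is a positive integer, $k\ge 0$ is an integer, and $\tau=\langle v_1,\dots,v_n\rangle$ is a linear ordering of $V$; a minimal graph story is one with $k=0$, written $(G,\omega,\tau)$. For $1\le i\le n$, $G_i$ is the subgraph of $G$ induced by $\{v_j:\max\{1,i-\omega+1\}\le j\le i\}$. Throughout, every edge $(v_i,v_j)$ of $G$ satisfies $|i-j|<\omega$. A drawing maps vertices to distinct points of the plane and edges to Jordan arcs between their end-vertices; it is planar if no two edges intersect except at common endpoints. A realization of $\mathcal{S}$ on a set $P$ of $\omega+k$ points is a sequence $\langle\Gamma_1,\dots,\Gamma_n\rangle$ such that (R1) each $\Gamma_i$ is a planar drawing of $G_i$ with distinct vertices mapped to distinct points of $P$, and (R2) for $2\le i\le n$ the restrictions of $\Gamma_{i-1}$ and $\Gamma_i$ to $G_{i-1}\cap G_i$ are identical; $\mathcal{S}$ is realizable if it has a realization on some set of $\omega+k$ points. A graph is cubic if every vertex has degree three. A planar embedding is an equivalence class of planar drawings with the same rotation system, face boundaries and external face. For a minimal story, planar embeddings $\phi_{i-1}$ of $G_{i-1}$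 and $\phi_i$ of $G_i$ ($\omega+1\le i\le n$) are compatible if removing $v_{i-\omega}$ from $\phi_{i-1}$ and removing $v_i$ from $\phi_i$ yield the same planar embedding of $G_{i-1}\cap G_i$ and, in both cases, the face created by the removal is the same face of that embedding. *)

(* Defs.v *)
(* The plane is R * R for a real type R. *)
From HB Require Import structures.
From mathcomp Require Import all_boot all_order all_algebra.
From mathcomp Require Import all_classical all_reals all_analysis.

Set Implicit Arguments.
Unset Strict Implicit.
Unset Printing Implicit Defensive.

Import Order.TTheory GRing.Theory Num.Theory.
Import numFieldNormedType.Exports.

Local Open Scope ring_scope.

Record sgraph (V : finType) := SGraph {
  adjacent :> rel V;
  adjacent_sym : symmetric adjacent;
  adjacent_irr : irreflexive adjacent }.

Definition neighbours (V : finType) (G : sgraph V) (W : {set V}) (v : V) :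
    {set V} :=
  [set u in W | G v u]%SET.

Definition cubic (V : finType) (G : sgraph V) : Prop :=
  forall v : V, #|neighbours G [set: V]%SET v| = 3%N.

Definition connected_on (V : finType) (G : sgraph V) (W : {set V}) : Prop :=
  forall x y : V, x \in W -> y \in W ->
    connect [rel u v | [&& u \in W, v \in W & G u v]] x y.

Definition triconnected (V : finType) (G : sgraph V) : Prop :=
  (3 < #|V|)%N /\
  forall X : {set V}, (#|X| < 3)%N -> connected_on G (~: X)%SET.

Section Plane.
Variable R : realType.
Local Open Scope classical_set_scope.

Definition sqdist (p q : R * R) : R := (p.1 - q.1) ^+ 2 + (p.2 - q.2) ^+ 2.

Definition parametrizes (g : R -> R * R) (A : set (R * R)) (p q : R * R) :
    Prop :=
  [/\ {within `[0, 1], continuous g},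
      {in `[0, 1] &, injective g},
      g 0 = p, g 1 = q & A = g @` `[0, 1]].

Definition jordan_arc (A : set (R * R)) (p q : R * R) : Prop :=
  exists g : R -> R * R, parametrizes g A p q.

(* x is the point where the arc A, followed from its end p, first meets the
   circle of radius r centred at p. *)
Definition first_hit (p : R * R) (A : set (R * R)) (r : R) (x : R * R) : Prop :=
  exists (g : R -> R * R) (q : R * R) (t : R),
    [/\ parametrizes g A p q, 0 <= t <= 1, g t = x, sqdist p x = r ^+ 2 &
        forall s, 0 <= s < t -> sqdist p (g s) < r ^+ 2].

(* Twice the signed area of the triangle abc; for three distinct points of a
   circle it is positive iff a, b, c are met in this order counterclockwise. *)
Definition signed_area (a b c : R * R) : R :=
  (b.1 - a.1) * (c.2 - a.2) - (b.2 - a.2) * (c.1 - a.1).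

(* The arcs A, B, C leave their common end p in this cyclic counterclockwise
   order. *)
Definition ccw (p : R * R) (A B C : set (R * R)) : Prop :=
  \forall r \near 0^'+, exists a b c : R * R,
    [/\ first_hit p A r a, first_hit p B r b, first_hit p C r c &
        0 < signed_area a b c].

End Plane.

(* Edges are drawn as point sets.  A drawing of the subgraph induced by a
   vertex set W is read off from the values of both fields on W only. *)
Record drawing (R : realType) (V : finType) := Drawing {
  pos : V -> R * R;
  curve : V -> V -> set (R * R) }.

Section Drawings.
Variables (R : realType) (V : finType) (G : sgraph V) (W : {set V}).
Implicit Types D : drawing R V.
Local Open Scope classical_set_scope.

Definition planar_drawing D : Prop :=
  [/\ {in W &, injective (pos D)},
      forall u v, u \in W -> v \in W -> G u v ->
        jordan_arc (curve D u v) (pos D u) (pos D v) /\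
        curve D u v = curve D v u,
      forall u v w, u \in W -> v \in W -> w \in W -> G u v ->
        curve D u v (pos D w) -> w = u \/ w = v &
      forall u v x y, u \in W -> v \in W -> x \in W -> y \in W ->
        G u v -> G x y -> [set u; v]%SET <> [set x; y]%SET ->
        forall p, curve D u v p -> curve D x y p ->
        exists w, [/\ w \in [set u; v]%SET, w \in [set x; y]%SET &
                      p = pos D w]].

Definition same_drawing D D' : Prop :=
  (forall v, v \in W -> pos D v = pos D' v) /\
  (forall u v, u \in W -> v \in W -> G u v -> curve D u v = curve D' u v).

Definition drawn_points D : set (R * R) :=
  [set p | (exists2 v, v \in W & p = pos D v) \/
           (exists u v, [/\ u \in W, v \in W, G u v & curve D u v p])].

Definition face_at D (p : R * R) : set (R * R) :=
  connected_component (~` drawn_points D) p.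

Definition faces D : set (set (R * R)) :=
  [set face_at D p | p in ~` drawn_points D].

Definition external_face D : set (set (R * R)) :=
  [set f | faces D f /\ ~ bounded_set f].

(* f lies immediately to the left of the edge (u, v) directed from u to v: an
   arc can be drawn from u into f that leaves u directly after (u, v) in
   counterclockwise order. *)
Definition on_left D (u v : V) (f : set (R * R)) : Prop :=
  exists (A : set (R * R)) (q : R * R),
    [/\ jordan_arc A (pos D u) q, A `\ pos D u `<=` f &
        forall w, w \in neighbours G W u -> w <> v ->
          ccw (pos D u) (curve D u v) A (curve D u w)].

(* The boundary of a face: its vertices and its edges, directed so that the
   face is on their left.  Directing the edges makes the boundary orientation
   sensitive; together with the rotation system it gives the closed walks
   bounding the face, isolated vertices being seen in the first component. *)
Definition boundary D (f : set (R * R)) : set V * set (V * V) :=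
  ([set v | v \in W /\ closure f (pos D v)],
   [set d | [/\ d.1 \in W, d.2 \in W, G d.1 d.2 & on_left D d.1 d.2 f]]).

Definition same_rotation D D' : Prop :=
  forall v a b c, v \in W -> a \in neighbours G W v ->
    b \in neighbours G W v -> c \in neighbours G W v ->
    ccw (pos D v) (curve D v a) (curve D v b) (curve D v c) <->
    ccw (pos D' v) (curve D' v a) (curve D' v b) (curve D' v c).

Definition equivalent D D' : Prop :=
  [/\ same_rotation D D',
      boundary D @` faces D = boundary D' @` faces D' &
      boundary D @` external_face D = boundary D' @` external_face D'].

Definition planar_embedding (phi : set (drawing R V)) : Prop :=
  exists2 D, planar_drawing D &
    phi = [set D' | planar_drawing D' /\ equivalent D D'].

End Drawings.

Definition planar (R : realType) (V : finType) (G : sgraph V) : Prop :=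
  exists D : drawing R V, planar_drawing G [set: V]%SET D.

(* n = #|V|; the vertex v_i is the one with index v story_order = i - 1. *)
Record graph_story (V : finType) := GraphStory {
  story_graph : sgraph V;
  omega : nat;
  extra_points : nat;
  story_order : seq V;
  omega_gt0 : (0 < omega)%N;
  omega_le : (omega <= #|V|)%N;
  story_order_uniq : uniq story_order;
  story_order_full : forall v, v \in story_order;
  story_edges : forall u v, story_graph u v ->
    (index u story_order < index v story_order + omega)%N }.

Definition minimal_story (V : finType) (S : graph_story V) : Prop :=
  extra_points S = 0%N.

(* The vertex set of G_i. *)
Definition window (V : finType) (S : graph_story V) (i : nat) : {set V} :=
  [set v | i - omega S <= index v (story_order S) < i]%N%SET.

Definition realization (R : realType) (V : finType) (S : graph_story V)
    (P : seq (R * R)) (Gamma : nat -> drawing R V) : Prop :=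
  (forall i, (1 <= i <= #|V|)%N ->
     planar_drawing (story_graph S) (window S i) (Gamma i) /\
     forall v, v \in window S i -> pos (Gamma i) v \in P) /\
  (forall i, (2 <= i <= #|V|)%N ->
     same_drawing (story_graph S) (window S i.-1 :&: window S i)%SET
       (Gamma i.-1) (Gamma i)).

Definition realizable (R : realType) (V : finType) (S : graph_story V) : Prop :=
  exists P : seq (R * R),
    [/\ uniq P, size P = (omega S + extra_points S)%N &
        exists Gamma, realization S P Gamma].

(* Compatibility of embeddings of G_{i-1} and G_i, for omega < i <= n.  The two
   removals are carried out on representatives; the choice of these is
   immaterial since equivalent drawings stay equivalent after the removal. *)
Definition compatible (R : realType) (V : finType) (S : graph_story V)
    (i : nat) (phi phi' : set (drawing R V)) : Prop :=
  exists (x y : V) (D D' : drawing R V),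
    let G := story_graph S in
    let W := (window S i.-1 :&: window S i)%SET in
    [/\ (index x (story_order S)).+1 = (i - omega S)%N,
        (index y (story_order S)).+1 = i,
        phi D /\ phi' D',
        equivalent G W D D' &
        boundary G W D (face_at G W D (pos D x)) =
        boundary G W D' (face_at G W D' (pos D' y))].

Definition compatible_sequence (R : realType) (V : finType)
    (S : graph_story V) (phi : nat -> set (drawing R V)) : Prop :=
  (forall i, (omega S <= i <= #|V|)%N ->
     planar_embedding (story_graph S) (window S i) (phi i)) /\
  (forall i, (omega S < i <= #|V|)%N -> compatible S i (phi i.-1) (phi i)).

(* Finite description of an embedding: the neighbours of each vertex in
   counterclockwise order, and the boundaries of the external face and of the
   internal faces. *)
Record embedding_code (V : finType) := Code {
  code_rotation : seq (V * seq V);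
  code_external : seq V * seq (V * V);
  code_internal : seq (seq V * seq (V * V)) }.

Definition listed (V : finType) (b : seq V * seq (V * V)) :
    set V * set (V * V) :=
  ([set v | v \in b.1]%classic, [set d | d \in b.2]%classic).

Definition describes (R : realType) (V : finType) (G : sgraph V)
    (W : {set V}) (c : embedding_code V) (D : drawing R V) : Prop :=
  [/\ uniq (unzip1 (code_rotation c)) /\ unzip1 (code_rotation c) =i W,
      forall v l, (v, l) \in code_rotation c ->
        [/\ uniq l, l =i neighbours G W v &
            forall a b d, subseq [:: a; b; d] l ->
              ccw (pos D v) (curve D v a) (curve D v b) (curve D v d)],
      (boundary G W D @` external_face G W D =
         [set listed (code_external c)])%classic &
      (boundary G W D @` (faces G W D `\` external_face G W D) =
         [set listed b | b in [set b | b \in code_internal c]])%classic].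

Definition encodes_embedding (R : realType) (V : finType) (G : sgraph V)
    (W : {set V}) (c : embedding_code V) (phi : set (drawing R V)) : Prop :=
  exists2 D, phi D & describes G W c D.

Section Serialization.
Local Open Scope nat_scope.

(* Lists are preceded by their length. *)
Definition put_seq (T : Type) (put : T -> seq nat) (s : seq T) : seq nat :=
  size s :: flatten (map put s).

Definition put_vertex (n : nat) (v : 'I_n) : seq nat := [:: val v].

Definition put_boundary (n : nat) (b : seq 'I_n * seq ('I_n * 'I_n)) :
    seq nat :=
  put_seq (@put_vertex n) b.1 ++
  put_seq (fun d => put_vertex d.1 ++ put_vertex d.2) b.2.

Definition put_code (n : nat) (c : embedding_code 'I_n) : seq nat :=
  put_seq (fun vl => put_vertex vl.1 ++ put_seq (@put_vertex n) vl.2)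
    (code_rotation c) ++
  put_boundary (code_external c) ++
  put_seq (@put_boundary n) (code_internal c).

Definition adjacency_lists (n : nat) (G : sgraph 'I_n)
    (adj : 'I_n -> seq 'I_n) : Prop :=
  forall v, uniq (adj v) /\ adj v =i G v.

Definition story_input (n : nat) (S : graph_story 'I_n)
    (adj : 'I_n -> seq 'I_n) : seq nat :=
  n :: map val (story_order S) ++
  flatten [seq put_seq (@put_vertex n) (adj v) | v <- enum 'I_n].

(* The concatenated codes of the embeddings phi_omega, ..., phi_n. *)
Definition sequence_output (n : nat) (S : graph_story 'I_n)
    (cs : nat -> embedding_code 'I_n) : seq nat :=
  flatten [seq put_code (cs i) | i <- iota (omega S) (n - omega S).+1].

End Serialization.

(* Random-access machine with unit cost per operation and words bounded by a
   parameter w: a program gets stuck as soon as it handles a number above w. *)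
Section Machine.
Local Open Scope nat_scope.

Inductive expr : Type :=
| Lit of nat
| Fetch of expr
| Plus of expr & expr
| Minus of expr & expr.

Inductive cmd : Type :=
| Skip
| Store of expr & expr
| Emit of expr
| Seq of cmd & cmd
| IfLt of expr & expr & cmd & cmd
| WhileLt of expr & expr & cmd.

Definition memory : Type := nat -> nat.

Fixpoint eval (m : memory) (e : expr) : nat :=
  match e with
  | Lit k => k
  | Fetch a => m (eval m a)
  | Plus a b => eval m a + eval m b
  | Minus a b => eval m a - eval m b
  end.

Fixpoint cost (e : expr) : nat :=
  match e with
  | Lit _ => 1
  | Fetch a => (cost a).+1
  | Plus a b | Minus a b => (cost a + cost b).+1
  end.

Fixpoint fits (w : nat) (m : memory) (e : expr) : bool :=
  (eval m e <= w) &&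
  match e with
  | Lit _ => true
  | Fetch a => fits w m a
  | Plus a b | Minus a b => fits w m a && fits w m b
  end.

Definition update (m : memory) (a x : nat) : memory :=
  fun b => if b == a then x else m b.

(* exec w p m out t m' out': started in memory m with output out, the program
   p halts after t steps in memory m' with output out'. *)
Inductive exec (w : nat) :
    cmd -> memory -> seq nat -> nat -> memory -> seq nat -> Prop :=
| ExecSkip m out : exec w Skip m out 1 m out
| ExecStore a e m out : fits w m a -> fits w m e ->
    exec w (Store a e) m out (cost a + cost e).+1
      (update m (eval m a) (eval m e)) out
| ExecEmit e m out : fits w m e ->
    exec w (Emit e) m out (cost e).+1 m (rcons out (eval m e))
| ExecSeq p q m out t m1 out1 t' m2 out2 :
    exec w p m out t m1 out1 -> exec w q m1 out1 t' m2 out2 ->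
    exec w (Seq p q) m out (t + t') m2 out2
| ExecIf a b p q m out t m1 out1 : fits w m a -> fits w m b ->
    exec w (if eval m a < eval m b then p else q) m out t m1 out1 ->
    exec w (IfLt a b p q) m out (cost a + cost b + t).+1 m1 out1
| ExecWhileStop a b p m out : fits w m a -> fits w m b ->
    eval m b <= eval m a ->
    exec w (WhileLt a b p) m out (cost a + cost b).+1 m out
| ExecWhileStep a b p m out t m1 out1 t' m2 out2 :
    fits w m a -> fits w m b -> eval m a < eval m b ->
    exec w p m out t m1 out1 -> exec w (WhileLt a b p) m1 out1 t' m2 out2 ->
    exec w (WhileLt a b p) m out (cost a + cost b + t + t').+1 m2 out2.

Definition computes_in (w : nat) (p : cmd) (input : seq nat) (t : nat)
    (output : seq nat) : Prop :=
  exists m', exec w p (nth 0 input) [::] t m' output.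

End Machine.

(* Main.v *)
(* Cut the story with at least three vertices on each side: by triconnectivity at
   least three vertices of each side have neighbours on the other one.  Hence a
   window of five vertices that is neither the first nor the last spans at most
   four edges, and all windows span at most six.

   For the realization, the vertex with index [i] is put at the [i mod 5]-th of
   five points around the origin, and each edge is drawn as a polygonal arc around
   the origin in one of at most four ways.  The edges are drawn in the order of the
   story, without ever changing an earlier one: this is a game against the story,
   and a finite list of winning positions, closed under all moves that the counting
   above allows, is checked by computation.

   For the embeddings, every window graph is drawn as a subgraph of a wheel with
   five vertices.  The graph shared by two successive windows has a canonical
   embedding in which the face receiving the vanishing and the new vertex is the
   external one; for each window graph that passes the counting a suitable placement
   on the wheel is found by computation.  Since an embedding depends on ten
   adjacencies only, a program that tests these and writes a constant answer needs
   constant time per window. *)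
Require Import Defs.
From mathcomp Require Import all_boot all_order all_algebra.
From mathcomp Require Import all_classical all_reals all_analysis.
From mathcomp Require Import lra ring zify.

Set Implicit Arguments.
Unset Strict Implicit.
Unset Printing Implicit Defensive.

Import Order.TTheory GRing.Theory Num.Theory.
Import numFieldNormedType.Exports.

Local Open Scope ring_scope.

(** * Cyclic order on a circle *)

(** The two claims call for different methods. A realization never redraws a shared edge, so an edge
    drawn badly could block later windows; the strategy therefore needs states, which record the
    arcs among the last four vertices and how many later neighbours each of these still has.
    Compatibility is only up to equivalence, which decouples successive windows: each is compared
    with an embedding that depends on the shared graph alone.

    The topology is reduced to finite data. On the wheel, a face is a union of cells: explicit
    segments join them across undrawn edges, and the union is relatively open and closed among the
    undrawn points. Rotations and sides of edges, although defined through arbitrary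
    parametrizations and arcs, are read off from first hits on small circles. Arcs around the origin
    are compared by their distances on five rays.

    The bound of four edges involves parity: the degree sum 15 of a window loses at least three on
    each side, and what is left is at most nine and even. *)

Section CyclicOrder.
Variable R : realType.
Implicit Types p a b c d u v w : R * R.

Definition cross u v : R := u.1 * v.2 - u.2 * v.1.

Lemma signed_area_rot a b c : signed_area b c a = signed_area a b c.
Proof. by rewrite /signed_area; ring. Qed.

Lemma signed_area_swapr a b c : signed_area a c b = - signed_area a b c.
Proof. by rewrite /signed_area; ring. Qed.

Lemma signed_area_neq a b c : 0 < signed_area a b c -> b <> a.
Proof. by move=> + e; rewrite e /signed_area !subrr !mul0r subr0 ltxx. Qed.

Lemma sqdist_ge0 p q : 0 <= sqdist p q.
Proof. by rewrite addr_ge0 ?sqr_ge0. Qed.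

Lemma sqdist_gt0 p q : p <> q -> 0 < sqdist p q.
Proof.
case: p q => [x y] [z t] neq; rewrite lt_neqAle sqdist_ge0 andbT eq_sym.
apply/negP; rewrite /sqdist /= paddr_eq0 ?sqr_ge0 // !sqrf_eq0 !subr_eq0.
by case/andP=> /eqP e1 /eqP e2; apply: neq; rewrite e1 e2.
Qed.

Section Circle.
Variables (p : R * R) (r : R).
Hypothesis r_gt0 : 0 < r.
(** Here [r] is the squared radius, as [sqdist] is a squared distance. *)
Definition on_circle a := sqdist p a = r.

(** The angle from [u] to [w] may exceed a half turn, so the sign of its sine is not known; the
    identity used below writes the area with the sines of the two smaller angles only. *)
Lemma cyc_cross u v w : on_circle u -> on_circle v -> on_circle w ->
  0 < cross (u - p) (v - p) -> 0 < cross (v - p) (w - p) ->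
  0 < signed_area u v w.
Proof.
case: u v w => [u1 u2] [v1 v2] [w1 w2].
rewrite /on_circle /cross /signed_area /sqdist /=.
pose a := u1 - p.1; pose b := u2 - p.2; pose c := v1 - p.1; pose d := v2 - p.2.
pose e := w1 - p.1; pose f := w2 - p.2.
have -> : (v1 - u1) * (w2 - u2) - (v2 - u2) * (w1 - u1) =
  (a * d - b * c) + (c * f - d * e) - (a * f - b * e).
  by rewrite /a /b /c /d /e /f; ring.
rewrite -/a -/b -/c -/d -/e -/f => hu hv hw uv vw.
have {}hu : a ^+ 2 + b ^+ 2 = r by rewrite -hu /a /b; ring.
have {}hv : c ^+ 2 + d ^+ 2 = r by rewrite -hv /c /d; ring.
have {}hw : e ^+ 2 + f ^+ 2 = r by rewrite -hw /e /f; ring.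
rewrite -(pmulr_rgt0 _ r_gt0).
(* [sin s + sin t - sin (s + t)
    = sin s * (1 - cos t) + sin t * (1 - cos s)] *)
have -> : r * (a * d - b * c + (c * f - d * e) - (a * f - b * e)) =
  (a * d - b * c) * (r - (c * e + d * f)) +
  (c * f - d * e) * (r - (a * c + b * d)).
  by rewrite -hv; ring.
have key (x y : R) : x ^+ 2 + y ^+ 2 = r ^+ 2 -> 0 < x -> 0 < r - y.
  move=> h x0; rewrite subr_gt0 ltNge; apply/negP => ry.
  have : r ^+ 2 <= y ^+ 2 by rewrite ler_sqr ?nnegrE ?(ltW r_gt0) ?(le_trans (ltW r_gt0)).
  by rewrite -h gerDr leNgt exprn_gt0.
apply: addr_gt0; apply: mulr_gt0 => //.
- apply: (key (c * f - d * e)) => //.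
  have -> : r ^+ 2 = (c ^+ 2 + d ^+ 2) * (e ^+ 2 + f ^+ 2) by rewrite hv hw.
  ring.
- apply: (key (a * d - b * c)) => //.
  have -> : r ^+ 2 = (a ^+ 2 + b ^+ 2) * (c ^+ 2 + d ^+ 2) by rewrite hu hv.
  ring.
Qed.

(** Inversion with centre [a] turns the circle into a line, on which the area of [a], [x], [y]
    divided by [nu x * nu y] measures the signed distance of the images of [x] and [y]. The identity
    below is the additivity of these distances. *)
Lemma cyc_trans a b c d : on_circle a -> on_circle b -> on_circle c ->
  on_circle d -> 0 < signed_area a b c -> 0 < signed_area a c d ->
  0 < signed_area a b d.
Proof.
move=> ha hb hc hd abc acd.
(* the scalar product of [x - a] and [p - a], for [x] on the circle *)
pose nu x := (x.1 - a.1) * (p.1 - a.1) + (x.2 - a.2) * (p.2 - a.2).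
have nu_gt0 x : on_circle x -> x <> a -> 0 < nu x.
  move=> hx xa; rewrite -(pmulr_rgt0 _ (ltr0Sn R 1)).
  suff -> : 2 * nu x = sqdist x a by apply: sqdist_gt0.
  have := hx; rewrite /on_circle -ha /nu /sqdist => e.
  apply/eqP; rewrite -subr_eq0; apply/eqP.
  transitivity ((p.1 - a.1) ^+ 2 + (p.2 - a.2) ^+ 2
    - ((p.1 - x.1) ^+ 2 + (p.2 - x.2) ^+ 2)); first by ring.
  by rewrite e subrr.
have ba := nu_gt0 b hb (signed_area_neq abc).
have ca := nu_gt0 c hc (signed_area_neq acd).
have da : 0 < nu d.
  apply: nu_gt0 => // e; move: acd; rewrite e /signed_area; lra.
rewrite -(pmulr_lgt0 _ ca).
have -> : signed_area a b d * nu c =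
    signed_area a b c * nu d + signed_area a c d * nu b.
  by rewrite /signed_area /nu; ring.
by rewrite addr_gt0 ?mulr_gt0.
Qed.

(* [x] lies between [b] and [c] on the arc that does not contain [a]. *)
Lemma cyc_insert a b c x : on_circle a -> on_circle b -> on_circle c ->
  on_circle x -> 0 < signed_area a b c -> 0 < signed_area b x c ->
  0 < signed_area a b x /\ 0 < signed_area a x c.
Proof.
move=> ha hb hc hx abc bxc; split.
- rewrite -signed_area_rot; apply: (@cyc_trans b x c a) => //.
  by rewrite signed_area_rot.
- rewrite signed_area_rot; apply: (@cyc_trans c a b x) => //.
    by rewrite -signed_area_rot -signed_area_rot signed_area_rot.
  by rewrite -signed_area_rot.
Qed.
End Circle.
End CyclicOrder.

(** * The wheel *)

(* The wheel with hub 4 at the origin and rim 0, 1, 2, 3 at (1, 0), (0, 1),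
   (-1, 0), (0, -1) cuts the plane into vertices, open edges and cells; cell 0 is
   the unbounded one and cell [c] the part of the [c]-th quadrant.  All drawings
   of the second half of the theorem are drawings of subgraphs of this wheel. *)
Inductive stratum := Vtx of nat | Edg of nat & nat | Cel of nat.

Definition edge_of (k l : nat) := if (k < l)%N then Edg k l else Edg l k.

(* Neighbours in counterclockwise order. *)
Definition rotT (k : nat) : seq nat :=
  match k with
  | 0 => [:: 1; 4; 3] | 1 => [:: 2; 4; 0] | 2 => [:: 3; 4; 1]
  | 3 => [:: 0; 4; 2] | 4 => [:: 0; 1; 2; 3] | _ => [::]
  end%N.

(* The cell on the left of the edge from [k] to [l]. *)
Definition leftT (k l : nat) : nat :=
  match k, l with
  | 0, 1 => 1 | 0, 4 => 4 | 0, 3 => 0 | 1, 2 => 2 | 1, 4 => 1 | 1, 0 => 0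
  | 2, 3 => 3 | 2, 4 => 2 | 2, 1 => 0 | 3, 0 => 4 | 3, 4 => 3 | 3, 2 => 0
  | 4, 0 => 1 | 4, 1 => 2 | 4, 2 => 3 | 4, 3 => 4 | _, _ => 5
  end%N.

Definition adjT k l := (l \in rotT k).
Definition nextT k l := next (rotT k) l.

Lemma adjT_cases (k l : nat) (P : nat -> nat -> Prop) :
  P 0%N 1%N -> P 0%N 4%N -> P 0%N 3%N -> P 1%N 2%N -> P 1%N 4%N -> P 1%N 0%N ->
  P 2%N 3%N -> P 2%N 4%N -> P 2%N 1%N -> P 3%N 0%N -> P 3%N 4%N -> P 3%N 2%N ->
  P 4%N 0%N -> P 4%N 1%N -> P 4%N 2%N -> P 4%N 3%N -> adjT k l -> P k l.
Proof.
do 16!move=> ?; rewrite /adjT.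
case: k => [|[|[|[|[|k]]]]] //=; rewrite !inE; do ?[case/orP];
  by move=> /eqP ->.
Qed.

(* [s] is in the closure of [s'] *)
Definition incident s s' : Prop :=
  match s, s' with
  | Vtx k, Vtx l => k = l
  | Vtx k, Edg l m => k = l \/ k = m
  | Vtx k, Cel c => c \in [seq leftT k l | l <- rotT k]
  | Edg k l, Edg m n => k = m /\ l = n
  | Edg k l, Cel c => c = leftT k l \/ c = leftT l k
  | Cel c, Cel d => c = d
  | _, _ => False
  end.

(* The arguments are the signs of [x], [y] and [|x| + |y| - 1], coded by 0, 1, 2. *)
Definition strata_table (sx sy su : nat) : stratum :=
  let mid s s' := if su == 0%N then s else if su == 1%N then s' else Cel 0 in
  match sx, sy with
  | 0, 0 => mid (Cel 3) (Edg 2 3)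
  | 0, 1 => mid (Edg 2 4) (Vtx 2)
  | 0, _ => mid (Cel 2) (Edg 1 2)
  | 1, 0 => mid (Edg 3 4) (Vtx 3)
  | 1, 1 => Vtx 4
  | 1, _ => mid (Edg 1 4) (Vtx 1)
  | _, 0 => mid (Cel 4) (Edg 0 3)
  | _, 1 => mid (Edg 0 4) (Vtx 0)
  | _, _ => mid (Cel 1) (Edg 0 1)
  end%N.

(** Near a point its nonzero signs persist while a zero sign may become anything. The implication
    excludes triples that belong to no point: at the origin the third sign is negative. *)
Lemma strata_refine (a b c a' b' c' : nat) : (a' < 3)%N -> (b' < 3)%N ->
  (c' < 3)%N -> (a == 1%N) && (b == 1%N) ==> (c == 0%N) ->
  (a != 1%N -> a' = a) -> (b != 1%N -> b' = b) -> (c != 1%N -> c' = c) ->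
  incident (strata_table a b c) (strata_table a' b' c').
Proof.
have split1 d d' : (d' < 3)%N -> (d != 1%N -> d' = d) ->
    d' = d \/ d = 1%N /\ (d' = 0%N \/ d' = 2%N).
  case: (eqVneq d 1%N) => [-> | _ _ /(_ isT) ->]; last by left.
  by case: d' => [|[|[|]]] //; auto.
move=> /split1 A /split1 B /split1 C + /A {}A /B {}B /C {}C.
case: A => [?|[? A]]; case: B => [?|[? B]]; case: C => [?|[? C]]; subst=> //=.
all: try (case: A => ->); try (case: B => ->); try (case: C => ->).
all: try (case: a => [|[|a]]); try (case: b => [|[|b]]);
  try (case: c => [|[|c]]); rewrite //=; by [left | right].
Qed.

Section Strata.
Variable R : realType.
Implicit Types (x y : R) (p q : R * R) (s : stratum) (k l : nat).

Definition ptT k : R * R :=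
  match k with
  | 0%N => (1, 0) | 1%N => (0, 1) | 2%N => (- 1, 0) | 3%N => (0, - 1)
  | _ => (0, 0)
  end.

Definition sign3 x : nat := if x < 0 then 0 else if x == 0 then 1 else 2.

Definition level p : R := `|p.1| + `|p.2| - 1.

Definition loc p : stratum :=
  strata_table (sign3 p.1) (sign3 p.2) (sign3 (level p)).

Variant sign3_spec x : nat -> Prop :=
  | Sign3Neg of x < 0 : sign3_spec x 0
  | Sign3Zero of x = 0 : sign3_spec x 1
  | Sign3Pos of 0 < x : sign3_spec x 2.

Lemma sign3P x : sign3_spec x (sign3 x).
Proof. by rewrite /sign3; case: (ltrgtP x 0) => ?; constructor. Qed.

Lemma sign3_lt x : (sign3 x < 3)%N.
Proof. by case: sign3P. Qed.

Lemma sign3_neg x : x < 0 -> sign3 x = 0%N.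
Proof. by rewrite /sign3 => ->. Qed.

Lemma sign3_pos x : 0 < x -> sign3 x = 2%N.
Proof. by move=> x0; rewrite /sign3 ltNge ltW //= gt_eqF. Qed.

Lemma sign3_0 : sign3 0 = 1%N.
Proof. by rewrite /sign3 ltxx eqxx. Qed.

Lemma loc_ptT k : (k < 5)%N -> loc (ptT k) = Vtx k.
Proof.
case: k => [|[|[|[|[|//]]]]] _; rewrite /loc /level /= ?normrN ?normr1 ?normr0
  ?addr0 ?add0r ?subrr ?sign3_0 ?(sign3_neg (ltrN10 R)) ?(sign3_pos ltr01) //.
Qed.

Lemma level_origin : level (0, 0) < 0.
Proof. by rewrite /level /= normr0 addr0 add0r ltrN10. Qed.

Lemma loc_incident p : \forall q \near p, incident (loc p) (loc q).
Proof.
have near_sign (f : R * R -> R) : {for p, continuous f} ->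
    \forall q \near p, sign3 (f p) != 1%N -> sign3 (f q) = sign3 (f p).
  move=> cf; case: sign3P => fp; last 2 first.
  - by near=> q.
  - near=> q => _; apply: sign3_pos; near: q; exact: (cvgr_gt (f p)).
  - near=> q => _; apply: sign3_neg; near: q; exact: (cvgr_lt (f p)).
have c1 : {for p, continuous (fun q : R * R => q.1)} by exact: cvg_fst.
have c2 : {for p, continuous (fun q : R * R => q.2)} by exact: cvg_snd.
have c3 : {for p, continuous level}.
  by apply: cvgB; [apply: cvgD; apply: cvg_norm | exact: cvg_cst].
have : (sign3 p.1 == 1%N) && (sign3 p.2 == 1%N) ==> (sign3 (level p) == 0%N).
  case: (p) => x y /=.
  case: (sign3P x) => [?|->|?]; case: (sign3P y) => [?|->|?];
    case: (sign3P (level _)) => //= h; exfalso; move: level_origin;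
    by rewrite ?h ?ltxx // ltNge ltW.
move=> cons; near=> q.
have h1 : sign3 p.1 != 1%N -> sign3 q.1 = sign3 p.1.
  by near: q; exact: (near_sign _ c1).
have h2 : sign3 p.2 != 1%N -> sign3 q.2 = sign3 p.2.
  by near: q; exact: (near_sign _ c2).
have h3 : sign3 (level p) != 1%N -> sign3 (level q) = sign3 (level p).
  by near: q; exact: (near_sign _ c3).
exact: (strata_refine (sign3_lt _) (sign3_lt _) (sign3_lt _) cons).
Unshelve. all: by end_near. Qed.

End Strata.

Section StrataInequalities.
Variable R : realType.
Implicit Types (x y c : R) (p q : R * R) (s : stratum) (k l : nat).

(** The strata as linear inequalities, within reach of [lra]; only the unbounded cell, which is not
    convex, keeps its absolute values. *)
Definition at_stratum s p : Prop :=
  let: (x, y) := p in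
  match s with
  | Cel 0%N => 1 < `|x| + `|y|
  | Cel 1%N => [/\ 0 < x, 0 < y & x + y < 1]
  | Cel 2%N => [/\ x < 0, 0 < y & - x + y < 1]
  | Cel 3%N => [/\ x < 0, y < 0 & - x - y < 1]
  | Cel 4%N => [/\ 0 < x, y < 0 & x - y < 1]
  | Edg 0%N 1%N => [/\ 0 < x, 0 < y & x + y = 1]
  | Edg 1%N 2%N => [/\ x < 0, 0 < y & - x + y = 1]
  | Edg 2%N 3%N => [/\ x < 0, y < 0 & - x - y = 1]
  | Edg 0%N 3%N => [/\ 0 < x, y < 0 & x - y = 1]
  | Edg 0%N 4%N => [/\ 0 < x, y = 0 & x < 1]
  | Edg 1%N 4%N => [/\ x = 0, 0 < y & y < 1]
  | Edg 2%N 4%N => [/\ x < 0, y = 0 & - x < 1]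
  | Edg 3%N 4%N => [/\ x = 0, y < 0 & - y < 1]
  | Vtx k => (k < 5)%N /\ (x, y) = ptT R k
  | _ => False
  end.

Lemma loc_at p : at_stratum (loc p) p.
Proof.
case: p => x y; rewrite /loc /level /=.
case: (sign3P x) => [x0|->|x0]; case: (sign3P y) => [y0|->|y0];
  rewrite ?normr0 ?(gtr0_norm x0) ?(ltr0_norm x0) ?(gtr0_norm y0)
    ?(ltr0_norm y0) ?add0r ?addr0 ?sub0r ?ltrN10;
  case: sign3P => [h|/eqP h|h] //=;
  try (move: h; rewrite ?subr_lt0 ?subr_gt0 ?subr_eq0) => /= h;
  rewrite ?normr0 ?(gtr0_norm x0) ?(ltr0_norm x0) ?(gtr0_norm y0)
    ?(ltr0_norm y0) ?add0r ?addr0 ?sub0r //.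
all: try (by split=> //; apply/eqP).
all: try (by split=> //; rewrite -?(eqP h) ?opprK).
Qed.

Lemma at_loc s p : at_stratum s p -> loc p = s.
Proof.
case: p => x y.
have out : 1 < `|x| + `|y| -> loc (x, y) = Cel 0.
  move=> h; rewrite /loc /level /= (@sign3_pos R (_ - 1)) ?subr_gt0 //.
  by move: h; case: (sign3P x) => [?|->|?]; case: (sign3P y) => [?|->|?] //;
    rewrite normr0 addr0 ltr10.
case: s => [k|[|[|[|[|k]]]] [|[|[|[|[|l]]]]]|[|[|[|[|[|k]]]]]] //=;
  try exact: out.
- by case=> k5 ->; exact: loc_ptT.
all: rewrite /loc /level /=; case=> h1 h2 h3;
  rewrite ?h1 ?h2 ?normr0 ?sign3_0 ?(sign3_neg h1) ?(sign3_neg h2)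
    ?(sign3_pos h1) ?(sign3_pos h2) ?(gtr0_norm h1) ?(gtr0_norm h2)
    ?(ltr0_norm h1) ?(ltr0_norm h2) ?add0r ?addr0 ?h3 ?subrr ?sign3_0
    ?(@sign3_neg R (_ - 1)) ?subr_lt0 //.
Qed.

Definition ray k l c : R * R :=
  ((ptT R k).1 + c * ((ptT R l).1 - (ptT R k).1),
   (ptT R k).2 + c * ((ptT R l).2 - (ptT R k).2)).

Lemma edge_of_sym k l : edge_of k l = edge_of l k.
Proof. by rewrite /edge_of; case: ltngtP => // ->. Qed.

Lemma loc_ray k l c : adjT k l -> 0 < c < 1 -> loc (ray k l c) = edge_of k l.
Proof.
move=> + /andP[c0 c1]; elim/adjT_cases; apply: at_loc; rewrite /ray /=;
  by split; lra.
Qed.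

Lemma edge_ray k l q : adjT k l -> loc q = edge_of k l ->
  exists2 c, 0 < c < 1 & q = ray k l c.
Proof.
have := loc_at q; case: q => x y + kl e; rewrite e.
have sol (c : R) : 0 < c -> c < 1 -> (x, y) = ray k l c ->
    exists2 c, 0 < c < 1 & (x, y) = ray k l c.
  by move=> ? ? ?; exists c => //; apply/andP.
move: kl e sol; rewrite /ray; elim/adjT_cases => /= _ sol [h1 h2 h3].
- by apply: (sol y); rewrite ?h2; [lra.. | congr (_, _); lra].
- by apply: (sol (1 - x)); [lra.. | congr (_, _); lra].
- by apply: (sol (- y)); [lra.. | congr (_, _); lra].
- by apply: (sol (- x)); [lra.. | congr (_, _); lra].
- by apply: (sol (1 - y)); [lra.. | congr (_, _); lra].
- by apply: (sol x); [lra.. | congr (_, _); lra].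
- by apply: (sol (- y)); [lra.. | congr (_, _); lra].
- by apply: (sol (1 + x)); [lra.. | congr (_, _); lra].
- by apply: (sol y); [lra.. | congr (_, _); lra].
- by apply: (sol x); [lra.. | congr (_, _); lra].
- by apply: (sol (1 + y)); [lra.. | congr (_, _); lra].
- by apply: (sol (- x)); [lra.. | congr (_, _); lra].
- by apply: (sol x); [lra.. | congr (_, _); lra].
- by apply: (sol y); [lra.. | congr (_, _); lra].
- by apply: (sol (- x)); [lra.. | congr (_, _); lra].
- by apply: (sol (- y)); [lra.. | congr (_, _); lra].
Qed.

End StrataInequalities.

(** * Counterclockwise order around a vertex of the wheel *)

Section Sectors.
Variable R : realType.
Implicit Types (x y c : R) (p q d e f : R * R) (s : stratum) (k l : nat).

(** Counterclockwise order of three directions: the three turns add up to a full turn, so at least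
    two of them are less than a half turn. *)
Definition turns d e f := [\/ 0 < cross d e /\ 0 < cross e f,
  0 < cross e f /\ 0 < cross f d | 0 < cross f d /\ 0 < cross d e].

Lemma cyc_turns p r u v w : 0 < r -> on_circle p r u -> on_circle p r v ->
  on_circle p r w -> turns (u - p) (v - p) (w - p) -> 0 < signed_area u v w.
Proof.
move=> r0 hu hv hw [] [h1 h2].
- exact: (cyc_cross r0 hu hv hw).
- by rewrite -signed_area_rot; apply: (cyc_cross r0 hv hw hu).
- by rewrite signed_area_rot; apply: (cyc_cross r0 hw hu hv).
Qed.

Definition dir k l : R * R := ptT R l - ptT R k.

Lemma cross_rayl k l c e : cross (ray k l c - ptT R k) e = c * cross (dir k l) e.
Proof. by rewrite /cross /ray /=; ring. Qed.

Lemma cross_rayr k l c e : cross e (ray k l c - ptT R k) = c * cross e (dir k l).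
Proof. by rewrite /cross /ray /=; ring. Qed.

Lemma near_bounds p q : sqdist p q < 1 / 16 ->
  [/\ - (1 / 4) < q.1 - p.1, q.1 - p.1 < 1 / 4,
      - (1 / 4) < q.2 - p.2 & q.2 - p.2 < 1 / 4].
Proof.
have key (a b : R) : a ^+ 2 + b ^+ 2 < 1 / 16 -> - (1 / 4) < a /\ a < 1 / 4.
  have := sqr_ge0 b; move=> ? h; split; nra.
rewrite /sqdist => h; have := key _ _ h; rewrite addrC in h.
by have := key _ _ h; move=> [? ?] [? ?]; split; lra.
Qed.

(** Bounded cells have an angle below a half turn at the vertex, which gives the first disjunct. The
    outer cell has a reflex angle, so there the disjunct depends on the position of [q]. *)
Lemma cell_turns k l q : adjT k l -> sqdist (ptT R k) q < 1 / 16 ->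
  loc q = Cel (leftT k l) ->
  turns (dir k l) (q - ptT R k) (dir k (nextT k l)).
Proof.
move=> + /near_bounds; have := loc_at q; case: q => x y + + + e; rewrite e {e}.
move=> + kl; move: kl; rewrite /turns /cross /dir.
elim/adjT_cases => /=.
all: try (case=> h1 h2 h3 [? ? ? ?]; apply: Or31; split; lra).
all: move=> + [? ? ? ?]; rewrite /nextT /=.
all: have [x0|x0] := ltP x 0; have [y0|y0] := ltP y 0;
  rewrite ?(ltr0_norm x0) ?(ger0_norm x0) ?(ltr0_norm y0) ?(ger0_norm y0) => h;
  first [apply: Or32; split; lra | apply: Or33; split; lra | exfalso; lra].
Qed.

Lemma ray_turns k l : adjT k l ->
  turns (dir k l) (dir k (nextT k l)) (dir k (nextT k (nextT k l))).
Proof.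
rewrite /turns /cross /dir /nextT; elim/adjT_cases => /=;
  first [by apply: Or31; split; lra | by apply: Or32; split; lra
    | by apply: Or33; split; lra].
Qed.

Lemma turns_scale d e f d' f' c c' : 0 < c -> 0 < c' ->
  (forall g, cross d' g = c * cross d g) ->
  (forall g, cross g d' = c * cross g d) ->
  (forall g, cross f' g = c' * cross f g) ->
  (forall g, cross g f' = c' * cross g f) ->
  turns d e f -> turns d' e f'.
Proof.
move=> c0 c0' dl dr fl fr; rewrite /turns !dl !fr fl dr !pmulr_rgt0 ?mulr_gt0 //.
Qed.

Section AroundVertex.
Variables (k : nat) (r : R).
Hypothesis r0 : 0 < r.
Let circ := on_circle (ptT R k) r.

Lemma cyc_cell l c c' q : adjT k l -> 0 < c -> 0 < c' -> r < 1 / 16 ->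
  circ (ray k l c) -> circ q -> circ (ray k (nextT k l) c') ->
  loc q = Cel (leftT k l) ->
  0 < signed_area (ray k l c) q (ray k (nextT k l) c').
Proof.
move=> kl c0 c0' r16 hl hq hl' lq; apply: (cyc_turns r0 hl hq hl').
apply: (turns_scale c0 c0' (cross_rayl _ _ _) (fun g => cross_rayr _ _ _ g)
  (cross_rayl _ _ _) (fun g => cross_rayr _ _ _ g)).
by apply: cell_turns => //; rewrite hq.
Qed.

Lemma cyc_rays l c c' c'' : adjT k l -> 0 < c -> 0 < c' -> 0 < c'' ->
  let l' := nextT k l in let l'' := nextT k l' in
  circ (ray k l c) -> circ (ray k l' c') -> circ (ray k l'' c'') ->
  0 < signed_area (ray k l c) (ray k l' c') (ray k l'' c'').
Proof.
move=> kl c0 c0' c0'' l' l'' h h' h''; apply: (cyc_turns r0 h h' h'').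
apply: (turns_scale c0 c0'' (cross_rayl _ _ _) (fun g => cross_rayr _ _ _ g)
  (cross_rayl _ _ _) (fun g => cross_rayr _ _ _ g)).
have := ray_turns kl; rewrite /turns !cross_rayl !cross_rayr.
by rewrite !pmulr_rgt0.
Qed.
End AroundVertex.
End Sectors.

Lemma nextT_adj k l : adjT k l -> adjT k (nextT k l).
Proof. by rewrite /nextT; elim/adjT_cases. Qed.

Lemma adjT_sym k l : adjT k l -> adjT l k.
Proof. by elim/adjT_cases. Qed.

Lemma adjT_lt k l : adjT k l -> (k < 5)%N /\ (l < 5)%N.
Proof. by elim/adjT_cases. Qed.

Lemma left_next k l : adjT k l -> leftT (nextT k l) k = leftT k l.
Proof. by rewrite /nextT; elim/adjT_cases. Qed.

Lemma leftT_lt k l : adjT k l -> (leftT k l < 5)%N.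
Proof. by elim/adjT_cases. Qed.

(* The neighbours met counterclockwise around [k], starting after [l]. *)
Lemma around k l m : adjT k l -> adjT k m ->
  let l1 := nextT k l in let l2 := nextT k l1 in let l3 := nextT k l2 in
  [\/ m = l, m = l1, l2 <> l /\ m = l2 | [/\ l2 <> l, l3 <> l & m = l3]].
Proof.
have mem (n : nat) : (m \in [:: n]) = (m == n) by rewrite inE.
rewrite /adjT; elim/adjT_cases; rewrite /nextT /= !inE;
  do ?[case/orP]; move=> /eqP ->; by [constructor 1 | constructor 2
    | constructor 3 | constructor 4].
Qed.

Lemma next_neq k l : adjT k l -> nextT k l <> l /\ nextT k (nextT k l) <> l.
Proof. by rewrite /nextT; elim/adjT_cases. Qed.

Lemma next4 k l : adjT k l -> nextT k (nextT k (nextT k l)) <> l ->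
  nextT k (nextT k (nextT k (nextT k l))) = l.
Proof. by rewrite /nextT; elim/adjT_cases. Qed.

Section AroundVertex.
Variable R : realType.
Variables (k : nat) (r : R) (c : nat -> R).
Hypotheses (r0 : 0 < r) (r16 : r < 1 / 16).
Let circ := on_circle (ptT R k) r.
Hypothesis c_gt0 : forall m, adjT k m -> 0 < c m.
Hypothesis circ_ray : forall m, adjT k m -> circ (ray k m (c m)).
Let u m := ray k m (c m).
Let C x y z := 0 < @signed_area R x y z.

Let rotC x y z : C x y z -> C y z x.
Proof. by rewrite /C -(signed_area_rot x y z). Qed.

Lemma order12 l : adjT k l -> C (u l) (u (nextT k l)) (u (nextT k (nextT k l))).
Proof.
move=> kl; have kl1 := nextT_adj kl; have kl2 := nextT_adj kl1.
by apply: (cyc_rays r0) => //; by [apply: c_gt0 | apply: circ_ray].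
Qed.

Lemma order23 l : adjT k l ->
  let l2 := nextT k (nextT k l) in let l3 := nextT k l2 in
  l3 <> l -> C (u l) (u l2) (u l3).
Proof.
move=> kl l2 l3 l3l; have kl2 := nextT_adj (nextT_adj kl).
by have := order12 kl2; rewrite -/l3 (next4 kl l3l) => /rotC /rotC.
Qed.

Lemma order13 l : adjT k l ->
  let l1 := nextT k l in let l3 := nextT k (nextT k l1) in
  l3 <> l -> C (u l) (u l1) (u l3).
Proof.
move=> kl l1 l3 l3l; have kl3 := nextT_adj (nextT_adj (nextT_adj kl)).
by have := order12 kl3; rewrite (next4 kl l3l) => /rotC.
Qed.

Lemma cell_next l q : adjT k l -> circ q -> loc q = Cel (leftT k l) ->
  C (u l) q (u (nextT k l)).
Proof.
move=> kl hq lq; have kl1 := nextT_adj kl.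
by apply: (cyc_cell r0) => //; by [apply: c_gt0 | apply: circ_ray].
Qed.

Lemma cell_before l m q : adjT k l -> adjT k m -> m <> l -> circ q ->
  loc q = Cel (leftT k l) -> C (u l) q (u m).
Proof.
move=> kl km ml hq lq; have kl1 := nextT_adj kl.
have h1 := cell_next kl hq lq.
have tr m' : adjT k m' -> C (u l) (u (nextT k l)) (u m') -> C (u l) q (u m').
  by move=> km'; apply: cyc_trans h1; [exact: circ_ray| |exact: circ_ray..].
case: (around kl km) => [//|->//|[l2 e]|[l2 l3 e]]; apply: tr => //; rewrite e.
  exact: order12.
exact: order13.
Qed.

Lemma cell_after l q : adjT k l -> circ q ->
  let l1 := nextT k l in let l2 := nextT k l1 in let l3 := nextT k l2 in
  [/\ loc q = Cel (leftT k l1) -> C (u l) (u l1) q,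
      l2 <> l -> loc q = Cel (leftT k l2) ->
        C (u l) (u l1) q /\ C (u l) (u l2) q
    & l2 <> l -> l3 <> l -> loc q = Cel (leftT k l3) ->
        [/\ C (u l) (u l1) q, C (u l) (u l2) q & C (u l) (u l3) q]].
Proof.
move=> kl hq l1 l2 l3.
have kl1 : adjT k l1 := nextT_adj kl; have kl2 : adjT k l2 := nextT_adj kl1.
have kl3 : adjT k l3 := nextT_adj kl2.
have cu m : adjT k m -> circ (u m) by exact: circ_ray.
have ins m m' : adjT k m -> adjT k m' -> C (u l) (u m) (u m') ->
    C (u m) q (u m') -> C (u l) (u m) q.
  move=> km km' h h'.
  by have [] := @cyc_insert _ _ r (u l) (u m) (u m') q
    (cu _ kl) (cu _ km) (cu _ km') hq h h'.
have tr m m' : adjT k m -> adjT k m' -> C (u l) (u m) (u m') ->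
    C (u l) (u m') q -> C (u l) (u m) q.
  by move=> km km'; apply: cyc_trans; [exact: cu..|].
split=> [lq|l2l lq|l2l l3l lq].
- exact: (ins l1 l2) (order12 kl) (cell_next kl1 hq lq).
- suff h : C (u l) (u l2) q by split=> //; apply: (tr l1 l2) (order12 kl) h.
  have [l3l|/eqP l3l] := eqVneq l3 l.
    by have := cell_next kl2 hq lq; rewrite -/l3 l3l => /rotC /rotC.
  exact: (ins l2 l3) (order23 kl l3l) (cell_next kl2 hq lq).
- have h : C (u l) (u l3) q.
    by have := cell_next kl3 hq lq; rewrite (next4 kl l3l) => /rotC /rotC.
  split=> //; first exact: (tr l1 l3) (order13 kl l3l) h.
  exact: (tr l2 l3) (order23 kl l3l) h.
Qed.

Lemma circ_ray_inj m d : adjT k m -> 0 < d -> circ (ray k m d) -> ray k m d = u m.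
Proof.
move=> km d0 hd; suff -> : d = c m by [].
have c0 := c_gt0 km; have := circ_ray km; move: hd.
rewrite /circ /on_circle => {1}<- /eqP; rewrite -subr_eq0.
have -> : sqdist (ptT R k) (ray k m (c m)) - sqdist (ptT R k) (ray k m d) =
    (c m - d) * ((c m + d) * sqdist (ptT R k) (ptT R m)).
  by rewrite /sqdist /ray /=; ring.
rewrite !mulf_eq0 subr_eq0 => /orP[/eqP -> //|/orP[|]].
  by rewrite paddr_eq0 ?ltW // gt_eqF.
by rewrite gt_eqF //; move: km; elim/adjT_cases; rewrite /sqdist /=; lra.
Qed.

(** If [q] comes before the first drawn edge after [l], then only undrawn edges separate it from the
    cell on the left of [l], and crossing these does not change the label. The last three premises
    ask this for the first drawn edge only, so that a single radius suffices when [q] lies on an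
    arbitrary arc. *)
Lemma directly_after (E : nat -> bool) (lab : nat -> nat) l m q :
  (forall m, adjT k m -> ~~ E m -> lab (leftT k m) = lab (leftT m k)) ->
  adjT k l -> adjT k m -> E l -> circ q ->
  loc q = Cel (leftT k m) \/ loc q = edge_of k m /\ ~~ E m ->
  let l1 := nextT k l in let l2 := nextT k l1 in let l3 := nextT k l2 in
  (E l1 -> C (u l) q (u l1)) ->
  (~~ E l1 -> E l2 -> l2 <> l -> C (u l) q (u l2)) ->
  (~~ E l1 -> ~~ E l2 -> E l3 -> l2 <> l -> l3 <> l -> C (u l) q (u l3)) ->
  lab (leftT k m) = lab (leftT k l).
Proof.
move=> labE kl km El hq lq l1 l2 l3 C1 C2 C3.
have kl1 : adjT k l1 := nextT_adj kl; have kl2 : adjT k l2 := nextT_adj kl1.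
have kl3 : adjT k l3 := nextT_adj kl2.
have undrawn m' : C (u l) (u m') q -> (E m' -> C (u l) q (u m')) -> ~~ E m'.
  move=> h h'; apply/negP => /h'.
  by rewrite /C signed_area_swapr oppr_gt0 ltNge (ltW h).
have step m' : adjT k m' -> ~~ E (nextT k m') ->
    lab (leftT k (nextT k m')) = lab (leftT k m').
  by move=> km' Em'; rewrite labE ?left_next //; exact: nextT_adj.
have on_edge : loc q = edge_of k m -> q = u m.
  move=> e; have [d /andP[d0 _] qd] := edge_ray km e.
  by rewrite qd; apply: circ_ray_inj => //; rewrite -qd.
have [h1 h2 h3] := cell_after kl hq; rewrite -/l1 -/l2 -/l3 in h1 h2 h3.
have s1 : ~~ E l1 -> lab (leftT k l1) = lab (leftT k l) by exact: step.
have s2 : ~~ E l2 -> lab (leftT k l2) = lab (leftT k l1) by exact: step.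
have s3 : ~~ E l3 -> lab (leftT k l3) = lab (leftT k l2) by exact: step.
case: (around kl km) => [e|e|[l2l e]|[l2l l3l e]]; rewrite -/l1 -/l2 -/l3 in e *;
  rewrite {}e in lq on_edge *.
- by [].
- apply: s1; case: lq => [lq|[]//]; exact: undrawn (h1 lq) C1.
- case: lq => [lq|[lq El2]].
    have [i1 i2] := h2 l2l lq; have e1 := undrawn _ i1 C1.
    by rewrite s2 ?s1 //; apply: undrawn i2 _ => El2; exact: C2.
  rewrite s2 // s1 //; apply: undrawn C1; rewrite on_edge //.
  exact: order12.
- case: lq => [lq|[lq El3]].
    have [i1 i2 i3] := h3 l2l l3l lq; have e1 := undrawn _ i1 C1.
    have e2 : ~~ E l2 by apply: undrawn i2 _ => El2; exact: C2.
    by rewrite s3 ?s2 ?s1 //; apply: undrawn i3 _ => El3; exact: C3.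
  have e1 : ~~ E l1 by apply: undrawn C1; rewrite on_edge //; exact: order13.
  rewrite s3 // s2 ?s1 //; apply: undrawn; last by move=> El2; exact: C2.
  by rewrite on_edge //; exact: order23.
Qed.
End AroundVertex.

(** If no edge at [k] other than that to [l] is drawn, one can walk around [k] from one side of this
    edge to the other across undrawn edges. *)
Lemma labels_around (k : nat) (E : nat -> bool) (lab : nat -> nat) l m :
  (forall m, adjT k m -> ~~ E m -> lab (leftT k m) = lab (leftT m k)) ->
  adjT k l -> adjT k m -> (forall m, adjT k m -> m <> l -> ~~ E m) ->
  lab (leftT k m) = lab (leftT k l).
Proof.
move=> labE kl km hE.
have step m' : adjT k m' -> nextT k m' <> l ->
    lab (leftT k (nextT k m')) = lab (leftT k m').
  move=> km' m'l; have km1 := nextT_adj km'.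
  by rewrite labE ?left_next //; exact: hE.
have kl1 := nextT_adj kl; have kl2 := nextT_adj kl1.
have [l1l _] := next_neq kl.
case: (around kl km) => [->|->|[l2l ->]|[l2l l3l ->]] //; rewrite ?step //.
Qed.

Local Close Scope ring_scope.
Local Open Scope classical_set_scope.
Local Open Scope ring_scope.

(** * Drawings on the wheel *)

Section Segments.
Variable R : realType.
Implicit Types (a b p q : R * R) (t r : R) (A U : set (R * R)).

Definition seg a b t : R * R := (a.1 + t * (b.1 - a.1), a.2 + t * (b.2 - a.2)).

Definition segment_set a b : set (R * R) := seg a b @` `[0, 1].

Lemma seg0 a b : seg a b 0 = a.
Proof. by rewrite /seg !mul0r !addr0; case: a. Qed.

Lemma seg1 a b : seg a b 1 = b.
Proof. by rewrite /seg !mul1r ![_ + (_ - _)]addrC !subrK; case: b. Qed.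

Lemma seg_sym a b t : seg b a (1 - t) = seg a b t.
Proof. by rewrite /seg; congr (_, _); ring. Qed.

Lemma segment_set_sym a b : segment_set a b = segment_set b a.
Proof.
apply/seteqP; split=> _ [t /= t01 <-]; (exists (1 - t); last exact: seg_sym);
  by move: t01; rewrite /= !in_itv /= subr_ge0 gerBl andbC.
Qed.

Lemma sqdist_seg a b t : sqdist a (seg a b t) = t ^+ 2 * sqdist a b.
Proof. by rewrite /sqdist /seg /=; ring. Qed.

Lemma pair_continuous (f g : R -> R) : continuous f -> continuous g ->
  continuous (fun t => (f t, g t)).
Proof.
move=> cf cg t; exact: (@cvg_pair _ _ _ (nbhs t) (nbhs (f t)) (nbhs (g t))
  _ _ _ f g (cf t) (cg t)).
Qed.

Lemma seg_continuous a b : continuous (seg a b).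
Proof.
have lin (c d : R) : continuous (fun t : R => c + t * d).
  move=> t; apply: (@cvgD _ _ _ _ _ (fun=> c) (fun t => t * d));
    by [exact: cvg_cst | exact: mulrr_continuous].
exact: pair_continuous.
Qed.

Lemma seg_inj a b : a <> b -> injective (seg a b).
Proof.
move=> ab t t' [/addrI h1 /addrI h2]; have [//|tt'] := eqVneq t t'.
have sub0 x : t * x = t' * x -> x = 0.
  move/eqP; rewrite -subr_eq0 -mulrBl mulf_eq0 subr_eq0 (negbTE tt') /=.
  by move/eqP.
by exfalso; apply: ab; case: a b h1 h2 => ? ? [? ?] /= /sub0/subr0_eq -> /sub0/subr0_eq ->.
Qed.

Lemma seg_parametrizes a b : a <> b ->
  parametrizes (seg a b) (segment_set a b) a b.
Proof.
move=> ab; split; rewrite ?seg0 ?seg1 //.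
- exact/continuous_subspaceT/seg_continuous.
- by move=> ? ? _ _; exact: seg_inj.
Qed.

Lemma seg_jordan_arc a b : a <> b -> jordan_arc (segment_set a b) a b.
Proof. by move=> ab; exists (seg a b); exact: seg_parametrizes. Qed.

Lemma seg_first_hit a b r : a <> b -> 0 < r -> r ^+ 2 <= sqdist a b ->
  first_hit a (segment_set a b) r (seg a b (r / Num.sqrt (sqdist a b))).
Proof.
move=> ab r0 rab; have d0 := sqdist_gt0 ab.
have s0 : 0 < Num.sqrt (sqdist a b) by rewrite sqrtr_gt0.
have hit : sqdist a (seg a b (r / Num.sqrt (sqdist a b))) = r ^+ 2.
  rewrite sqdist_seg expr_div_n sqr_sqrtr ?ltW // divfK ?gt_eqF //.
exists (seg a b), b, (r / Num.sqrt (sqdist a b)); split=> //.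
- exact: seg_parametrizes.
- apply/andP; split; first by rewrite divr_ge0 // ltW.
  rewrite ler_pdivrMr // mul1r -(@ler_pXn2r _ 2) ?nnegrE ?(ltW r0) ?(ltW s0) //.
  by rewrite sqr_sqrtr // ltW.
- move=> t /andP[t0 tr]; rewrite -hit !sqdist_seg ltr_pM2r //.
  by rewrite ltr_pXn2r // nnegrE // divr_ge0 // ltW.
Qed.

Lemma seg_component U a b : (forall t, 0 <= t <= 1 -> U (seg a b t)) ->
  connected_component U a b.
Proof.
move=> h; apply: (@connected_component_max _ U (segment_set a b)).
- by exists 0; rewrite ?seg0 //= in_itv /= lexx ler01.
- by move=> _ [t /= t01 <-]; apply: h; rewrite in_itv in t01.
- apply: connected_continuous_connected; first exact: segment_connected.
  exact/continuous_subspaceT/seg_continuous.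
- by exists 1; rewrite ?seg1 //= in_itv /= lexx ler01.
Qed.

End Segments.

Lemma edge_of_inj k l m n : adjT k l -> adjT m n -> edge_of k l = edge_of m n ->
  (k = m /\ l = n) \/ (k = n /\ l = m).
Proof.
move=> kl mn; rewrite /edge_of.
by case: ltngtP => ?; case: ltngtP => ? // [-> ->]; subst; auto.
Qed.

Definition cell_of (s : stratum) : nat :=
  match s with
  | Vtx k => leftT k (head 0%N (rotT k)) | Edg k l => leftT k l | Cel c => c
  end.

Definition well_formed s :=
  match s with
  | Vtx k => (k < 5)%N | Edg k l => adjT k l && (k < l)%N | Cel c => (c < 5)%N
  end.

Lemma loc_well_formed (R : realType) (p : R * R) : well_formed (loc p).
Proof.
have := loc_at p; case: p => x y; case: (loc _) => [k|k l|c] /=.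
- by case.
- by case: k => [|[|[|[|k]]]] //; case: l => [|[|[|[|[|l]]]]].
- by case: c => [|[|[|[|[|c]]]]].
Qed.

Lemma loc_Vtx (R : realType) (p : R * R) k : loc p = Vtx k -> p = ptT R k.
Proof. by have := loc_at p; case: p => x y + e; rewrite e => -[]. Qed.

Section WheelDrawing.
Variables (R : realType) (V : finType) (G : sgraph V) (W : {set V}).
Variable pi : V -> nat.
Implicit Types (u v w : V) (k l m c : nat) (p q : R * R).

Definition wheel_drawing : drawing R V :=
  Drawing (fun v => ptT R (pi v))
    (fun u v => segment_set (ptT R (pi u)) (ptT R (pi v))).
Let D := wheel_drawing.

Hypothesis pi_inj : {in W &, injective pi}.
Hypothesis pi_lt : forall v, v \in W -> (pi v < 5)%N.
Hypothesis pi_adj : forall u v, u \in W -> v \in W -> G u v -> adjT (pi u) (pi v).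

Lemma ptT_neq k l : adjT k l -> ptT R k <> ptT R l.
Proof.
move=> kl e; have [k5 l5] := adjT_lt kl.
have := loc_ptT R k5; rewrite e loc_ptT // => -[e'].
by move: kl; rewrite e'; case: k {k5 e e'} => [|[|[|[|[|]]]]].
Qed.

Lemma segment_loc k l p : adjT k l ->
  segment_set (ptT R k) (ptT R l) p <->
  [\/ loc p = Vtx k, loc p = Vtx l | loc p = edge_of k l].
Proof.
move=> kl; have [k5 l5] := adjT_lt kl; split.
- case=> t /=; rewrite in_itv /= => /andP[t0 t1] <-.
  move: t0; rewrite le_eqVlt => /predU1P[<-|t0].
    by rewrite seg0; constructor 1; exact: loc_ptT.
  move: t1; rewrite le_eqVlt => /predU1P[->|t1].
    by rewrite seg1; constructor 2; exact: loc_ptT.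
  by constructor 3; apply: (@loc_ray _ k l t) => //; apply/andP.
- case=> [/loc_Vtx ->|/loc_Vtx ->|/(edge_ray kl)[t /andP[t0 t1] ->]].
  + by exists 0; rewrite ?seg0 //= in_itv /= lexx ler01.
  + by exists 1; rewrite ?seg1 //= in_itv /= lexx ler01.
  + by exists t => //=; rewrite in_itv /= !ltW.
Qed.

Lemma wheel_planar : planar_drawing G W D.
Proof.
split=> [u v uW vW /= e|u v uW vW uv|u v w uW vW wW uv|].
- apply: pi_inj => //; have := loc_ptT R (pi_lt uW).
  by rewrite e loc_ptT ?pi_lt // => -[].
- split; last exact: segment_set_sym.
  by apply: seg_jordan_arc; apply: ptT_neq; exact: pi_adj.
- move/(segment_loc _ (pi_adj uW vW uv)); rewrite /= loc_ptT ?pi_lt //.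
  case=> [[e]|[e]|]; [left; exact: pi_inj e | right; exact: pi_inj e | ].
  by rewrite /edge_of; case: ifP.
- move=> u v x y uW vW xW yW uv xy neq p.
  move=> /(segment_loc _ (pi_adj uW vW uv)) h1.
  move=> /(segment_loc _ (pi_adj xW yW xy)) h2.
  have vtx a b : a \in W -> b \in W -> loc p = Vtx (pi a) ->
      loc p = Vtx (pi b) -> a = b /\ p = pos D a.
    move=> aW bW ha; rewrite ha => -[e]; split; last exact: loc_Vtx.
    exact: pi_inj e.
  have ve a k l : loc p = Vtx a -> loc p = edge_of k l -> False.
    by move=> ->; rewrite /edge_of; case: ifP.
  have common a b : a \in [set u; v]%SET -> b \in [set x; y]%SET ->
      a = b /\ p = pos D a -> exists w : V,
      [/\ w \in [set u; v]%SET, w \in [set x; y]%SET & p = pos D w].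
    by move=> ha hb [eab pa]; exists a; split=> //; rewrite eab.
  case: h1 => e1; case: h2 => e2; try by have := ve _ _ _ e1 e2.
  + by apply: (common u x); rewrite ?set21 //; exact: vtx.
  + by apply: (common u y); rewrite ?set21 ?set22 //; exact: vtx.
  + by apply: (common v x); rewrite ?set21 ?set22 //; exact: vtx.
  + by apply: (common v y); rewrite ?set22 //; exact: vtx.
  + by have := ve _ _ _ e2 e1.
  + by have := ve _ _ _ e2 e1.
  + exfalso; move: e2; rewrite e1 => /(edge_of_inj (pi_adj uW vW uv)).
    case/(_ (pi_adj xW yW xy)) => -[/pi_inj e3 /pi_inj e4]; apply: neq.
      by rewrite e3 // e4.
    by rewrite e3 // e4 // finset.setUC.
Qed.

Definition drawn_vertex k := [exists v, (v \in W) && (pi v == k)].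
Definition drawn_edge k l := [exists u, exists v,
  [&& u \in W, v \in W, G u v, pi u == k & pi v == l]].

Definition drawn s :=
  match s with
  | Vtx k => drawn_vertex k | Edg k l => drawn_edge k l | Cel _ => false
  end.

Lemma drawn_vertexP k : reflect (exists2 v, v \in W & pi v = k) (drawn_vertex k).
Proof.
apply: (iffP existsP) => [[v /andP[vW /eqP]]|[v vW e]]; exists v => //.
by rewrite vW e eqxx.
Qed.

Lemma drawn_edgeP k l : reflect
  (exists u v, [/\ u \in W, v \in W, G u v, pi u = k & pi v = l])
  (drawn_edge k l).
Proof.
apply: (iffP existsP) => [[u /existsP[v /and5P[? ? ? /eqP ? /eqP ?]]]|].
  by exists u, v.
by case=> u [v [? ? ? /eqP ? /eqP ?]]; exists u; apply/existsP; exists v; apply/and5P.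
Qed.

Lemma drawn_edge_sym k l : drawn_edge k l = drawn_edge l k.
Proof.
by apply/drawn_edgeP/drawn_edgeP => -[u [v [? ? ? ? ?]]]; exists v, u;
  rewrite adjacent_sym.
Qed.

Lemma drawn_edge_vertex k l : drawn_edge k l -> drawn_vertex k.
Proof. by case/drawn_edgeP => u [v [? ? ? <- _]]; apply/drawn_vertexP; exists u. Qed.

Lemma drawn_edge_of k l : drawn (edge_of k l) = drawn_edge k l.
Proof. by rewrite /edge_of; case: ifP => //= _; exact: drawn_edge_sym. Qed.

Lemma drawn_pointsE p : drawn_points G W D p <-> drawn (loc p).
Proof.
split.
- case=> [[v vW ->]|[u [v [uW vW uv]]]].
    by rewrite loc_ptT ?pi_lt //; apply/drawn_vertexP; exists v.
  move/(segment_loc _ (pi_adj uW vW uv)); case=> -> /=.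
  + by apply/drawn_vertexP; exists u.
  + by apply/drawn_vertexP; exists v.
  + by rewrite drawn_edge_of; apply/drawn_edgeP; exists u, v.
- case e: (loc p) => [k|k l|c] //=.
    case/drawn_vertexP => v vW vk; left; exists v => //=.
    by rewrite vk; exact: loc_Vtx.
  case/drawn_edgeP => u [v [uW vW uv uk vl]]; right; exists u, v; split=> //.
  apply/(segment_loc _ (pi_adj uW vW uv)); constructor 3.
  by have := loc_well_formed p; rewrite e uk vl /= /edge_of => /andP[_ ->].
Qed.

Let U := ~` drawn_points G W D.

Lemma undrawnE p : U p <-> ~~ drawn (loc p).
Proof.
split; first by move=> h; apply/negP => /drawn_pointsE.
by move=> /negP h /drawn_pointsE.
Qed.

Section Faces.
Variable lab : nat -> nat.
Hypothesis lab_undrawn : forall k l, adjT k l -> ~~ drawn_edge k l ->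
  lab (leftT k l) = lab (leftT l k).
(** Together with [lab_undrawn]: equality of labels is the least equivalence relation that joins the
    two sides of every undrawn edge, expressed by quantifying over all such relations. *)
Hypothesis lab_joined : forall E : nat -> nat -> Prop,
  (forall c, E c c) -> (forall c d, E c d -> E d c) ->
  (forall c d e, E c d -> E d e -> E c e) ->
  (forall k l, adjT k l -> ~~ drawn_edge k l -> E (leftT k l) (leftT l k)) ->
  forall c d, lab c = lab d -> E c d.

Definition face c : set (R * R) :=
  [set p | U p /\ lab (cell_of (loc p)) = lab c].

Lemma face_lab c d : lab c = lab d -> face c = face d.
Proof. by rewrite /face => ->. Qed.

(** The drawn strata form a closed set, since the ends of a drawn edge are drawn. All edges at an
    undrawn vertex are undrawn, so the cells around it have one label. *)
Lemma incident_undrawn s s' : well_formed s -> well_formed s' -> incident s s' ->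
  ~~ drawn s -> ~~ drawn s' /\ lab (cell_of s') = lab (cell_of s).
Proof.
have around_vertex k : ~~ drawn_vertex k -> forall l m, adjT k l -> adjT k m ->
    lab (leftT k m) = lab (leftT k l).
  move=> hk l m kl km; apply: (@labels_around k (drawn_edge k) lab) => //.
    by move=> n kn; exact: lab_undrawn.
  by move=> n _ _; apply: contra hk; exact: drawn_edge_vertex.
have headT k : (k < 5)%N -> adjT k (head 0%N (rotT k)).
  by case: k => [|[|[|[|[|]]]]].
case: s => [k|k l|c]; case: s' => [k'|k' l'|c'] //=.
- by move=> _ _ ->.
- move=> k5 /andP[kl' _] [ek|ek] hk; rewrite {}ek in hk k5 *.
    split; first by apply: contra hk; exact: drawn_edge_vertex.
    by apply: around_vertex => //; exact: headT.
  have nd : ~~ drawn_edge k' l'.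
    by rewrite drawn_edge_sym; apply: contra hk; exact: drawn_edge_vertex.
  split=> //; rewrite lab_undrawn //; apply: around_vertex => //.
    exact: headT.
  exact: adjT_sym.
- move=> k5 _ /mapP[l kl ->] hk; split=> //; apply: around_vertex => //.
  exact: headT.
- by move=> _ _ [-> ->].
- move=> /andP[kl _] _ [->|->] h //; split=> //.
  by rewrite -lab_undrawn.
- by move=> _ _ ->.
Qed.

Lemma near_face p : U p -> \forall q \near p, face (cell_of (loc p)) q.
Proof.
move=> /undrawnE Up; apply: filterS (loc_incident p) => q pq.
have [h1 h2] := incident_undrawn (loc_well_formed p) (loc_well_formed q) pq Up.
by split=> //; apply/undrawnE.
Qed.

End Faces.
End WheelDrawing.

(** * Connectedness of the cells, and the faces of a wheel drawing *)

Section CellsConnected.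
Variable R : realType.
Implicit Types (x y t : R) (p q : R * R) (U : set (R * R)).

Definition closed_cell c q : Prop :=
  let: (x, y) := q in
  match c with
  | 0%N => 1 <= `|x| + `|y|
  | 1%N => [/\ 0 <= x, 0 <= y & x + y <= 1]
  | 2%N => [/\ x <= 0, 0 <= y & - x + y <= 1]
  | 3%N => [/\ x <= 0, y <= 0 & - x - y <= 1]
  | 4%N => [/\ 0 <= x, y <= 0 & x - y <= 1]
  | _ => False
  end.

Lemma incident_closed c q : incident (loc q) (Cel c) -> closed_cell c q.
Proof.
have := loc_at q; have := loc_well_formed q.
case: q => x y; case: (loc _) => [k|k l|d].
- move=> /= k5 [_ e]; move: e k5.
  by case: k => [|[|[|[|[|//]]]]] /= [-> ->] _; rewrite !inE;
    do ?[case/orP]; move=> /eqP -> /=; rewrite ?normrN ?normr1 ?normr0;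
    try split; lra.
- move=> /= /andP[kl lt_kl]; move: kl lt_kl.
  elim/adjT_cases => //= _ + [] -> /=;
    by case=> h1 h2 h3; rewrite ?h1 ?h2 ?normr0 ?(gtr0_norm h1) ?(gtr0_norm h2)
      ?(ltr0_norm h1) ?(ltr0_norm h2); try split; lra.
- move=> /= _ + e; rewrite {}e.
  case: c => [/ltW //|[|[|[|[|c]]]]] //= [h1 h2 h3]; by split; exact: ltW.
Qed.

Definition base c : R * R :=
  match c with
  | 0%N => (5, 0) | 1%N => (1 / 4, 1 / 4) | 2%N => (- (1 / 4), 1 / 4)
  | 3%N => (- (1 / 4), - (1 / 4)) | _ => (1 / 4, - (1 / 4))
  end.

Lemma conv_gt0 x m t : 0 <= x -> 0 < m -> 0 < t <= 1 -> 0 < x + t * (m - x).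
Proof.
move=> x0 m0 /andP[t0 t1]; have -> : x + t * (m - x) = (1 - t) * x + t * m by ring.
by rewrite ltr_wpDl ?mulr_ge0 ?mulr_gt0 // subr_ge0.
Qed.

Lemma seg_base c q t : (0 < c < 5)%N -> incident (loc q) (Cel c) ->
  0 < t <= 1 -> loc (seg q (base c) t) = Cel c.
Proof.
move=> c5 /incident_closed h t01; apply: at_loc; rewrite /seg.
have key (u m : R) : 0 <= u -> 0 < m -> 0 < u + t * (m - u) by move=> *; exact: conv_gt0.
have q4 : 0 < 1 / 4 :> R by lra.
have q2 : 0 < 1 / 2 :> R by lra.
have sub (u : R) : u <= 1 -> 0 <= 1 - u by rewrite subr_ge0.
have opp (u : R) : u <= 0 -> 0 <= - u by rewrite oppr_ge0.
case: q h => x y; case: c c5 => [|[|[|[|[|c]]]]] //= _ [h1 h2 h3].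
- have := key _ _ h1 q4; have := key _ _ h2 q4; have := key _ _ (sub _ h3) q2.
  by move=> *; split; lra.
- have := key _ _ (opp _ h1) q4; have := key _ _ h2 q4.
  by have := key _ _ (sub _ h3) q2; move=> *; split; lra.
- have := key _ _ (opp _ h1) q4; have := key _ _ (opp _ h2) q4.
  by have := key _ _ (sub _ h3) q2; move=> *; split; lra.
- have := key _ _ h1 q4; have := key _ _ (opp _ h2) q4.
  by have := key _ _ (sub _ h3) q2; move=> *; split; lra.
Qed.

(** The outer cell is not convex, but its right half is star-shaped about [(5, 0)]; [seg_left] is
    the mirror image. *)
Lemma seg_right q t : 0 <= q.1 -> incident (loc q) (Cel 0) -> 0 < t <= 1 ->
  loc (seg q (5, 0) t) = Cel 0.
Proof.
case: q => x y /= x0 /incident_closed /= + /andP[t0 t1].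
rewrite (ger0_norm x0) => h; have t1' : 0 <= 1 - t by rewrite subr_ge0.
apply: at_loc => /=; have -> : y + t * (0 - y) = (1 - t) * y by ring.
have xt : 0 <= x + t * (5 - x).
  have -> : x + t * (5 - x) = (1 - t) * x + t * 5 by ring.
  by rewrite addr_ge0 // mulr_ge0 // ltW.
rewrite normrM (ger0_norm t1') (ger0_norm xt).
have : 0 <= (1 - t) * (x + `|y| - 1) by rewrite mulr_ge0 // subr_ge0.
move=> ?; lra.
Qed.

Lemma seg_left q t : q.1 <= 0 -> incident (loc q) (Cel 0) -> 0 < t <= 1 ->
  loc (seg q (- 5, 0) t) = Cel 0.
Proof.
case: q => x y /= x0 /incident_closed /= + /andP[t0 t1].
rewrite (ler0_norm x0) => h; have t1' : 0 <= 1 - t by rewrite subr_ge0.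
apply: at_loc => /=; have -> : y + t * (0 - y) = (1 - t) * y by ring.
have xt : x + t * (- 5 - x) <= 0.
  have -> : x + t * (- 5 - x) = - ((1 - t) * (- x) + t * 5) by ring.
  by rewrite oppr_le0 addr_ge0 // mulr_ge0 ?oppr_ge0 // ltW.
rewrite normrM (ger0_norm t1') (ler0_norm xt).
have : 0 <= (1 - t) * (- x + `|y| - 1) by rewrite mulr_ge0 // subr_ge0.
move=> ?; lra.
Qed.

Lemma cell_base_component U c q : (forall p d, loc p = Cel d -> U p) -> U q ->
  (c < 5)%N -> incident (loc q) (Cel c) -> connected_component U q (base c).
Proof.
move=> Ucell Uq c5 qc.
have path q' b : U q' -> (forall t, 0 < t <= 1 -> loc (seg q' b t) = Cel c) ->
    connected_component U q' b.
  move=> Uq' h; apply: seg_component => t /andP[].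
  rewrite le_eqVlt => /predU1P[<- _|t0 t1]; first by rewrite seg0.
  by apply: Ucell (h _ _); apply/andP.
have [c0|c0] := posnP c; last first.
  by apply: path => // t; apply: seg_base; rewrite ?c0.
rewrite c0 in path qc *.
have [x0|/ltW x0] := leP 0 q.1; first by apply: path => // t; exact: seg_right.
have out x y : 1 < `|x| + `|y| -> loc (x, y) = Cel 0 :> stratum.
  by move=> h; exact: at_loc.
have [r5 l5 t5] : [/\ loc (5 : R, 0 : R) = Cel 0, loc (- 5 : R, 0 : R) = Cel 0
    & loc (0 : R, 5 : R) = Cel 0].
  by split; apply: out; rewrite ?normrN !normr0 !ger0_norm //; lra.
have h1 : connected_component U q (- 5, 0).
  by apply: path => // t; exact: seg_left.
(* The point [(0, 5)] lies in both half-planes and links the two star-shaped halves. *)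
have h2 : connected_component U (0, 5) (- 5, 0).
  by apply: path => [|t]; [exact: Ucell t5 | apply: seg_left; rewrite ?t5].
have h3 : connected_component U (0, 5) (5, 0).
  by apply: path => [|t]; [exact: Ucell t5 | apply: seg_right; rewrite ?t5].
apply: connected_component_trans h1 _; apply: connected_component_trans h3.
exact: connected_component_sym.
Qed.

End CellsConnected.

Lemma loc_base (R : realType) c : (c < 5)%N -> loc (base R c) = Cel c.
Proof.
case: c => [|[|[|[|[|//]]]]] _; apply: at_loc => /=; try (by split; lra).
by rewrite normr0 ger0_norm; lra.
Qed.

Lemma cell_of_lt s : well_formed s -> (cell_of s < 5)%N.
Proof.
by case: s => [[|[|[|[|[|//]]]]]|k l /andP[kl _]|c] //=; exact: leftT_lt.
Qed.

Lemma cell_of_incident s : well_formed s -> incident s (Cel (cell_of s)).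
Proof. by case: s => [[|[|[|[|[|//]]]]]|k l|c] //= _; left. Qed.

Section Faces.
Variables (R : realType) (V : finType) (G : sgraph V) (W : {set V}).
Variable pi : V -> nat.
Hypothesis pi_inj : {in W &, injective pi}.
Hypothesis pi_lt : forall v, v \in W -> (pi v < 5)%N.
Hypothesis pi_adj : forall u v, u \in W -> v \in W -> G u v -> adjT (pi u) (pi v).
Variable lab : nat -> nat.
Hypothesis lab_undrawn : forall k l, adjT k l -> ~~ drawn_edge G W pi k l ->
  lab (leftT k l) = lab (leftT l k).
Hypothesis lab_joined : forall E : nat -> nat -> Prop,
  (forall c, E c c) -> (forall c d, E c d -> E d c) ->
  (forall c d e, E c d -> E d e -> E c e) ->
  (forall k l, adjT k l -> ~~ drawn_edge G W pi k l ->
     E (leftT k l) (leftT l k)) ->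
  forall c d, (c < 5)%N -> (d < 5)%N -> lab c = lab d -> E c d.
Let D : drawing R V := wheel_drawing R pi.
Let U := ~` drawn_points G W D.
Let face := @face R V G W pi lab.
Implicit Types (u v w : V) (k l m c d : nat) (p q : R * R).

Lemma cell_undrawn p c : loc p = Cel c -> U p.
Proof. by move=> e; apply/undrawnE => //; rewrite e. Qed.

Lemma bases_joined c d : (c < 5)%N -> (d < 5)%N -> lab c = lab d ->
  connected_component U (base R c) (base R d).
Proof.
have ub e : (e < 5)%N -> U (base R e).
  by move=> e5; apply: (@cell_undrawn _ e); exact: loc_base.
(* The first disjunct makes [E] reflexive also on numbers that are not cells. *)
pose E c d := c = d \/ connected_component U (base R c) (base R d).
suff H : forall c d, (c < 5)%N -> (d < 5)%N -> lab c = lab d -> E c d.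
  move=> c5 d5 /(H _ _ c5 d5)[->|//].
  by apply: connected_component_refl; exact: ub.
apply: lab_joined => [c'|c' d' [->|h]|c' d' e [->|h] // [<-|h']|k l kl nd].
- by left.
- by left.
- by right; exact: connected_component_sym.
- by right.
- by right; exact: connected_component_trans h h'.
- right; pose m : R * R := ray k l (1 / 2).
  have lm : loc m = edge_of k l by apply: loc_ray => //; apply/andP; split; lra.
  have Um : U m by apply/undrawnE => //; rewrite lm drawn_edge_of.
  have [lt_l lt_r] : incident (loc m) (Cel (leftT k l)) /\
      incident (loc m) (Cel (leftT l k)).
    by rewrite lm /edge_of; case: ifP => _ /=; split; auto.
  have Ucell p e : loc p = Cel e -> U p by exact: cell_undrawn.
  apply: connected_component_trans (connected_component_sym _) _.
    exact: cell_base_component Ucell Um (leftT_lt kl) lt_l.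
  exact: cell_base_component Ucell Um (leftT_lt (adjT_sym kl)) lt_r.
Qed.

Lemma face_open (P : nat -> Prop) : open [set r | U r /\ P (lab (cell_of (loc r)))].
Proof.
rewrite openE => r [Ur Pr].
have := near_face pi_lt pi_adj lab_undrawn Ur; apply: filterS => r' [Ur' e].
by split=> //; rewrite e.
Qed.

(** One inclusion follows paths through bases of cells. For the other, labels are locally constant
    on the undrawn points, so the points with a given label form a relatively open and closed set,
    which a connected component cannot leave. *)
Lemma face_atE p : U p -> face_at G W D p = face (cell_of (loc p)).
Proof.
move=> Up; rewrite /face_at -/U.
have Ucell q e : loc q = Cel e -> U q by exact: cell_undrawn.
have wf := loc_well_formed; pose c := cell_of (loc p).
have to_base q : U q -> connected_component U q (base R (cell_of (loc q))).
  move=> Uq; apply: cell_base_component => //; first exact: cell_of_lt.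
  exact: cell_of_incident.
apply/seteqP; split=> q; last first.
  case=> Uq e; apply: connected_component_trans (to_base p Up) _.
  apply: connected_component_trans (connected_component_sym (to_base q Uq)).
  by apply: bases_joined => //; exact: cell_of_lt.
pose A := connected_component U p => Aq.
have AU : A `<=` U by exact: connected_component_sub.
suff e : A `&` face c = A by have : A q by []; rewrite -e => -[].
apply: (component_connected (A := U) (x := p)).
- by exists p; split; [exact: connected_component_refl | split].
- by exists (face c) => //; exact: (@face_open (fun n => n = lab c)).
- exists (~` [set r | U r /\ lab (cell_of (loc r)) <> lab c]).
    by rewrite closedC; exact: (@face_open (fun n => n <> lab c)).
  apply/seteqP; split=> r [Ar]; [move=> [Ur e] | move=> h]; split=> //.
    by case.
  split; first exact: AU.
  by apply: contrapT => e; apply: h; split=> //; exact: AU.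
Qed.

Lemma face_base c : (c < 5)%N -> face c (base R c).
Proof.
move=> c5; split; last by rewrite loc_base.
by apply: (@cell_undrawn _ c); exact: loc_base.
Qed.

Lemma face_eq c d : (c < 5)%N -> face c = face d <-> lab c = lab d.
Proof.
move=> c5; split=> [e|e]; last exact: face_lab.
by have := face_base c5; rewrite e => -[_ <-]; rewrite loc_base.
Qed.

Lemma facesE : faces G W D = [set face c | c in [set c | (c < 5)%N]].
Proof.
apply/seteqP; split=> f.
  move=> [p Up <-]; exists (cell_of (loc p)); last by rewrite face_atE.
  exact/cell_of_lt/loc_well_formed.
move=> [c /= c5 <-]; have [Ub _] := face_base c5.
by exists (base R c) => //; rewrite face_atE // loc_base.
Qed.

Lemma face_bounded c : bounded_set (face c) <-> lab 0%N <> lab c.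
Proof.
split=> [[M [_ Mb]] e|ne].
  pose t : R := Num.max M 1 + 1.
  have [tM t1] : M < t /\ 1 < t.
    by split; rewrite /t ltr_pwDr // le_max lexx ?orbT.
  have t0 : 0 < t by exact: lt_trans t1.
  have l0 : loc (t + 1, 0 : R) = Cel 0.
    by apply: at_loc; rewrite /= normr0 addr0 (ger0_norm (ltW _)); lra.
  have : face c (t + 1, 0).
    split; last by rewrite l0.
    exact: cell_undrawn l0.
  move=> /(Mb t tM) /=; rewrite prod_normE /= normr0 ge_max => /andP[+ _].
  by rewrite (ger0_norm (addr_ge0 (ltW t0) ler01)) gerDl leNgt ltr01.
exists 1; split=> // M M1 q [Uq e] /=; apply: le_trans (ltW M1).
have [x1 y1] : `|q.1| <= 1 /\ `|q.2| <= 1.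
  apply: contrapT => h; apply: ne; rewrite -e.
  suff -> : loc q = Cel 0 by [].
  have nx := normr_ge0 q.1; have ny := normr_ge0 q.2.
  case: q {Uq e} h nx ny => x y /= h nx ny; apply: at_loc => /=.
  have : ~~ ((`|x| <= 1) && (`|y| <= 1)) by apply/negP => /andP.
  by rewrite negb_and -!ltNge => /orP[] ?; lra.
by rewrite prod_normE ge_max x1 y1.
Qed.

Lemma external_faceE : external_face G W D = [set face 0].
Proof.
apply/seteqP; split=> f.
  rewrite /external_face /= facesE => -[[c /= c5 <-]].
  move=> /(contra_not (face_bounded c).2)/contrapT e.
  exact/esym/(face_eq _ (isT : (0 < 5)%N)).
move=> ->; split; last by move/face_bounded.
by rewrite facesE; exists 0%N.
Qed.

End Faces.

(** * Rotations of a wheel drawing *)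

Definition cycT (k l m n : nat) : bool :=
  let s := rot (index l (rotT k)) (rotT k) in
  (0 < index m s)%N && (index m s < index n s < size s)%N.

Lemma cycT_inv k l m n : adjT k l -> adjT k m -> adjT k n -> cycT k l m n ->
  let l1 := nextT k l in let l2 := nextT k l1 in let l3 := nextT k l2 in
  [\/ m = l1 /\ n = l2, [/\ m = l1, n = l3 & l3 <> l]
    | [/\ m = l2, n = l3 & l3 <> l]].
Proof.
move=> kl km kn; case: (around kl kn) => [->|->|[_ ->]|[_ _ ->]];
case: (around kl km) => [->|->|[_ ->]|[_ _ ->]];
move: kl; rewrite /nextT /cycT; elim/adjT_cases => //= _;
by [constructor 1 | constructor 2 | constructor 3].
Qed.

Lemma cycT_total k l m n : adjT k l -> adjT k m -> adjT k n ->
  [\/ cycT k l m n, cycT k l n m | [\/ l = m, l = n | m = n]].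
Proof.
move=> kl km kn; case: (around kl kn) => [->|->|[_ ->]|[_ _ ->]];
case: (around kl km) => [->|->|[_ ->]|[_ _ ->]];
move: kl; rewrite /nextT /cycT; elim/adjT_cases => /=;
first [exact: Or31 | exact: Or32 | exact: Or33 (Or31 _ _ erefl)
  | exact: Or33 (Or32 _ _ erefl) | exact: Or33 (Or33 _ _ erefl)].
Qed.

Section Hits.
Variable R : realType.
Implicit Types (k l m n : nat) (r : R) (p q : R * R).

Definition reach k r l : R := r / Num.sqrt (sqdist (ptT R k) (ptT R l)).

Lemma edge_length k l : adjT k l -> 1 <= sqdist (ptT R k) (ptT R l).
Proof. by elim/adjT_cases; rewrite /sqdist /=; lra. Qed.

Lemma reach_gt0 k r l : adjT k l -> 0 < r -> 0 < reach k r l.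
Proof.
by move=> kl r0; rewrite divr_gt0 // sqrtr_gt0 (lt_le_trans ltr01) ?edge_length.
Qed.

Lemma reach_circle k r l : adjT k l ->
  on_circle (ptT R k) (r ^+ 2) (ray k l (reach k r l)).
Proof.
move=> kl; rewrite /on_circle.
have -> : ray k l (reach k r l) = seg (ptT R k) (ptT R l) (reach k r l) by [].
have d0 : 0 < sqdist (ptT R k) (ptT R l).
  by rewrite (lt_le_trans ltr01) ?edge_length.
by rewrite sqdist_seg expr_div_n sqr_sqrtr ?ltW // divfK ?gt_eqF.
Qed.

Lemma ray_first_hit k r l : adjT k l -> 0 < r < 1 / 4 ->
  first_hit (ptT R k) (segment_set (ptT R k) (ptT R l)) r
    (ray k l (reach k r l)).
Proof.
move=> kl /andP[r0 r4]; apply: seg_first_hit => //; first exact: ptT_neq.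
by apply: le_trans (edge_length kl); nra.
Qed.

Lemma first_hit_ray k r l p : adjT k l -> 0 < r ->
  first_hit (ptT R k) (segment_set (ptT R k) (ptT R l)) r p ->
  p = ray k l (reach k r l).
Proof.
move=> kl r0 [g [q [t [[_ _ _ _ Ag] t01 gt hp _]]]].
have : segment_set (ptT R k) (ptT R l) p.
  by rewrite Ag -gt; exists t.
case=> c /= c01 cp; have r20 : 0 < r ^+ 2 by rewrite exprn_gt0.
rewrite -cp; apply: (circ_ray_inj (r := r ^+ 2) (c := reach k r)) => //.
- by move=> m km; exact: reach_gt0.
- by move=> m km; exact: reach_circle.
- move: c01; rewrite in_itv /= => /andP[+ _]; rewrite le_eqVlt.
  case/predU1P => // c0; move: hp; rewrite -cp -c0 seg0 /sqdist !subrr !expr0n /=.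
  by rewrite addr0 => e; move: r20; rewrite -e ltxx.
- by rewrite /on_circle -hp -cp.
Qed.

Lemma near_radius (P : R -> Prop) : (forall r, 0 < r < 1 / 4 -> P r) ->
  \forall r \near 0^'+, P r.
Proof.
move=> h; near=> r; apply: h; apply/andP; split; first by near: r; exact: nbhs_right_gt.
by near: r; apply: nbhs_right_lt; lra.
Unshelve. all: by end_near. Qed.

Lemma near_radius_ex (P : R -> Prop) : (\forall r \near 0^'+, P r) ->
  exists r, 0 < r < 1 / 4 /\ P r.
Proof.
move=> h; have h' := near_radius (fun r => id : 0 < r < 1 / 4 -> 0 < r < 1 / 4).
by have [r [? ?]] := @filter_ex _ (0 : R)^'+ _ _ (filterI h' h); exists r.
Qed.

Lemma nbhs_circle p (N : set (R * R)) : nbhs p N ->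
  \forall r \near 0^'+, forall q, sqdist p q = r ^+ 2 -> N q.
Proof.
move=> /nbhs_ballP[e /= e0 pe]; near=> r => q hq; apply: pe.
have r0 : 0 < r by near: r; exact: nbhs_right_gt.
have re : r < e by near: r; exact: nbhs_right_lt.
have key (x y : R) : x ^+ 2 + y ^+ 2 = r ^+ 2 -> `|x| < e.
  move=> h; apply: le_lt_trans re; rewrite -(@ler_pXn2r _ 2) ?nnegrE ?(ltW r0) //.
  by rewrite real_normK ?num_real // -h lerDl sqr_ge0.
split; rewrite /ball /= /ball_; first exact: key hq.
by apply: (key _ (p.1 - q.1)); rewrite addrC.
Unshelve. all: by end_near. Qed.

(** If the rotation list does not have the order [l], [m], [n], it has the reverse order or two of
    them coincide; the area would then be negative or zero. *)
Lemma ccw_rays k l m n : adjT k l -> adjT k m -> adjT k n ->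
  let S j := segment_set (ptT R k) (ptT R j) in
  ccw (ptT R k) (S l) (S m) (S n) <-> cycT k l m n.
Proof.
move=> kl km kn S.
have cyc r i j o : 0 < r < 1 / 4 -> adjT k i -> adjT k j -> adjT k o ->
    cycT k i j o -> 0 < signed_area (ray k i (reach k r i))
      (ray k j (reach k r j)) (ray k o (reach k r o)).
  move=> /andP[r0 r4] ki kj ko; have r20 : 0 < r ^+ 2 by rewrite exprn_gt0.
  have c0 b : adjT k b -> 0 < reach k r b by move=> kb; exact: reach_gt0.
  have hc b : adjT k b ->
    on_circle (ptT R k) (r ^+ 2) (ray k b (reach k r b)) by exact: reach_circle.
  move=> h; case: (cycT_inv ki kj ko h) => [[-> ->]|[-> -> h3]|[-> -> h3]].
  - exact: order12 c0 hc _ ki.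
  - exact: order13 c0 hc _ ki h3.
  - exact: order23 c0 hc _ ki h3.
split=> [h|h].
  have [r [r4 [a [b [c [ha hb hc]]]]]] := near_radius_ex h.
  have r0 : 0 < r by case/andP: r4.
  rewrite (first_hit_ray kl r0 ha) (first_hit_ray km r0 hb).
  rewrite (first_hit_ray kn r0 hc) => {ha hb hc} h'.
  have [//|h2|e] := cycT_total kl km kn.
    by have := cyc r l n m r4 kl kn km h2; rewrite signed_area_swapr oppr_gt0 ltNge ltW.
  exfalso; move: h'; case: e => ->; rewrite /signed_area ?subrr ?mul0r ?mulr0;
    by rewrite ?subrr ?ltxx // [X in X - _]mulrC subrr ltxx.
apply: near_radius => r r4; exists (ray k l (reach k r l)), (ray k m (reach k r m)),
  (ray k n (reach k r n)).
by split; [exact: ray_first_hit.. | exact: cyc].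
Qed.
End Hits.

(** * Boundaries of the faces of a wheel drawing *)

Section Spokes.
Variable R : realType.

Lemma radius16 (r : R) : 0 < r < 1 / 4 -> r ^+ 2 < 1 / 16.
Proof. by move=> /andP[r0 r4]; nra. Qed.

(** A segment that enters the cell at once. It serves as the arc required by [on_left], and shows
    that the vertex is in the closure of the cell. *)
Lemma spoke k l : adjT k l -> exists b : R * R,
  forall t, 0 < t <= 1 -> loc (seg (ptT R k) b t) = Cel (leftT k l).
Proof.
move=> kl; have [k5 _] := adjT_lt kl.
have inc : incident (loc (ptT R k)) (Cel (leftT k l)).
  by rewrite loc_ptT //=; apply/mapP; exists l.
have [l0|l0] := posnP (leftT k l); last first.
  by exists (base R (leftT k l)) => t; apply: seg_base; rewrite // l0 leftT_lt.
rewrite l0 in inc *; have [x0|/ltW x0] := leP 0 (ptT R k).1.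
  by exists (5, 0) => t; exact: seg_right.
by exists (- 5, 0) => t; exact: seg_left.
Qed.

Lemma spoke_neq k l b : adjT k l ->
  (forall t, 0 < t <= 1 -> loc (seg (ptT R k) b t) = Cel (leftT k l)) ->
  ptT R k <> b.
Proof.
move=> kl h e; have := h 1; rewrite -e seg1 ltr01 lexx => /(_ isT).
by have [k5 _] := adjT_lt kl; rewrite loc_ptT.
Qed.
End Spokes.

Section Boundary.
Variables (R : realType) (V : finType) (G : sgraph V) (W : {set V}).
Variable pi : V -> nat.
Hypothesis pi_inj : {in W &, injective pi}.
Hypothesis pi_lt : forall v, v \in W -> (pi v < 5)%N.
Hypothesis pi_adj : forall u v, u \in W -> v \in W -> G u v -> adjT (pi u) (pi v).
Variable lab : nat -> nat.
Hypothesis lab_undrawn : forall k l, adjT k l -> ~~ drawn_edge G W pi k l ->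
  lab (leftT k l) = lab (leftT l k).
Let D : drawing R V := wheel_drawing R pi.
Let U := ~` drawn_points G W D.
Let face := @face R V G W pi lab.
Implicit Types (u v w : V) (k l m c d : nat) (p q : R * R).

Lemma near_vertex k : (k < 5)%N -> drawn_vertex W pi k ->
  \forall q \near ptT R k, U q -> exists2 m, adjT k m &
    [/\ loc q = Cel (leftT k m) \/
        loc q = edge_of k m /\ ~~ drawn_edge G W pi k m
      & lab (cell_of (loc q)) = lab (leftT k m)].
Proof.
move=> k5 kW; apply: filterS (loc_incident (ptT R k)) => q.
rewrite loc_ptT // => inc /(undrawnE pi_lt pi_adj); have := loc_well_formed q.
case: (loc q) inc => [k' /= <-|m n /= inc /andP[mn lt_mn] nd|c /=].
- by rewrite kW.
- have edg : Edg m n = edge_of m n by rewrite /edge_of lt_mn.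
  case: inc => e; rewrite {}e in k5 kW *.
    by exists n => //; split; [right|].
  exists m; first exact: adjT_sym.
  rewrite edge_of_sym -edg drawn_edge_sym; split; first by right.
  exact: lab_undrawn.
- by case/mapP => m km -> _ _; exists m => //; split; [left|].
Qed.

Lemma closure_face v c : v \in W ->
  closure (face c) (ptT R (pi v)) <->
  exists2 m, adjT (pi v) m & lab (leftT (pi v) m) = lab c.
Proof.
move=> vW; have k5 := pi_lt vW; split.
  move=> /(_ _ (near_vertex k5 _)) [|q [[Uq <-] /(_ Uq)[m km [_ e]]]].
    by apply/drawn_vertexP; exists v.
  by exists m.
case=> m km e B nB; have [b hb] := spoke R km.
have near0 : \forall t \near 0^'+, B (seg (ptT R (pi v)) b t).
  have cg : seg (ptT R (pi v)) b t @[t --> 0^'+] --> seg (ptT R (pi v)) b 0.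
    by apply: cvg_within_filter; exact: seg_continuous.
  by apply: cg; rewrite seg0.
have [t [/andP[t0 t4] Bt]] := near_radius_ex near0.
have lt : loc (seg (ptT R (pi v)) b t) = Cel (leftT (pi v) m).
  by apply: hb; rewrite t0 /=; lra.
exists (seg (ptT R (pi v)) b t); split=> //; split; last by rewrite lt.
by apply/(undrawnE pi_lt pi_adj); rewrite lt.
Qed.

(** The arc [A] is arbitrary and may wind around, and each other edge at [u] provides its own radii.
    It is enough to take the first drawn edge after [l] and one of its radii: the first hit of [A]
    on that circle lies between the two edges, where [directly_after] applies. *)
Lemma arc_left_of u v l A q c : u \in W -> v \in W -> G u v -> pi v = l ->
  jordan_arc A (ptT R (pi u)) q -> A `\ ptT R (pi u) `<=` face c ->
  (forall w, w \in neighbours G W u -> w <> v ->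
    ccw (pos D u) (curve D u v) A (curve D u w)) ->
  lab (leftT (pi u) l) = lab c.
Proof.
move=> uW vW uv vl [g gA] Af left.
have ku := pi_adj uW vW uv; rewrite vl in ku.
move k_def : (pi u) ku gA Af left => k kl gA Af left.
have k5 : (k < 5)%N by rewrite -k_def pi_lt.
have kW : drawn_vertex W pi k by apply/drawn_vertexP; exists u.
pose E := drawn_edge G W pi k.
have El : E l by apply/drawn_edgeP; exists u, v.
pose l1 := nextT k l; pose l2 := nextT k l1; pose l3 := nextT k l2.
have kl1 : adjT k l1 := nextT_adj kl; have kl2 : adjT k l2 := nextT_adj kl1.
have kl3 : adjT k l3 := nextT_adj kl2.
have [l1l _] := next_neq kl.
have labk m : adjT k m -> ~~ E m -> lab (leftT k m) = lab (leftT m k).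
  by move=> km nd; exact: lab_undrawn.
(* a point of [A] that lies on the right side of one of the other edges *)
have hit n : E n -> n <> l -> exists r q m, [/\ 0 < r, r ^+ 2 < 1 / 16,
    on_circle (ptT R k) (r ^+ 2) q & adjT k m] /\
    [/\ loc q = Cel (leftT k m) \/ loc q = edge_of k m /\ ~~ E m,
        lab c = lab (leftT k m)
      & 0 < signed_area (ray k l (reach k r l)) q (ray k n (reach k r n))].
  move=> /drawn_edgeP[u' [w [u'W wW uw u'k wn]]] nl.
  have {u'W u'k}eu : u' = u by apply: pi_inj => //; rewrite u'k k_def.
  rewrite {}eu in uw; have kn : adjT k n by rewrite -k_def -wn pi_adj.
  have wu : w \in neighbours G W u by rewrite inE wW.
  have wv : w <> v by move=> e; apply: nl; rewrite -wn e.
  have := left w wu wv; rewrite /= k_def vl wn => hc.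
  have hn := nbhs_circle (near_vertex k5 kW).
  have [r [/andP[r0 r4] [hn' [a [b [d [ha hb hd]]]]]]] :=
    near_radius_ex (filterI hn hc).
  rewrite (first_hit_ray kl r0 ha) (first_hit_ray kn r0 hd) => area.
  have [g' [q' [t [[_ _ _ _ Ag] t01 gt hb' _]]]] := hb.
  have Ab : A b by rewrite Ag -gt; exists t.
  have [Ub eb] : face c b.
    apply: Af; split=> // e; move: hb'; rewrite e /sqdist !subrr !expr0n /= addr0.
    by move=> /esym/eqP; rewrite expf_eq0 /= gt_eqF.
  have [m km [h1 h2]] := hn' b hb' Ub.
  have r16 : r ^+ 2 < 1 / 16 by apply: radius16; rewrite r0.
  by exists r, b, m; split; split; rewrite // -eb h2.
have fin r q' m : 0 < r -> r ^+ 2 < 1 / 16 -> on_circle (ptT R k) (r ^+ 2) q' ->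
    adjT k m -> loc q' = Cel (leftT k m) \/ loc q' = edge_of k m /\ ~~ E m ->
    lab c = lab (leftT k m) ->
    let C n := 0 < signed_area (ray k l (reach k r l)) q'
      (ray k n (reach k r n)) in
    (E l1 -> C l1) -> (~~ E l1 -> E l2 -> l2 <> l -> C l2) ->
    (~~ E l1 -> ~~ E l2 -> E l3 -> l2 <> l -> l3 <> l -> C l3) ->
    lab (leftT k l) = lab c.
  move=> r0 r16 hq km lq e C h1 h2 h3; rewrite e; apply/esym.
  apply: (@directly_after R k (r ^+ 2) (reach k r)) h1 h2 h3 => //.
  - by rewrite exprn_gt0.
  - by move=> n kn; exact: reach_gt0.
  - by move=> n kn; exact: reach_circle.
have [El1|nE1] := boolP (E l1).
  have [r [q' [m [[h1 h2 h3 h4] [h5 h6 h7]]]]] := hit l1 El1 l1l.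
  by apply: (fin r q' m) => // nE1; rewrite El1 in nE1.
have [/andP[El2 /eqP l2l]|nE2] := boolP (E l2 && (l2 != l)).
  have [r [q' [m [[h1 h2 h3 h4] [h5 h6 h7]]]]] := hit l2 El2 l2l.
  apply: (fin r q' m) => // [El1|_ nE2]; first by rewrite El1 in nE1.
  by rewrite El2 in nE2.
have [/and3P[El3 /eqP l3l /eqP l2l]|nE3] := boolP [&& E l3, l3 != l & l2 != l].
  have [r [q' [m [[h1 h2 h3 h4] [h5 h6 h7]]]]] := hit l3 El3 l3l.
  apply: (fin r q' m) => // [El1|_ El2]; first by rewrite El1 in nE1.
  by rewrite El2 /= (introF eqP l2l) in nE2.
have only m : adjT k m -> m <> l -> ~~ E m.
  move=> km ml; case: (around kl km) => [//|->//|[l2l ->]|[l2l l3l ->]].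
    by move: nE2; rewrite -/l1 -/l2 (introF eqP l2l) andbT.
  by move: nE3; rewrite (introF eqP l2l) (introF eqP l3l) andbT.
(* No other edge is drawn at [u], and [on_left] says nothing about directions. All cells around the
   vertex have one label, so any point of [A] close to the vertex will do; continuity at 0 provides
   one. *)
have [cg ig g0 _ Ag] := gA.
have [_ g0' _] := (continuous_within_itvP g (@ltr01 R)).1 cg.
have nv : nbhs (g 0) [set q | U q -> exists2 m, adjT k m &
    [/\ loc q = Cel (leftT k m) \/ loc q = edge_of k m /\ ~~ E m
      & lab (cell_of (loc q)) = lab (leftT k m)]].
  by rewrite g0; exact: near_vertex.
have [t [/andP[t0 t4] ht]] := near_radius_ex (g0' _ nv).
have t1 : t <= 1 by lra.
have in01 (x : R) : 0 <= x -> x <= 1 -> x \in `[0, 1].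
  by move=> ? ?; rewrite in_itv /=; apply/andP.
have [Ug eg] : face c (g t).
  apply: Af; split; first by rewrite Ag; exists t => //=; exact: in01 (ltW t0) t1.
  move=> /= e; move: (t0); rewrite -[X in X < _](ig t 0) ?ltxx //.
  - by rewrite inE; exact: in01 (ltW t0) t1.
  - by rewrite inE; exact: in01.
  - by rewrite e g0.
have [m km [_ em]] := ht Ug.
by rewrite -eg em; apply/esym; apply: (labels_around labk kl km).
Qed.

Lemma on_left_face u v c : u \in W -> v \in W -> G u v ->
  on_left G W D u v (face c) <-> lab (leftT (pi u) (pi v)) = lab c.
Proof.
move=> uW vW uv; have kl := pi_adj uW vW uv; split.
  by case=> A [q [jA Af left]]; exact: arc_left_of jA Af left.
move=> e; have [b hb] := spoke R kl; have kb := spoke_neq kl hb.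
exists (segment_set (ptT R (pi u)) b), b; split.
- exact: seg_jordan_arc.
- move=> _ [[t /= + <-] tn]; rewrite in_itv /= => /andP[+ t1].
  rewrite le_eqVlt => /predU1P[t0|t0]; first by case: tn; rewrite -t0 /= seg0.
  have lt : loc (seg (ptT R (pi u)) b t) = Cel (leftT (pi u) (pi v)).
    by apply: hb; rewrite t0.
  split; last by rewrite lt.
  by apply/(undrawnE pi_lt pi_adj); rewrite lt.
- move=> w; rewrite inE => /andP[wW uw] wv.
  have kn := pi_adj uW wW uw; set k := pi u in kl kb hb kn *.
  have nl : pi w <> pi v by move=> /pi_inj e'; apply: wv; exact: e'.
  have d0 := sqdist_gt0 kb.
  rewrite /ccw; near=> r; rewrite /= -/k.
  have r0 : 0 < r by near: r; exact: nbhs_right_gt.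
  have r4 : r < 1 / 4 by near: r; apply: nbhs_right_lt; lra.
  have rd : r < sqdist (ptT R k) b by near: r; exact: nbhs_right_lt.
  have r04 : 0 < r < 1 / 4 by rewrite r0.
  have r2d : r ^+ 2 <= sqdist (ptT R k) b.
    by apply: le_trans (ltW rd); rewrite expr2 ger_pMl //; lra.
  pose t := r / Num.sqrt (sqdist (ptT R k) b).
  have hit := seg_first_hit kb r0 r2d; rewrite -/t in hit.
  exists (ray k (pi v) (reach k r (pi v))), (seg (ptT R k) b t),
    (ray k (pi w) (reach k r (pi w))); split.
  + exact: ray_first_hit.
  + exact: hit.
  + exact: ray_first_hit.
  + have s0 : 0 < Num.sqrt (sqdist (ptT R k) b) by rewrite sqrtr_gt0.
    have t01 : 0 < t <= 1.
      rewrite divr_gt0 //= ler_pdivrMr // mul1r.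
      by rewrite -(@ler_pXn2r _ 2) ?nnegrE ?(ltW r0) ?(ltW s0) // sqr_sqrtr // ltW.
    apply: (@cell_before R k (r ^+ 2) (reach k r)) => //.
    * by rewrite exprn_gt0.
    * exact: radius16.
    * by move=> n kn'; exact: reach_gt0.
    * by move=> n kn'; exact: reach_circle.
    * by rewrite /on_circle sqdist_seg expr_div_n sqr_sqrtr ?ltW // divfK ?gt_eqF.
    * exact: hb.
Unshelve. all: by end_near. Qed.

Lemma boundaryE c : boundary G W D (face c) =
  ([set v | v \in W /\ exists2 m, adjT (pi v) m & lab (leftT (pi v) m) = lab c],
   [set d | [/\ d.1 \in W, d.2 \in W, G d.1 d.2
     & lab (leftT (pi d.1) (pi d.2)) = lab c]]).
Proof.
congr (_, _); apply/seteqP; split.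
- by move=> v [vW /(closure_face c vW)].
- by move=> v [vW /(closure_face c vW)].
- by move=> d [uW vW uv /(on_left_face c uW vW uv)].
- by move=> d [uW vW uv /(on_left_face c uW vW uv)].
Qed.
End Boundary.

Local Close Scope ring_scope.
Local Close Scope classical_set_scope.
Local Open Scope nat_scope.

(** * Placements of a window on the wheel *)

(* Union-find on the cells: each cell is labelled by a representative, and the
   two sides of an undrawn edge are merged. *)
Definition merge (l : seq nat) (e : nat * nat) : seq nat :=
  [seq if x == nth 0 l e.2 then nth 0 l e.1 else x | x <- l].

Definition merge_all (l : seq nat) (es : seq (nat * nat)) := foldl merge l es.

Lemma size_merge_all l es : size (merge_all l es) = size l.
Proof. by elim: es l => //= e es IH l; rewrite IH size_map. Qed.

Lemma nth_merge l e c : c < size l ->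
  nth 0 (merge l e) c =
  if nth 0 l c == nth 0 l e.2 then nth 0 l e.1 else nth 0 l c.
Proof. by move=> h; rewrite (nth_map 0). Qed.

Lemma merge_all_mono l es c d : c < size l -> d < size l ->
  nth 0 l c = nth 0 l d -> nth 0 (merge_all l es) c = nth 0 (merge_all l es) d.
Proof.
elim: es l => //= e es IH l cl dl h.
by apply: IH; rewrite ?size_map // !nth_merge // h.
Qed.

Lemma merge_all_joins l es e : e \in es -> e.1 < size l -> e.2 < size l ->
  nth 0 (merge_all l es) e.1 = nth 0 (merge_all l es) e.2.
Proof.
elim: es l => //= e' es IH l; rewrite inE => /predU1P[->|he] h1 h2; last first.
  by apply: IH; rewrite ?size_map.
by apply: merge_all_mono; rewrite ?size_map // !nth_merge // eqxx; case: ifP.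
Qed.

(** Merging identifies no more than it must; this becomes [lab_joined], while [merge_all_joins]
    becomes [lab_undrawn]. *)
Lemma merge_all_equiv (E : nat -> nat -> Prop) l es :
  (forall c, E c c) -> (forall c d, E c d -> E d c) ->
  (forall c d e, E c d -> E d e -> E c e) ->
  (forall e, e \in es -> [/\ e.1 < size l, e.2 < size l & E e.1 e.2]) ->
  (forall c d, c < size l -> d < size l -> nth 0 l c = nth 0 l d -> E c d) ->
  forall c d, c < size l -> d < size l ->
    nth 0 (merge_all l es) c = nth 0 (merge_all l es) d -> E c d.
Proof.
move=> Er Es Et; elim: es l => //= e es IH l hes hl.
have [e1 e2 Ee] := hes e (mem_head _ _).
have := IH (merge l e); rewrite size_map; apply.
  by move=> e' he'; apply: hes; rewrite inE he' orbT.
move=> c d cl dl; rewrite !nth_merge //.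
case: ifP => [/eqP h1|_]; case: ifP => [/eqP h2|_].
- by move=> _; apply: hl; rewrite // h1 h2.
- move=> h; apply: (Et _ e.2); first exact: hl.
  by apply: (Et _ e.1); [exact: Es | exact: hl].
- move=> h; apply: (Et _ e.1); first exact: hl.
  by apply: (Et _ e.2); [| apply: hl].
- exact: hl.
Qed.

(** Every label is a cell that labels itself, hence [inner_roots] contains exactly one cell of each
    internal face. *)
Definition rooted (l : seq nat) :=
  forall c, c < size l -> nth 0 l c < size l /\ nth 0 l (nth 0 l c) = nth 0 l c.

Lemma merge_all_rooted l es :
  (forall e, e \in es -> e.1 < size l /\ e.2 < size l) -> rooted l ->
  rooted (merge_all l es).
Proof.
elim: es l => //= e es IH l hes hl.
have [e1 e2] := hes e (mem_head _ _).
apply: IH => [e' he'|c].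
  by rewrite size_map; apply: hes; rewrite inE he' orbT.
rewrite size_map => cl; have [c1 c2] := hl c cl; have [d1 d2] := hl _ e1.
rewrite nth_merge //; case: ifP => [h|h]; rewrite nth_merge //.
  by rewrite d2; split=> //; case: ifP.
by rewrite c2 h.
Qed.

Definition tedges : seq (nat * nat) :=
  [:: (0, 1); (1, 2); (2, 3); (0, 3); (0, 4); (1, 4); (2, 4); (3, 4)].

(* Slots [s < m] stand for vertices; slot [s] is placed at vertex [nth 0 P s] of
   the wheel. *)
Section Placement.
Variables (P : seq nat) (m : nat) (H : nat -> nat -> bool).
Let at_ s := nth 0 P s.

Definition shown k l :=
  has (fun s => (at_ s == k) && has (fun t => (at_ t == l) && H s t) (iota 0 m))
    (iota 0 m).

Definition labels : seq nat :=
  merge_all (iota 0 5) [seq (leftT e.1 e.2, leftT e.2 e.1) |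
    e <- tedges & ~~ shown e.1 e.2].

Definition label c := nth 0 labels c.

Definition slot_vertices (L : seq nat) c : seq nat :=
  [seq s <- iota 0 m | has (fun l => nth 0 L (leftT (at_ s) l) == nth 0 L c)
     (rotT (at_ s))].

Definition slot_darts (L : seq nat) c : seq (nat * nat) :=
  [seq d <- allpairs pair (iota 0 m) (iota 0 m) | if H d.1 d.2 then
    nth 0 L (leftT (at_ d.1) (at_ d.2)) == nth 0 L c else false].

Definition slot_boundary (L : seq nat) c := (slot_vertices L c, slot_darts L c).

Definition slot_rotation s : seq nat :=
  [seq t <- [seq index k P | k <- rotT (at_ s)] | (t < m) && H s t].

Definition inner_roots : seq nat :=
  [seq c <- iota 0 5 | (label c == c) && (label c != label 0)].

Lemma shownP k l : reflect
  (exists s t, [/\ s < m, t < m, H s t, at_ s = k & at_ t = l]) (shown k l).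
Proof.
apply: (iffP hasP) => [[s]|[s [t [sm tm st sk tl]]]].
  rewrite mem_iota add0n => /andP[_ sm] /andP[/eqP sk /hasP[t]].
  by rewrite mem_iota add0n => /andP[_ tm] /andP[/eqP tl st]; exists s, t.
exists s; rewrite ?mem_iota // sk eqxx; apply/hasP; exists t.
  by rewrite mem_iota.
by rewrite tl eqxx.
Qed.

Lemma tedge_cells e : e \in [seq (leftT e.1 e.2, leftT e.2 e.1) |
    e <- tedges & ~~ shown e.1 e.2] -> e.1 < 5 /\ e.2 < 5.
Proof.
case/mapP => -[k l]; rewrite mem_filter => /andP[_]; rewrite !inE.
do ?[case/orP]; by move=> /eqP[-> ->] ->.
Qed.

Lemma label_rooted c : c < 5 -> label c < 5 /\ label (label c) = label c.
Proof.
have r0 : rooted (iota 0 5) by move=> d; rewrite size_iota => d5; rewrite !nth_iota.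
by have := @merge_all_rooted (iota 0 5) _ tedge_cells r0 c; rewrite size_merge_all.
Qed.

Hypothesis H_sym : symmetric H.

Lemma shown_sym k l : shown k l = shown l k.
Proof.
by apply/shownP/shownP => -[s [t [? ? ? ? ?]]]; exists t, s; rewrite H_sym.
Qed.

Lemma tedges_mem k l : adjT k l -> (k, l) \in tedges \/ (l, k) \in tedges.
Proof.
by elim/adjT_cases; [left|left|left|left|left|right|left|left|right|right|left
  |right|right|right|right|right].
Qed.

Lemma label_undrawn k l : adjT k l -> ~~ shown k l ->
  label (leftT k l) = label (leftT l k).
Proof.
have side k' l' : (k', l') \in tedges -> ~~ shown k' l' ->
    label (leftT k' l') = label (leftT l' k').
  move=> he nd; have he' : (leftT k' l', leftT l' k') \in
      [seq (leftT e.1 e.2, leftT e.2 e.1) | e <- tedges & ~~ shown e.1 e.2].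
    by apply/mapP; exists (k', l'); rewrite // mem_filter nd.
  have [h1 h2] := tedge_cells he'.
  by have := merge_all_joins he'; apply.
move=> /tedges_mem[] he nd; first exact: side.
by apply/esym/side => //; rewrite shown_sym.
Qed.

Lemma label_joined (E : nat -> nat -> Prop) :
  (forall c, E c c) -> (forall c d, E c d -> E d c) ->
  (forall c d e, E c d -> E d e -> E c e) ->
  (forall k l, adjT k l -> ~~ shown k l -> E (leftT k l) (leftT l k)) ->
  forall c d, c < 5 -> d < 5 -> label c = label d -> E c d.
Proof.
move=> Er Es Et Ee; apply: (merge_all_equiv (l := iota 0 5)) => // [e he|c d].
  have [h1 h2] := tedge_cells he; split=> //.
  case/mapP: he => -[k l]; rewrite mem_filter => /andP[nd kl] -> /=.
  apply: Ee nd; move: kl; rewrite !inE.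
  do ?[case/orP]; by move=> /eqP[-> ->].
by rewrite size_iota => c5 d5; rewrite !nth_iota // !add0n => ->.
Qed.
End Placement.

Definition placement_ok (P : seq nat) (m : nat) (H : nat -> nat -> bool) : bool :=
  [&& uniq P, all (fun k => k < 5) P, m <= size P &
    all (fun s => all (fun t => H s t ==> adjT (nth 0 P s) (nth 0 P t))
      (iota 0 m)) (iota 0 m)].

Definition name_boundary (V : Type) (nm : nat -> V)
    (b : seq nat * seq (nat * nat)) : seq V * seq (V * V) :=
  (map nm b.1, [seq (nm d.1, nm d.2) | d <- b.2]).

Section Slots.
Variables (V : finType) (G : sgraph V) (W : {set V}).
Variables (nm : nat -> V) (sl : V -> nat) (m : nat) (H : nat -> nat -> bool).

Definition slots_of : Prop :=
  [/\ forall v, v \in W -> sl v < m /\ nm (sl v) = v,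
      forall s, s < m -> nm s \in W /\ sl (nm s) = s,
      forall s t, s < m -> t < m -> H s t = G (nm s) (nm t) & symmetric H].

Hypothesis sH : slots_of.

Section OnePlacement.
Variables (P : seq nat) (pi : V -> nat).
Hypothesis P_ok : placement_ok P m H.
Hypothesis piE : forall v, v \in W -> pi v = nth 0 P (sl v).

Let sl_lt v : v \in W -> sl v < m. Proof. by case: sH => h _ _ _ /h[]. Qed.
Let nm_sl v : v \in W -> nm (sl v) = v. Proof. by case: sH => h _ _ _ /h[]. Qed.
Let nm_in s : s < m -> nm s \in W. Proof. by case: sH => _ h _ _ /h[]. Qed.
Let sl_nm s : s < m -> sl (nm s) = s. Proof. by case: sH => _ h _ _ /h[]. Qed.
Let HE s t : s < m -> t < m -> H s t = G (nm s) (nm t).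
Proof. by case: sH => _ _ h _; exact: h. Qed.
Let H_sym : symmetric H. Proof. by case: sH. Qed.
Let P_uniq : uniq P. Proof. by case/and4P: P_ok. Qed.
Let P_size : m <= size P. Proof. by case/and4P: P_ok. Qed.

Lemma pi_nm s : s < m -> pi (nm s) = nth 0 P s.
Proof. by move=> sm; rewrite piE ?sl_nm //; exact: nm_in. Qed.

Lemma pi_inj : {in W &, injective pi}.
Proof.
move=> u v uW vW; rewrite !piE // => /eqP; rewrite nth_uniq //.
- by move=> /eqP e; rewrite -(nm_sl uW) e nm_sl.
- exact: leq_trans (sl_lt uW) P_size.
- exact: leq_trans (sl_lt vW) P_size.
Qed.

Lemma pos_lt s : s < m -> nth 0 P s < 5.
Proof.
by move=> sm; case/and4P: P_ok => _ /all_nthP h _ _; apply: h; exact: leq_trans sm _.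
Qed.

Lemma pi_lt v : v \in W -> pi v < 5.
Proof. by move=> vW; rewrite piE //; apply/pos_lt/sl_lt. Qed.

Lemma pos_adj s t : s < m -> t < m -> H s t -> adjT (nth 0 P s) (nth 0 P t).
Proof.
move=> sm tm; case/and4P: P_ok => _ _ _ /allP/(_ s); rewrite mem_iota => /(_ sm).
by move=> /allP/(_ t); rewrite mem_iota => /(_ tm)/implyP.
Qed.

Lemma pi_adj u v : u \in W -> v \in W -> G u v -> adjT (pi u) (pi v).
Proof.
move=> uW vW uv; rewrite !piE //; apply: pos_adj; try exact: sl_lt.
by rewrite HE ?nm_sl //; exact: sl_lt.
Qed.

Lemma drawn_edge_shown k l : drawn_edge G W pi k l = shown P m H k l.
Proof.
apply/drawn_edgeP/shownP => [[u [v [uW vW uv <- <-]]]|[s [t [sm tm st <- <-]]]].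
  exists (sl u), (sl v); rewrite !piE //; split=> //; try exact: sl_lt.
  by rewrite HE ?nm_sl //; exact: sl_lt.
exists (nm s), (nm t); rewrite !pi_nm // !nm_in // -HE //.
Qed.

Let lab := label P m H.

Lemma lab_undrawn k l : adjT k l -> ~~ drawn_edge G W pi k l ->
  lab (leftT k l) = lab (leftT l k).
Proof. by rewrite drawn_edge_shown; exact: label_undrawn. Qed.

Lemma lab_joined (E : nat -> nat -> Prop) :
  (forall c, E c c) -> (forall c d, E c d -> E d c) ->
  (forall c d e, E c d -> E d e -> E c e) ->
  (forall k l, adjT k l -> ~~ drawn_edge G W pi k l ->
     E (leftT k l) (leftT l k)) ->
  forall c d, c < 5 -> d < 5 -> lab c = lab d -> E c d.
Proof.
move=> h1 h2 h3 h4; apply: label_joined => // k l kl nd.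
by apply: h4; rewrite // drawn_edge_shown.
Qed.

Variable R : realType.
Let D := wheel_drawing R pi.
Let face := @face R V G W pi lab.

Lemma slot_boundaryE c :
  boundary G W D (face c) = listed (name_boundary nm (slot_boundary P m H (labels P m H) c)).
Proof.
rewrite (boundaryE R pi_inj pi_lt pi_adj lab_undrawn) /listed /=.
congr (_, _); apply/seteqP; split=> /=.
- move=> v [vW [k]]; rewrite piE // => vk e.
  apply/mapP; exists (sl v); last by rewrite nm_sl.
  rewrite mem_filter mem_iota /= add0n sl_lt // andbT.
  by apply/hasP; exists k => //; apply/eqP.
- move=> v /mapP[s]; rewrite mem_filter mem_iota add0n /= => /andP[/hasP[k sk]].
  move=> /eqP e sm ->; split; first exact: nm_in.
  by exists k; rewrite pi_nm.
- move=> [u v] /= [uW vW uv e]; apply/mapP; exists (sl u, sl v); last first.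
    by rewrite /= !nm_sl.
  rewrite mem_filter /= HE ?sl_lt // !nm_sl // uv /=; apply/andP; split.
    by apply/eqP; rewrite -!piE.
  by apply/allpairsP; exists (sl u, sl v); rewrite !mem_iota !add0n !sl_lt.
- move=> [u v] /mapP[[s t]]; rewrite mem_filter /= => /andP[].
  case st : (H s t) => // /eqP e.
  case/allpairsP => -[s' t'] /= []; rewrite !mem_iota !add0n /= => sm tm [].
  move=> es et; subst s' t' => -[-> ->]; split; [exact: nm_in|exact: nm_in| |].
    by rewrite -HE.
  by rewrite !pi_nm.
Qed.

Lemma facesE' : faces G W D = [set face c | c in [set c | c < 5]]%classic.
Proof.
by apply: facesE; [exact: pi_lt|exact: pi_adj|exact: lab_undrawn|exact: lab_joined].
Qed.

Lemma external_faceE' : external_face G W D = [set face 0]%classic.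
Proof.
by apply: external_faceE;
  [exact: pi_lt|exact: pi_adj|exact: lab_undrawn|exact: lab_joined].
Qed.

Lemma slot_faces : (boundary G W D @` faces G W D =
  [set listed (name_boundary nm (slot_boundary P m H (labels P m H) c))
    | c in [set c | c < 5]])%classic.
Proof.
rewrite facesE'; apply/seteqP; split=> b /=.
  by move=> [_ [c c5 <-] <-]; exists c => //; rewrite slot_boundaryE.
by move=> [c c5 <-]; exists (face c); [exists c | rewrite slot_boundaryE].
Qed.

Lemma slot_external : (boundary G W D @` external_face G W D =
  [set listed (name_boundary nm (slot_boundary P m H (labels P m H) 0))])%classic.
Proof. by rewrite external_faceE' image_set1 slot_boundaryE. Qed.

(** The free position [g] is where the removed vertex was or the new one will be. No edge at it is
    drawn, so it lies inside a face, and any cell around it represents this face. *)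
Lemma slot_ghost g : g < 5 -> g \notin [seq nth 0 P s | s <- iota 0 m] ->
  boundary G W D (face_at G W D (ptT R g)) =
  listed (name_boundary nm (slot_boundary P m H (labels P m H) (cell_of (Vtx g)))).
Proof.
move=> g5 gP; rewrite (face_atE pi_lt pi_adj lab_undrawn (@lab_joined)).
  by rewrite loc_ptT // slot_boundaryE.
apply/(undrawnE pi_lt pi_adj); rewrite loc_ptT //=.
apply/drawn_vertexP => -[v vW e]; move/negP: gP; apply; apply/mapP.
by exists (sl v); rewrite ?mem_iota ?sl_lt // -piE.
Qed.

Lemma slot_ccw s a b d : s < m -> a < m -> b < m -> d < m ->
  H s a -> H s b -> H s d ->
  ccw (pos D (nm s)) (curve D (nm s) (nm a)) (curve D (nm s) (nm b))
    (curve D (nm s) (nm d)) <->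
  cycT (nth 0 P s) (nth 0 P a) (nth 0 P b) (nth 0 P d).
Proof.
move=> sm am bm dm sa sb sd; rewrite /= !pi_nm //.
by apply: ccw_rays; exact: pos_adj.
Qed.

Lemma slot_planar : planar_drawing G W D.
Proof. exact: wheel_planar pi_inj pi_lt pi_adj. Qed.

End OnePlacement.

Section TwoPlacements.
Variables (P P' : seq nat) (g g' : nat).

(* The [if]s keep the evaluation by [vm_compute] short. *)
Definition same_embedding : bool :=
  let I := iota 0 m in
  let B := [seq slot_boundary P m H (labels P m H) c | c <- iota 0 5] in
  let B' := [seq slot_boundary P' m H (labels P' m H) c | c <- iota 0 5] in
  [&& all (fun s => all (fun a => if H s a then all (fun b => if H s b then
        all (fun d => if H s d then
          (cycT (nth 0 P s) (nth 0 P a) (nth 0 P b) (nth 0 P d) ==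
           cycT (nth 0 P' s) (nth 0 P' a) (nth 0 P' b) (nth 0 P' d)) else true)
        I else true) I else true) I) I,
      all (fun b => b \in B') B, all (fun b => b \in B) B',
      nth ([::], [::]) B 0 == nth ([::], [::]) B' 0 &
      nth ([::], [::]) B (cell_of (Vtx g)) == nth ([::], [::]) B' (cell_of (Vtx g'))].

Variables (pi pi' : V -> nat) (R : realType).
Hypothesis P_ok : placement_ok P m H.
Hypothesis P_ok' : placement_ok P' m H.
Hypothesis piE : forall v, v \in W -> pi v = nth 0 P (sl v).
Hypothesis piE' : forall v, v \in W -> pi' v = nth 0 P' (sl v).
Hypothesis g5 : g < 5.
Hypothesis g5' : g' < 5.
Hypothesis gP : g \notin [seq nth 0 P s | s <- iota 0 m].
Hypothesis gP' : g' \notin [seq nth 0 P' s | s <- iota 0 m].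
Let D := wheel_drawing R pi.
Let D' := wheel_drawing R pi'.

Lemma same_embedding_equivalent : same_embedding -> equivalent G W D D' /\
  boundary G W D (face_at G W D (ptT R g)) =
  boundary G W D' (face_at G W D' (ptT R g')).
Proof.
have [h1 h2 h3 _] := sH.
case/and5P => /allP rot /allP f1 /allP f2 /eqP ext /eqP gh.
have {ext} ext : slot_boundary P m H (labels P m H) 0 =
    slot_boundary P' m H (labels P' m H) 0 by [].
have {gh} gh : slot_boundary P m H (labels P m H) (cell_of (Vtx g)) =
    slot_boundary P' m H (labels P' m H) (cell_of (Vtx g')).
  have lt5 x : x < 5 -> cell_of (Vtx x) < 5 by case: x => [|[|[|[|[|]]]]].
  have lt := lt5 _ g5; have lt' := lt5 _ g5'.
  by move: gh; rewrite !(nth_map 0) ?size_iota // !nth_iota // !add0n.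
split; last first.
  by rewrite (slot_ghost P_ok piE) // (slot_ghost P_ok' piE') // gh.
split.
- move=> v a b c vW; rewrite !inE => /andP[aW va] /andP[bW vb] /andP[cW vc].
  have [[vm ev] [am ea]] := (h1 _ vW, h1 _ aW).
  have [[bm eb] [cm ec]] := (h1 _ bW, h1 _ cW).
  move: va vb vc; rewrite -ev -ea -eb -ec -!h3 // => va vb vc.
  rewrite (slot_ccw P_ok piE) // (slot_ccw P_ok' piE') //.
  have := rot (sl v); rewrite mem_iota => /(_ vm)/allP/(_ (sl a)).
  rewrite mem_iota va => /(_ am)/allP/(_ (sl b)).
  rewrite mem_iota vb => /(_ bm)/allP/(_ (sl c)).
  by rewrite mem_iota vc => /(_ cm)/eqP ->.
- rewrite (slot_faces P_ok piE) (slot_faces P_ok' piE').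
  apply/seteqP; split=> _ [c /= c5 <-].
    have /f1 : slot_boundary P m H (labels P m H) c \in
        [seq slot_boundary P m H (labels P m H) c | c <- iota 0 5].
      by apply: map_f; rewrite mem_iota.
    by case/mapP => c'; rewrite mem_iota => c5' ->; exists c'.
  have /f2 : slot_boundary P' m H (labels P' m H) c \in
      [seq slot_boundary P' m H (labels P' m H) c | c <- iota 0 5].
    by apply: map_f; rewrite mem_iota.
  by case/mapP => c'; rewrite mem_iota => c5' ->; exists c'.
- by rewrite (slot_external P_ok piE) (slot_external P_ok' piE') ext.
Qed.
End TwoPlacements.
End Slots.

Lemma equivalent_sym (R : realType) (V : finType) (G : sgraph V) (W : {set V})
  (D D' : drawing R V) : equivalent G W D D' -> equivalent G W D' D.
Proof.
by case=> h1 h2 h3; split=> // v a b c vW ha hb hc; rewrite h1.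
Qed.

Lemma equivalent_trans (R : realType) (V : finType) (G : sgraph V) (W : {set V})
  (D D' D'' : drawing R V) : equivalent G W D D' -> equivalent G W D' D'' ->
  equivalent G W D D''.
Proof.
case=> h1 h2 h3 [k1 k2 k3]; split=> [v a b c vW ha hb hc||].
- by rewrite h1 // k1.
- by rewrite h2.
- by rewrite h3.
Qed.

Lemma equivalent_refl (R : realType) (V : finType) (G : sgraph V) (W : {set V})
  (D : drawing R V) : equivalent G W D D.
Proof. by split. Qed.

Definition slot_code (V : finType) (nm : nat -> V) (P : seq nat)
    (H : nat -> nat -> bool) : embedding_code V :=
  Code [seq (nm s, map nm (slot_rotation P 5 H s)) | s <- iota 0 5]
    (name_boundary nm (slot_boundary P 5 H (labels P 5 H) 0))
    [seq name_boundary nm (slot_boundary P 5 H (labels P 5 H) c) | c <- inner_roots P 5 H].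

Lemma subseq_cycT k a b d : subseq [:: a; b; d] (rotT k) -> cycT k a b d.
Proof.
move=> h; have km x : x \in [:: a; b; d] -> adjT k x by exact: mem_subseq h x.
have [ka kb kd] : [/\ adjT k a, adjT k b & adjT k d].
  by split; apply: km; rewrite !inE eqxx ?orbT.
move: ka kb kd h {km}; rewrite /adjT.
case: k => [|[|[|[|[|k]]]]] //; rewrite !inE.
all: do ?[case/orP]; move=> /eqP ->; do ?[case/orP]; move=> /eqP ->;
  do ?[case/orP]; by move=> /eqP ->.
Qed.

Section Describes.
Variables (R : realType) (V : finType) (G : sgraph V) (W : {set V}).
Variables (nm : nat -> V) (sl : V -> nat) (H : nat -> nat -> bool).
Hypothesis sH : slots_of G W nm sl 5 H.
Variables (P : seq nat) (pi : V -> nat).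
Hypothesis P_ok : placement_ok P 5 H.
Hypothesis P5 : size P = 5.
Hypothesis piE : forall v, v \in W -> pi v = nth 0 P (sl v).
Let D := wheel_drawing R pi.

Lemma mem_placement k : (k \in P) = (k < 5).
Proof.
case/and4P: P_ok => uP lP _ _.
have sub : {subset P <= iota 0 5}.
  by move=> x xP; rewrite mem_iota; exact: (allP lP).
have [_ e] := uniq_min_size uP sub (eq_leq (etrans (size_iota 0 5) (esym P5))).
by rewrite e mem_iota.
Qed.

Lemma slot_at s : s < 5 -> index (nth 0 P s) P = s.
Proof. by move=> s5; case/and4P: P_ok => uP _ _ _; rewrite index_uniq // P5. Qed.

Lemma slot_rotationE s : s < 5 ->
  slot_rotation P 5 H s =
  [seq index k P | k <- [seq k <- rotT (nth 0 P s) | H s (index k P)]].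
Proof.
move=> s5; rewrite /slot_rotation filter_map; congr map.
apply: eq_in_filter => k ks; rewrite /= -[X in _ < X]P5 index_mem mem_placement.
by have [_ ->] := adjT_lt ks.
Qed.

Lemma slot_rotation_uniq s : s < 5 -> uniq (slot_rotation P 5 H s).
Proof.
move=> s5; rewrite slot_rotationE // map_inj_in_uniq.
  by apply: filter_uniq; case: (nth 0 P s) => [|[|[|[|[|]]]]].
move=> k l; rewrite !mem_filter => /andP[_ /adjT_lt[_ k5]] /andP[_ /adjT_lt[_ l5]].
by move/(congr1 (nth 0 P)); rewrite !nth_index ?mem_placement.
Qed.

Lemma mem_slot_rotation s t : s < 5 ->
  (t \in slot_rotation P 5 H s) = (t < 5) && H s t.
Proof.
move=> s5; rewrite /slot_rotation mem_filter andbC; apply: andb_idl => /andP[t5 st].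
apply/mapP; exists (nth 0 P t); last by rewrite slot_at.
exact: pos_adj P_ok _ _ s5 t5 st.
Qed.

Lemma slot_code_describes : describes G W (slot_code nm P H) D.
Proof.
have [h1 h2 h3 Hs] := sH.
have nm_inj : {in gtn 5 &, injective nm}.
  move=> s t; rewrite !inE => s5 t5 e.
  by rewrite -(h2 s s5).2 e (h2 t t5).2.
split.
- have -> : unzip1 (code_rotation (slot_code nm P H)) = map nm (iota 0 5) by [].
  split.
    rewrite map_inj_in_uniq ?iota_uniq // => s t; rewrite !mem_iota => s5 t5.
    exact: nm_inj.
  move=> v; apply/mapP/idP => [[s]|vW].
    by rewrite mem_iota => s5 ->; have [] := h2 s s5.
  have [v5 e] := h1 v vW; exists (sl v); rewrite ?mem_iota //=.
- move=> v l /mapP[s]; rewrite mem_iota => /= s5 [-> ->].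
  have lt5 t : t \in slot_rotation P 5 H s -> t < 5.
    by rewrite mem_slot_rotation // => /andP[].
  split.
  + rewrite map_inj_in_uniq ?slot_rotation_uniq // => t t' /lt5 ? /lt5 ?.
    exact: nm_inj.
  + move=> w; rewrite inE; apply/mapP/andP => [[t]|[wW sw]].
      rewrite mem_slot_rotation // => /andP[t5 st] ->.
      by rewrite -h3 // st; have [-> _] := h2 t t5.
    have [w5 e] := h1 w wW; exists (sl w); last by [].
    by rewrite mem_slot_rotation // w5 h3 // e.
  + move=> a b d /subseqP[msk _]; rewrite -map_mask slot_rotationE // -map_mask.
    case e : (mask msk _) => [|ka [|kb [|kd [|kx l']]]] //= [-> -> ->].
    have sub : subseq [:: ka; kb; kd] [seq k <- rotT (nth 0 P s) | H s (index k P)].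
      by rewrite -e mask_subseq.
    have hk k : k \in [:: ka; kb; kd] ->
        [/\ index k P < 5, H s (index k P) & nth 0 P (index k P) = k].
      move=> /(mem_subseq sub); rewrite mem_filter => /andP[sk /adjT_lt[_ k5]].
      by rewrite -{1}P5 index_mem nth_index mem_placement.
    have [|ka5 Ha ea] := hk ka; first by rewrite !inE eqxx.
    have [|kb5 Hb eb] := hk kb; first by rewrite !inE eqxx orbT.
    have [|kd5 Hd ed] := hk kd; first by rewrite !inE eqxx !orbT.
    apply/(slot_ccw sH P_ok piE) => //; rewrite ea eb ed.
    exact/subseq_cycT/(subseq_trans sub)/filter_subseq.
- exact: (slot_external sH P_ok piE).
- rewrite (facesE' sH P_ok piE) (external_faceE' sH P_ok piE).
  have fe c d : c < 5 -> @face R V G W pi (label P 5 H) c = face G W pi (label P 5 H) d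
      <-> label P 5 H c = label P 5 H d.
    by apply: face_eq; [exact: (pi_lt sH P_ok piE) | exact: (pi_adj sH P_ok piE)].
  apply/seteqP; split=> [b [f [[c /= c5 fc] f0] <-]|b /= [bd /mapP[c]]].
    subst f.
    (* The code lists a face only under its root, so [c] is replaced by its label. *)
    have [lc5 llc] := label_rooted P 5 H c5.
    exists (name_boundary nm (slot_boundary P 5 H (labels P 5 H) (label P 5 H c))).
      apply/mapP; exists (label P 5 H c) => //.
      rewrite mem_filter mem_iota lc5 llc eqxx /= andbT.
      by apply/eqP => e; apply: f0; apply/fe => //; rewrite -llc.
    rewrite (slot_boundaryE sH P_ok piE).
    suff -> : slot_boundary P 5 H (labels P 5 H) (label P 5 H c) =
      slot_boundary P 5 H (labels P 5 H) c by [].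
    by congr (_, _); apply: eq_filter => s; rewrite -!/(label P 5 H _) llc.
  rewrite mem_filter mem_iota => /andP[/andP[/eqP cc /eqP c0] /= c5] -> <-.
  exists (face G W pi (label P 5 H) c); last exact: (slot_boundaryE sH P_ok piE).
  by split; [exists c | move=> /(fe _ _ c5)].
Qed.
End Describes.

(** * Placements for all window graphs *)

(* A graph on the slots 0, ..., 4 is given by ten bits, for the pairs 01, 02,
   03, 04, 12, 13, 14, 23, 24, 34. *)
Definition adjacency_matrix (b : seq bool) : seq (seq bool) :=
  let e i := nth false b i in
  [:: [:: false; e 0; e 1; e 2; e 3]; [:: e 0; false; e 4; e 5; e 6];
      [:: e 1; e 4; false; e 7; e 8]; [:: e 2; e 5; e 7; false; e 9];
      [:: e 3; e 6; e 8; e 9; false]].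

Definition matrix_graph (M : seq (seq bool)) (s t : nat) : bool :=
  nth false (nth [::] M s) t.

Definition graph_of b := matrix_graph (adjacency_matrix b).

(** Twelve of the 120 bijections between slots and wheel vertices; [windows_checked] shows that they
    suffice. *)
Definition placements : seq (seq nat) :=
  [:: [:: 0; 1; 2; 3; 4]; [:: 0; 1; 3; 2; 4]; [:: 0; 2; 1; 3; 4];
      [:: 4; 0; 1; 2; 3]; [:: 4; 0; 2; 1; 3]; [:: 4; 0; 3; 1; 2];
      [:: 0; 1; 2; 4; 3]; [:: 0; 1; 3; 4; 2]; [:: 0; 1; 4; 3; 2];
      [:: 0; 2; 4; 3; 1]; [:: 0; 2; 3; 4; 1]; [:: 0; 1; 4; 2; 3]].

Definition graph4_code (H : nat -> nat -> bool) : nat :=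
  H 0 1 + H 0 2 * 2 + H 0 3 * 4 + H 1 2 * 8 + H 1 3 * 16 + H 2 3 * 32.

(* For each graph on four slots, the embedding to which the windows before and
   after are both restricted; the last entry is the position of a fifth vertex
   in the outer face.  Every cycle is oriented so that its least slot is
   followed by the smaller of its two neighbours, and has an empty interior. *)
Definition canonical_placement (H : nat -> nat -> bool) : seq nat :=
  nth [::] [:: [:: 0; 1; 2; 4; 3]; [:: 0; 1; 4; 3; 2]; [:: 0; 1; 3; 4; 2];
      [:: 0; 2; 1; 4; 3]; [:: 0; 1; 4; 2; 3]; [:: 0; 2; 3; 4; 1]]
    (nth 0 [:: 0; 0; 1; 1; 0; 0; 1; 1; 0; 0; 1; 1; 0; 0; 1; 1;
               0; 0; 2; 2; 0; 0; 2; 2; 0; 0; 3; 4; 0; 0; 3; 0;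
               0; 0; 1; 1; 0; 0; 1; 1; 0; 0; 1; 1; 0; 0; 1; 0;
               0; 0; 2; 2; 0; 0; 3; 0; 0; 0; 5; 0; 0; 0; 0; 0]
       (graph4_code H)).

Definition canonical (H : nat -> nat -> bool) (P : seq nat) (g : nat) : bool :=
  let C := canonical_placement H in
  if placement_ok P 4 H && placement_ok (take 4 C) 4 H
  then same_embedding 4 H P (take 4 C) g (nth 0 C 4) else false.

Definition shifted (H : nat -> nat -> bool) s t := H s.+1 t.+1.

(** When the oldest vertex leaves, the slots move down by one; after this shift both windows name
    the shared vertices by the same four slots. The position of the missing vertex is passed as the
    free point. *)
Definition canonical_without_oldest M P :=
  canonical (shifted (matrix_graph M)) (behead P) (head 0 P).
Definition canonical_without_newest M P :=
  canonical (matrix_graph M) (take 4 P) (nth 0 P 4).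

(** The first window has no predecessor and the last one no successor, so each of them is compared
    on one side only. *)
Definition suits (first middle : bool) (M : seq (seq bool)) (P : seq nat) : bool :=
  if placement_ok P 5 (matrix_graph M) then
    if first then canonical_without_oldest M P else
    if canonical_without_newest M P then
      if middle then canonical_without_oldest M P else true
    else false
  else false.

Definition first_placement first middle M : seq nat :=
  nth [::] placements (find (suits first middle M) placements).

(** The choice may not depend on whether the window is the last one, which the adjacencies do not
    tell. A placement good on both sides is preferred; by [windows_checked] one exists for all
    middle windows, so the one-sided choice is left to last windows. *)
Definition place (first : bool) (b : seq bool) : seq nat :=
  let M := adjacency_matrix b in
  if first then first_placement true false M
  else if find (suits false true M) placements < size placements then first_placement false true M
  else first_placement false false M.

Definition slot_degree M s := count (matrix_graph M s) (iota 0 5).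
Definition slot_edges M := sumn [seq slot_degree M s | s <- iota 0 5].

(** [slot_edges] counts every edge twice: 8 and 12 stand for four and six edges. *)
Definition middle_window M :=
  all (fun s => slot_degree M s <= 3) (iota 0 5) && (slot_edges M <= 8).
(* [x] is the slot of the vertex that has all its neighbours in the window. *)
Definition end_window x M :=
  [&& all (fun s => slot_degree M s <= 3) (iota 0 5), slot_edges M <= 12,
      slot_degree M x == 3 &
      3 <= count (fun s => (s != x) && (slot_degree M s <= 2)) (iota 0 5)].

Definition suited first middle M :=
  find (suits first middle M) placements < size placements.

Definition window_check b :=
  let M := adjacency_matrix b in
  [&& if middle_window M then suited false true M else true,
      if end_window 0 M then suited true false M else true &
      if end_window 4 M then suited false false M else true].

Fixpoint bit_lists n : seq (seq bool) :=
  if n is n'.+1 then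
    [seq false :: b | b <- bit_lists n'] ++ [seq true :: b | b <- bit_lists n']
  else [:: [::]].

Lemma windows_checked : all window_check (bit_lists 10).
Proof. vm_compute; reflexivity. Qed.

(** * Windows of cubic triconnected stories *)

Definition pairs5 : seq (nat * nat) :=
  [:: (0, 1); (0, 2); (0, 3); (0, 4); (1, 2); (1, 3); (1, 4); (2, 3); (2, 4); (3, 4)].

Lemma mem_bit_lists n b : (b \in bit_lists n) = (size b == n).
Proof.
elim: n b => [|n IH] [|x b] //=.
  by apply/negP; rewrite mem_cat => /orP[] /mapP[].
rewrite mem_cat eqSS -IH; apply/orP/idP => [[] /mapP[b' hb [_ ->]] //|hb].
by case: x; [right | left]; apply: map_f.
Qed.

Lemma slot_edgesE b : size b = 10 ->
  slot_edges (adjacency_matrix b) = (count id b).*2.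
Proof.
move=> b10; have h : all (fun b => slot_edges (adjacency_matrix b) == (count id b).*2)
  (bit_lists 10) by vm_compute.
by apply/eqP; apply: (allP h); rewrite mem_bit_lists b10.
Qed.

Lemma slot_edges_even b : size b = 10 -> ~~ odd (slot_edges (adjacency_matrix b)).
Proof. by move=> b10; rewrite slot_edgesE // odd_double. Qed.

Lemma leq_count_in (a1 a2 : pred nat) s :
  {in s, forall x, a1 x -> a2 x} -> count a1 s <= count a2 s.
Proof.
elim: s => //= x s IH h; apply: leq_add; last first.
  by apply: IH => y ys; apply: h; rewrite inE ys orbT.
by have := h x (mem_head _ _); case: (a1 x) => // ->.
Qed.

Lemma graph_of_sym b : symmetric (graph_of b).
Proof.
by case=> [|[|[|[|[|s]]]]] [|[|[|[|[|t]]]]]; rewrite /graph_of /matrix_graph /=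
  ?nth_nil.
Qed.

Section Triconnected.
Variables (V : finType) (G : sgraph V).
Hypothesis G3 : triconnected G.

(** If the set [X] of these ends had at most two elements, some [a] in [A] would survive its
    removal. No remaining edge leaves [A], so [a] and [b] would be separated. *)
Lemma three_endpoints (A : {set V}) (b : V) : 3 <= #|A| -> b \notin A ->
  3 <= #|[set v in A | [exists u, (u \notin A) && G v u]]|.
Proof.
move=> A3 bA; set X := [set v in A | _]; rewrite leqNgt; apply/negP => X3.
have [a aA aX] : exists2 a, a \in A & a \notin X.
  apply/fintype.subsetPn/negP => /subset_leq_card; rewrite leqNgt.
  by rewrite (leq_trans X3 A3).
have bX : b \notin X by rewrite inE (negbTE bA).
have := G3.2 X X3 a b; rewrite !finset.in_setC => /(_ aX bX).
have clo : fingraph.closed [rel u v | [&& u \in ~: X, v \in ~: X & G u v]]%SET (mem A).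
  have half u v : u \notin X -> G u v -> u \in A -> v \in A.
    move=> uX uv uA; apply/negPn/negP => vA; move/negP: uX; apply.
    by rewrite inE uA; apply/existsP; exists v; rewrite vA.
  move=> u v /= /and3P[]; rewrite !finset.in_setC => uX vX uv; apply/idP/idP.
    exact: half uX uv.
  by apply: half vX _; rewrite adjacent_sym.
by move=> /(closed_connect clo) /=; rewrite aA (negbTE bA).
Qed.
End Triconnected.

Section Story.
Variables (V : finType) (S : graph_story V) (v0 : V).
Let G := story_graph S.
Let ord := story_order S.
Let n := #|V|.
Let ix v := index v ord.
Hypothesis G3 : triconnected G.
Hypothesis Gc : cubic G.
Hypothesis omega5 : omega S = 5.

Definition vtx j := nth v0 ord j.

Lemma size_ord : size ord = n.
Proof.
rewrite /n cardE; apply: perm_size; apply: uniq_perm.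
- exact: story_order_uniq.
- exact: enum_uniq.
- by move=> v; rewrite mem_enum story_order_full.
Qed.

Lemma ix_lt v : ix v < n.
Proof. by rewrite -size_ord index_mem story_order_full. Qed.

Lemma vtx_ix v : vtx (ix v) = v.
Proof. by rewrite /vtx nth_index // story_order_full. Qed.

Lemma ix_vtx j : j < n -> ix (vtx j) = j.
Proof. by move=> jn; rewrite /ix /vtx index_uniq ?size_ord // story_order_uniq. Qed.

Lemma n_ge5 : 5 <= n.
Proof. by rewrite -omega5; exact: omega_le. Qed.

Definition adj j k := [&& j < n, k < n & G (vtx j) (vtx k)].

Lemma adj_sym : symmetric adj.
Proof. by move=> j k; rewrite /adj adjacent_sym andbCA. Qed.

Lemma adj_irr j : adj j j = false.
Proof. by rewrite /adj adjacent_irr !andbF. Qed.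

Lemma adj_near j k : adj j k -> k < j + 5.
Proof.
case/and3P => jn kn; rewrite adjacent_sym => /story_edges.
by rewrite omega5 -/(ix _) -/(ix _) !ix_vtx.
Qed.

Definition degree_in j a b := count (adj j) (iota a (b - a)).

Lemma degree_split j a b c : a <= b <= c ->
  degree_in j a c = degree_in j a b + degree_in j b c.
Proof.
move=> /andP[ab bc]; rewrite /degree_in -count_cat.
suff -> : iota a (c - a) = iota a (b - a) ++ iota b (c - b) by [].
have {1}-> : c - a = (b - a) + (c - b) by lia.
by rewrite iotaD; congr (_ ++ iota _ _); lia.
Qed.

Lemma degree3 j : j < n -> degree_in j 0 n = 3.
Proof.
move=> jn; rewrite -(Gc (vtx j)) /degree_in subn0.
have -> : neighbours G [set: V]%SET (vtx j) =
    [set v in map vtx [seq k <- iota 0 n | adj j k]].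
  apply/setP => v; rewrite !inE; apply/idP/mapP => [jv|[k]].
    exists (ix v); last by rewrite vtx_ix.
    by rewrite mem_filter mem_iota add0n /= ix_lt andbT /adj jn ix_lt vtx_ix.
  by rewrite mem_filter => /andP[/and3P[_ _ ?] _] ->.
rewrite cardsE (card_uniqP _) ?size_map ?size_filter //.
rewrite map_inj_in_uniq ?filter_uniq ?iota_uniq // => k l.
rewrite !mem_filter !mem_iota => /andP[_ kn] /andP[_ ln].
by move/(congr1 ix); rewrite !ix_vtx.
Qed.

(** Applied to the newest vertex of a window, which has no neighbour before it; [degree_far_right]
    is applied to the oldest, which has none after it. *)
Lemma degree_far_left j b : b + 4 <= j -> degree_in j 0 b = 0.
Proof.
move=> h; apply/eqP; rewrite -leqn0 leqNgt -has_count; apply/hasPn => k.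
rewrite mem_iota add0n subn0 /= => kb; apply/negP; rewrite adj_sym.
by move/adj_near; lia.
Qed.

Lemma degree_far_right j a : j + 5 <= a -> degree_in j a n = 0.
Proof.
move=> h; apply/eqP; rewrite -leqn0 leqNgt -has_count; apply/hasPn => k.
by rewrite mem_iota => /andP[ak _]; apply/negP => /adj_near; lia.
Qed.

(* Otherwise these ends would be a cut set of at most two vertices. *)
Lemma cut_left m : 3 <= m < n ->
  3 <= count (fun j => 0 < degree_in j m n) (iota 0 m).
Proof.
move=> /andP[m3 mn]; pose A := [set v | ix v < m].
have vA j : j < m -> vtx j \in A.
  by move=> jm; rewrite inE ix_vtx //; exact: ltn_trans mn.
have cA : #|A| = m.
  have -> : A = [set v in map vtx (iota 0 m)].
    apply/setP => v; rewrite !inE; apply/idP/mapP => [vm|[j]].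
      by exists (ix v); rewrite ?vtx_ix // mem_iota.
    by rewrite mem_iota => jm ->; rewrite ix_vtx //; exact: ltn_trans mn.
  rewrite cardsE (card_uniqP _) ?size_map ?size_iota //.
  rewrite map_inj_in_uniq ?iota_uniq // => j k; rewrite !mem_iota => jm km.
  by move/(congr1 ix); rewrite !ix_vtx //; exact: ltn_trans mn.
have bA : vtx m \notin A by rewrite inE ix_vtx // ltnn.
apply: leq_trans (three_endpoints G3 _ bA) _; first by rewrite cA.
rewrite -size_filter -(size_map vtx); apply: leq_trans (card_size _).
apply: subset_leq_card; apply/fintype.subsetP => v; rewrite inE => /andP[].
rewrite inE => vm /existsP[u]; rewrite inE -leqNgt => /andP[mu vu].
apply/mapP; exists (ix v); last by rewrite vtx_ix.
rewrite mem_filter mem_iota /= add0n vm andbT /degree_in -has_count.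
apply/hasP; exists (ix u).
  by rewrite mem_iota mu subnKC ?ix_lt // ltnW.
by rewrite /adj !ix_lt !vtx_ix.
Qed.

Lemma cut_right m : 1 <= m -> m + 3 <= n ->
  3 <= count (fun j => 0 < degree_in j 0 m) (iota m (n - m)).
Proof.
move=> m1 mn; pose A := [set v | m <= ix v].
have cA : 3 <= #|A|.
  apply: (@leq_trans #|[set v in map vtx (iota m 3)]|).
    rewrite cardsE (card_uniqP _) ?size_map ?size_iota //.
    rewrite map_inj_in_uniq ?iota_uniq // => j k; rewrite !mem_iota => jm km.
    by move/(congr1 ix); rewrite !ix_vtx //; lia.
  apply: subset_leq_card; apply/fintype.subsetP => v.
  rewrite inE => /mapP[j]; rewrite mem_iota => jm ->.
  by rewrite inE ix_vtx; lia.
have bA : vtx 0 \notin A by rewrite inE ix_vtx; lia.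
apply: leq_trans (three_endpoints G3 cA bA) _.
rewrite -size_filter -(size_map vtx); apply: leq_trans (card_size _).
apply: subset_leq_card; apply/fintype.subsetP => v; rewrite inE => /andP[].
rewrite inE => mv /existsP[u]; rewrite inE -ltnNge => /andP[um vu].
apply/mapP; exists (ix v); last by rewrite vtx_ix.
rewrite mem_filter mem_iota mv /=; apply/andP; split; last first.
  by rewrite subnKC ?ix_lt //; lia.
rewrite /degree_in -has_count; apply/hasP; exists (ix u); first by rewrite mem_iota subn0.
by rewrite /adj !ix_lt !vtx_ix.
Qed.

Lemma sumn_positive (f : nat -> nat) s :
  count (fun j => 0 < f j) s <= sumn (map f s).
Proof. by elim: s => //= j s IH; apply: leq_add => //; case: (f j). Qed.

Definition window_bits w := [seq adj (w + p.1) (w + p.2) | p <- pairs5].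

Lemma window_graph w s t : s < 5 -> t < 5 ->
  graph_of (window_bits w) s t = adj (w + s) (w + t).
Proof.
by case: s => [|[|[|[|[|//]]]]] _; case: t => [|[|[|[|[|//]]]]] _;
  rewrite /graph_of /matrix_graph /= ?adj_irr // adj_sym.
Qed.

Section Window.
Variable w : nat.
Hypothesis w5 : w + 5 <= n.
Let M := adjacency_matrix (window_bits w).

Lemma slot_degreeE s : s < 5 -> slot_degree M s = degree_in (w + s) w (w + 5).
Proof.
move=> s5; rewrite /slot_degree /degree_in addKn.
have -> : iota w 5 = map (addn w) (iota 0 5) by rewrite -iotaDl addn0.
rewrite count_map; apply: eq_in_count => t; rewrite mem_iota => /= t5.
exact: window_graph.
Qed.

Lemma degree_sum s : s < 5 ->
  degree_in (w + s) 0 w + slot_degree M s + degree_in (w + s) (w + 5) n = 3.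
Proof.
move=> s5; have d : degree_in (w + s) 0 n = 3 by apply: degree3; lia.
have h1 : 0 <= w <= n by lia.
have h2 : w <= w + 5 <= n by lia.
rewrite slot_degreeE //; move: d.
by rewrite (degree_split _ h1) (degree_split _ h2) addnA.
Qed.

Lemma slot_degree_le3 : all (fun s => slot_degree M s <= 3) (iota 0 5).
Proof.
by apply/allP => s; rewrite mem_iota => /= s5; have := degree_sum s5; lia.
Qed.

Let L := sumn [seq degree_in (w + s) 0 w | s <- iota 0 5].
Let Rt := sumn [seq degree_in (w + s) (w + 5) n | s <- iota 0 5].

(** Five vertices of degree three; [L] and [Rt] count the edges leaving the window on either
    side. *)
Lemma edges_sum : L + slot_edges M + Rt = 15.
Proof.
have := degree_sum (isT : 0 < 5); have := degree_sum (isT : 1 < 5).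
have := degree_sum (isT : 2 < 5); have := degree_sum (isT : 3 < 5).
have := degree_sum (isT : 4 < 5); rewrite /L /Rt /slot_edges /=; lia.
Qed.

Lemma count_window (f : nat -> nat) :
  count (fun j => 0 < f j) (iota w 5) = count (fun s => 0 < f (w + s)) (iota 0 5).
Proof.
have -> : iota w 5 = map (addn w) (iota 0 5) by rewrite -iotaDl addn0.
by rewrite count_map.
Qed.

Lemma right_ends : w + 5 < n ->
  3 <= count (fun s => 0 < degree_in (w + s) (w + 5) n) (iota 0 5).
Proof.
move=> wn; have := @cut_left (w + 5); rewrite wn andbT => /(_ _)/leq_trans.
apply; first lia; rewrite iotaD count_cat add0n -(count_window (fun j => degree_in j (w + 5) n)).
rewrite -[X in _ <= X]add0n leq_add2r leqNgt -has_count; apply/hasPn => j.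
by rewrite mem_iota => /= jw; rewrite degree_far_right //; lia.
Qed.

Lemma left_ends : 0 < w ->
  3 <= count (fun s => 0 < degree_in (w + s) 0 w) (iota 0 5).
Proof.
move=> w0; have := cut_right w0 => /(_ _)/leq_trans; apply; first lia.
have -> : n - w = 5 + (n - w - 5) by lia.
rewrite iotaD count_cat -(count_window (fun j => degree_in j 0 w)).
rewrite -[X in _ <= X]addn0 leq_add2l leqNgt -has_count; apply/hasPn => j.
by rewrite mem_iota => jw; rewrite degree_far_left //; lia.
Qed.

Lemma slot_edges_window_even : ~~ odd (slot_edges M).
Proof. exact: slot_edges_even. Qed.

Lemma middle_windowP : 0 < w -> w + 5 < n -> middle_window M.
Proof.
move=> w0 wn; rewrite /middle_window slot_degree_le3 /=.
have := leq_trans (left_ends w0) (sumn_positive (fun s => degree_in (w + s) 0 w) _).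
have := leq_trans (right_ends wn) (sumn_positive (fun s => degree_in (w + s) (w + 5) n) _).
(* At least three edges on each side leave at most 9, and parity lowers this to 8. *)
have := edges_sum; have := slot_edges_window_even; rewrite -/L -/Rt; lia.
Qed.

Lemma first_windowP : w = 0 -> 5 < n -> end_window 0 M.
Proof.
move=> w0 n5; rewrite /end_window slot_degree_le3 andTb.
have wn : w + 5 < n by rewrite w0.
have r := right_ends wn.
have := leq_trans r (sumn_positive (fun s => degree_in (w + s) (w + 5) n) _).
rewrite -/Rt => Rt3; apply/and3P; split; first by have := edges_sum; lia.
  have e : degree_in (w + 0) 0 w = 0 by rewrite w0.
  have f : degree_in (w + 0) (w + 5) n = 0 by apply: degree_far_right; lia.
  by have := degree_sum (isT : 0 < 5); rewrite e f; lia.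
apply: leq_trans r _; apply: leq_count_in => s; rewrite mem_iota => /= s5.
have := degree_sum s5; case: s s5 => [|s] s5 h h'.
  by move: h'; rewrite degree_far_right // addn0.
by rewrite /=; lia.
Qed.

Lemma last_windowP : w + 5 = n -> 0 < w -> end_window 4 M.
Proof.
move=> wn w0; rewrite /end_window slot_degree_le3 andTb.
have r := left_ends w0.
have := leq_trans r (sumn_positive (fun s => degree_in (w + s) 0 w) _).
rewrite -/L => L3; apply/and3P; split; first by have := edges_sum; lia.
  have e : degree_in (w + 4) 0 w = 0 by apply: degree_far_left; lia.
  have f : degree_in (w + 4) (w + 5) n = 0 by rewrite wn /degree_in subnn.
  by have := degree_sum (isT : 4 < 5); rewrite e f; lia.
apply: leq_trans r _; apply: leq_count_in => s; rewrite mem_iota => /= s5 h.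
have := degree_sum s5; have [s4|s4] := eqVneq s 4.
  by move: h; rewrite s4 degree_far_left.
by rewrite /=; lia.
Qed.
End Window.

(** A cubic graph on five vertices would have the odd degree sum 15. Hence no window is both the
    first and the last one. *)
Lemma n_gt5 : 5 < n.
Proof.
rewrite ltn_neqAle n_ge5 andbT; apply/eqP => n5.
have := @edges_sum 0; rewrite add0n -n5 leqnn => /(_ isT).
have := slot_edges_window_even 0.
have z s : degree_in (0 + s) 0 0 = 0 by [].
have z' s : degree_in (0 + s) 5 5 = 0 by rewrite /degree_in subnn.
rewrite /= !z !z' !addn0 !add0n => + e; by rewrite e.
Qed.

End Story.

Lemma canonical_placement_ok H : let C := canonical_placement H in
  [/\ size C = 5, uniq C & all (fun k => k < 5) C].
Proof.
rewrite /canonical_placement /graph4_code.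
by case: (H 0 1); case: (H 0 2); case: (H 0 3); case: (H 1 2); case: (H 1 3);
  case: (H 2 3).
Qed.

Lemma canonical_placement_eq H H' :
  (forall s t, s < 4 -> t < 4 -> H s t = H' s t) ->
  canonical_placement H = canonical_placement H'.
Proof. by move=> h; rewrite /canonical_placement /graph4_code !h. Qed.

Lemma place_suits first b : size b = 10 -> let M := adjacency_matrix b in
  (if first then end_window 0 M else middle_window M || end_window 4 M) ->
  [/\ suits first false M (place first b),
      ~~ first -> middle_window M -> suits first true M (place first b)
    & size (place first b) = 5].
Proof.
move=> b10 M hM; have := allP windows_checked b; rewrite mem_bit_lists b10.
move=> /(_ isT)/and3P[]; rewrite -/M => mid fst lst.
have found f m : suited f m M ->
    suits f m M (first_placement f m M) /\ size (first_placement f m M) = 5.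
  rewrite /suited -has_find => h; split; first exact: nth_find.
  rewrite has_find in h; have /allP : all (fun P => size P == 5) placements by [].
  by move=> /(_ _ (mem_nth [::] h))/eqP.
have weaken P : suits false true M P -> suits false false M P.
  by rewrite /suits; case: ifP => // _; case: ifP.
case: first hM => hM; rewrite /place -/M.
  by move: fst; rewrite hM => /found[].
have [h|h] := boolP (suited false true M); move: (h); rewrite /suited => e.
  by rewrite e; have [h1 h2] := found _ _ h; split=> //; exact: weaken.
rewrite (negbTE e); have nmid : ~~ middle_window M.
  by apply/negP => hm; move: mid h; rewrite hm => ->.
move: hM lst; rewrite (negbTE nmid) /= => -> /found[h1 h2].
by split=> //; rewrite (negbTE nmid).
Qed.

Lemma canonicalP H P g : canonical H P g ->
  [/\ placement_ok P 4 H, placement_ok (take 4 (canonical_placement H)) 4 H &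
      same_embedding 4 H P (take 4 (canonical_placement H)) g
        (nth 0 (canonical_placement H) 4)].
Proof. by rewrite /canonical; case: ifP => // /andP[]. Qed.

Lemma suits_oldest first M P : suits first true M P ->
  canonical_without_oldest M P.
Proof. by rewrite /suits; case: ifP => // _; case: first => //; case: ifP. Qed.

Lemma suits_first middle M P : suits true middle M P ->
  canonical_without_oldest M P.
Proof. by rewrite /suits; case: ifP. Qed.

Lemma suits_newest middle M P : suits false middle M P ->
  canonical_without_newest M P.
Proof. by rewrite /suits; case: ifP => // _; case: ifP. Qed.

Lemma left_out (P : seq nat) : size P = 5 -> uniq P -> all (fun k => k < 5) P ->
  [/\ head 0 P < 5, nth 0 P 4 < 5,
      head 0 P \notin [seq nth 0 (behead P) s | s <- iota 0 4] &
      nth 0 P 4 \notin [seq nth 0 (take 4 P) s | s <- iota 0 4]].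
Proof.
case: P => [|a [|b [|c [|d [|e [|]]]]]] //= _ /and5P[h1 h2 h3 h4 _].
case/and5P=> a5 b5 c5 d5 /andP[e5 _]; split=> //.
by move: h1 h2 h3 h4; rewrite !inE; clear; lia.
Qed.

(** * The sequence of compatible embeddings *)

Section Sequence.
Variables (R : realType) (V : finType) (S : graph_story V) (v0 : V).
Let G := story_graph S.
Let n := #|V|.
Let ix v := index v (story_order S).
Hypothesis G3 : triconnected G.
Hypothesis Gc : cubic G.
Hypothesis omega5 : omega S = 5.
Let vtx := vtx S v0.

Definition window_place i := place (i == 5) (window_bits S v0 (i - 5)).
Definition window_name i s := vtx (i - 5 + s).
Definition window_position i v := nth 0 (window_place i) (ix v - (i - 5)).
Definition window_drawing i : drawing R V := wheel_drawing R (window_position i).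
Definition window_code i :=
  slot_code (window_name i) (window_place i) (graph_of (window_bits S v0 (i - 5))).
Definition window_embedding i : set (drawing R V) :=
  [set D | planar_drawing G (window S i) D /\
           equivalent G (window S i) (window_drawing i) D].

Let bits i := window_bits S v0 (i - 5).

Lemma window_suits i : 5 <= i <= n ->
  [/\ suits (i == 5) false (adjacency_matrix (bits i)) (window_place i),
      5 < i < n -> suits (i == 5) true (adjacency_matrix (bits i)) (window_place i)
    & size (window_place i) = 5].
Proof.
move=> /andP[i5 iN]; have nw : i - 5 + 5 <= #|V| by rewrite subnK.
have n5 := n_gt5 v0 Gc omega5.
have mid : 5 < i < n -> middle_window (adjacency_matrix (bits i)).
  by move=> ?; apply: middle_windowP => //; [lia | rewrite subnK //; lia].
have b10 : size (bits i) = 10 by [].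
have [] := @place_suits (i == 5) (bits i) b10.
  case: (eqVneq i 5) => [e|i5'].
    by apply: first_windowP; rewrite // ?e //.
  apply/orP; case: (ltnP i n) => h; first by left; apply: mid; lia.
  right; apply: last_windowP => //; [rewrite subnK //; lia | lia].
move=> h1 h2 h3; split=> // h; apply: h2; last exact: mid.
by rewrite gtn_eqF //; case/andP: h.
Qed.

Lemma window_placement_ok i : 5 <= i <= n ->
  placement_ok (window_place i) 5 (graph_of (bits i)).
Proof. by case/window_suits; rewrite /suits; case: ifP. Qed.

Lemma in_window i v : i <= n ->
  (v \in window S i) = (i - 5 <= ix v < i).
Proof. by move=> iN; rewrite inE omega5. Qed.

Lemma window_slots i : 5 <= i <= n ->
  slots_of G (window S i) (window_name i) (fun v => ix v - (i - 5)) 5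
    (graph_of (bits i)).
Proof.
move=> /andP[i5 iN]; split.
- move=> v; rewrite in_window // => /andP[h1 h2]; split; first lia.
  by rewrite /window_name subnKC // /vtx vtx_ix.
- move=> s s5; have sn : i - 5 + s < #|V| by lia.
  rewrite in_window // /window_name /ix ix_vtx //; split; lia.
- move=> s t s5 t5; rewrite window_graph // /adj.
  by have [-> ->] : i - 5 + s < #|V| /\ i - 5 + t < #|V| by lia.
- exact: graph_of_sym.
Qed.

Lemma window_planar i : 5 <= i <= n ->
  planar_drawing G (window S i) (window_drawing i).
Proof.
by move=> h; apply: (slot_planar (window_slots h) (window_placement_ok h)).
Qed.

Lemma window_embeddingP i : 5 <= i <= n ->
  planar_embedding G (window S i) (window_embedding i).
Proof. by move=> h; exists (window_drawing i) => //; exact: window_planar. Qed.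

Lemma window_drawing_in i : 5 <= i <= n -> window_embedding i (window_drawing i).
Proof. by move=> h; split; [exact: window_planar | exact: equivalent_refl]. Qed.

Lemma window_describes i : 5 <= i <= n ->
  describes G (window S i) (window_code i) (window_drawing i).
Proof.
move=> h; have [_ _ s5] := window_suits h.
by apply: (slot_code_describes R (window_slots h) (window_placement_ok h)).
Qed.

(** Both drawings, restricted to the shared vertices, are equivalent to the wheel drawing by the
    canonical placement [C], and both removed vertices lie in the face of its free position.
    Compatibility follows by transitivity through [C]. *)
Lemma windows_compatible i : 5 < i <= n ->
  compatible S i (window_embedding i.-1) (window_embedding i).
Proof.
case: i => // i /andP[i5 iN]; rewrite ltnS in i5; rewrite succnK.
have hi : 5 <= i <= n by lia.
have hi1 : 5 <= i.+1 <= n by lia.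
pose W := (window S i :&: window S i.+1)%SET.
pose w := i.+1 - 5; have wE : w = i - 5 + 1 by rewrite /w; lia.
have inW v : (v \in W) = (w <= ix v < i).
  by rewrite finset.in_setI !in_window //; lia.
pose nm s := vtx (w + s).
have slots H : symmetric H ->
    (forall s t, s < 4 -> t < 4 -> H s t = adj S v0 (w + s) (w + t)) ->
    slots_of G W nm (fun v => ix v - w) 4 H.
  move=> Hs HE; split=> //.
  - move=> v; rewrite inW => /andP[h1 h2]; split; first lia.
    by rewrite /nm subnKC // /vtx vtx_ix.
  - move=> s s4; have sn : w + s < #|V| by lia.
    rewrite inW /nm /ix ix_vtx //; split; lia.
  - move=> s t s4 t4; rewrite HE // /adj.
    by have [-> ->] : w + s < #|V| /\ w + t < #|V| by lia.
pose H1 := shifted (graph_of (bits i)); pose H2 := graph_of (bits i.+1).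
have H1E s t : s < 4 -> t < 4 -> H1 s t = adj S v0 (w + s) (w + t).
  by move=> s4 t4; rewrite /H1 /shifted window_graph ?wE -?addnA ?add1n.
have H2E s t : s < 4 -> t < 4 -> H2 s t = adj S v0 (w + s) (w + t).
  by move=> s4 t4; rewrite /H2 window_graph //; lia.
have sl1 : slots_of G W nm (fun v => ix v - w) 4 H1.
  by apply: slots => // s t; rewrite /H1 /shifted graph_of_sym.
have sl2 : slots_of G W nm (fun v => ix v - w) 4 H2.
  by apply: slots => // s t; rewrite /H2 graph_of_sym.
have CE : canonical_placement H1 = canonical_placement H2.
  by apply: canonical_placement_eq => s t s4 t4; rewrite H1E // H2E.
have [C5 uC lC] := canonical_placement_ok H2; set C := canonical_placement H2 in CE C5 uC lC.
have P1 := window_suits hi; have P2 := window_suits hi1.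
have old : canonical_without_oldest (adjacency_matrix (bits i)) (window_place i).
  case: P1 => h1 h2 _; case: (eqVneq i 5) h1 h2 => [_|i6] h1 h2.
    exact: suits_first h1.
  have /h2 h3 : 5 < i < n by lia.
  exact: suits_oldest h3.
have new : canonical_without_newest (adjacency_matrix (bits i.+1)) (window_place i.+1).
  case: P2 => + _ _; have -> : (i.+1 == 5) = false by lia.
  exact: suits_newest.
have [ok1 okC1 same1] := canonicalP old.
have [ok2 okC2 same2] := canonicalP new.
rewrite -/H1 CE in okC1 same1.
pose pc v := nth 0 (take 4 C) (ix v - w).
have s1 : size (window_place i) = 5 by case: P1.
have s2 : size (window_place i.+1) = 5 by case: P2.
have [u1 l1] : uniq (window_place i) /\ all (fun k => k < 5) (window_place i).
  by case/and4P: (window_placement_ok hi).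
have [u2 l2] : uniq (window_place i.+1) /\ all (fun k => k < 5) (window_place i.+1).
  by case/and4P: (window_placement_ok hi1).
have piE1 v : v \in W -> window_position i v = nth 0 (behead (window_place i)) (ix v - w).
  rewrite inW => /andP[h1 h2]; rewrite nth_behead /window_position.
  by congr nth; clear -wE h1; lia.
have piE2 v : v \in W ->
    window_position i.+1 v = nth 0 (take 4 (window_place i.+1)) (ix v - w).
  by rewrite inW => /andP[h1 h2]; rewrite nth_take //; clear -wE h1 h2 i5; lia.
have pcE v : v \in W -> pc v = nth 0 (take 4 C) (ix v - w) by [].
have [g1 _ n1 _] := left_out s1 u1 l1; have [_ g2 _ n2] := left_out s2 u2 l2.
have [_ gc _ nc] := left_out C5 uC lC.
have [e1 b1] := same_embedding_equivalent sl1 R ok1 okC1 piE1 pcE g1 gc n1 nc same1.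
have [e2 b2] := same_embedding_equivalent sl2 R ok2 okC2 piE2 pcE g2 gc n2 nc same2.
have y_lt : i < #|V| by exact: iN.
have x_lt : i - 5 < #|V| by apply: leq_ltn_trans y_lt; rewrite leq_subr.
exists (vtx (i - 5)), (vtx i), (window_drawing i), (window_drawing i.+1); split.
- by rewrite -/(ix _) /vtx /ix ix_vtx // omega5; clear -i5; lia.
- by rewrite -/(ix _) /vtx /ix ix_vtx.
- by split; exact: window_drawing_in.
- exact: equivalent_trans e1 (equivalent_sym e2).
- have p1 : window_position i (vtx (i - 5)) = head 0 (window_place i).
    by rewrite /window_position /ix /vtx ix_vtx // subnn nth0.
  have p2 : window_position i.+1 (vtx i) = nth 0 (window_place i.+1) 4.
    by rewrite /window_position /ix /vtx ix_vtx //; congr nth; clear -i5; lia.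
  have d1 : pos (window_drawing i) (vtx (i - 5)) = ptT R (head 0 (window_place i)).
    by rewrite -p1.
  have d2 : pos (window_drawing i.+1) (vtx i) = ptT R (nth 0 (window_place i.+1) 4).
    by rewrite -p2.
  have same p q : p = ptT R (head 0 (window_place i)) ->
      q = ptT R (nth 0 (window_place i.+1) 4) ->
      boundary G W (window_drawing i) (face_at G W (window_drawing i) p) =
      boundary G W (window_drawing i.+1) (face_at G W (window_drawing i.+1) q).
    by move=> -> ->; exact: etrans b1 (esym b2).
  exact: same d1 d2.
Qed.

End Sequence.

(** * The program *)

(** Meant for programs without loops: a loop is charged for its final test only, and the main loop
    is timed separately in [whileE]. *)
Fixpoint max_time (p : cmd) : nat :=
  match p with
  | Skip => 1
  | Store a e => (cost a + cost e).+1
  | Emit e => (cost e).+1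
  | Seq p q => max_time p + max_time q
  | IfLt a b p q => (cost a + cost b + maxn (max_time p) (max_time q)).+1
  | WhileLt a b p => (cost a + cost b).+1
  end.

Definition runs W p m out m' out' :=
  exists2 t, t <= max_time p & exec W p m out t m' out'.

Section Runs.
Variable W : nat.
Implicit Types (p q : cmd) (m : memory) (out : seq nat) (a b e : expr).

Lemma runs_skip m out : runs W Skip m out m out.
Proof. by exists 1 => //; constructor. Qed.

Lemma runs_store a e m out : fits W m a -> fits W m e ->
  runs W (Store a e) m out (update m (Defs.eval m a) (Defs.eval m e)) out.
Proof. by move=> ha he; exists (cost a + cost e).+1 => //; constructor. Qed.

Lemma runs_emit e m out : fits W m e ->
  runs W (Emit e) m out m (rcons out (Defs.eval m e)).
Proof. by move=> he; exists (cost e).+1 => //; constructor. Qed.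

Lemma runs_seq p q m out m1 out1 m2 out2 : runs W p m out m1 out1 ->
  runs W q m1 out1 m2 out2 -> runs W (Seq p q) m out m2 out2.
Proof.
move=> [t ht et] [t' ht' et']; exists (t + t'); first exact: leq_add.
exact: ExecSeq et et'.
Qed.

Lemma runs_if a b p q m out m1 out1 : fits W m a -> fits W m b ->
  runs W (if Defs.eval m a < Defs.eval m b then p else q) m out m1 out1 ->
  runs W (IfLt a b p q) m out m1 out1.
Proof.
move=> ha hb [t ht et]; exists (cost a + cost b + t).+1; last exact: ExecIf et.
by move: ht => /=; case: ifP => _ ht; rewrite ltnS leq_add2l leq_max ht ?orbT.
Qed.
End Runs.

Fixpoint seqs (ps : seq cmd) : cmd :=
  if ps is p :: ps' then Seq p (seqs ps') else Skip.

(* The input occupies the addresses up to [5 * n], the registers lie behind it;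
   register 1 holds the start of the window. *)
Definition input_size := Fetch (Lit 0).
Definition register k :=
  Plus (Plus input_size (Plus input_size (Plus input_size
    (Plus input_size input_size)))) (Lit k).
Definition slot_expr s := Plus (Fetch (register 1)) (Lit s.+1).
Definition slot_vertex s := Fetch (slot_expr s).
(** Behind the size and the order, vertex [v] owns a block of four numbers, its degree 3 and its
    neighbours, so its [k]-th neighbour is at address [4 * v + n + k + 2]. The factor 4 is obtained
    by additions, the only way to multiply on this machine. *)
Definition neighbour_expr s k :=
  Fetch (Plus (Plus (Plus (slot_vertex s) (slot_vertex s))
                    (Plus (slot_vertex s) (slot_vertex s)))
    (Plus input_size (Lit k.+2))).

Definition if_eq a b p := IfLt a b Skip (IfLt b a Skip p).

(* Stores in register 2 whether the vertices in slots [s] and [t] are adjacent. *)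
Definition adjacency_flag s t :=
  Seq (Store (register 2) (Lit 0))
    (seqs [seq if_eq (neighbour_expr s k) (slot_vertex t)
                 (Store (register 2) (Lit 1)) | k <- iota 0 3]).

(* A number, or the vertex in a slot. *)
Definition token := (nat + nat)%type.

Definition emit_token (x : token) :=
  match x with inl k => Emit (Lit k) | inr s => Emit (slot_vertex s) end.

(* Tests all pairs of slots one after the other: the ten adjacencies determine the
   output of a window, so that the program is a decision tree with constant
   leaves. *)
Fixpoint decide (leaf : seq bool -> seq token) (ps : seq (nat * nat))
    (acc : seq bool) : cmd :=
  if ps is (s, t) :: ps' then
    Seq (adjacency_flag s t)
      (IfLt (Fetch (register 2)) (Lit 1)
        (decide leaf ps' (rcons acc false)) (decide leaf ps' (rcons acc true)))
  else seqs (map emit_token (leaf acc)).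

Section Tokens.
Variable (T : Type).
Definition put_tokens (put : T -> seq token) (s : seq T) : seq token :=
  inl (size s) :: flatten (map put s).
End Tokens.

Definition slot_token (s : nat) : seq token := [:: inr s].

Definition boundary_tokens (b : seq nat * seq (nat * nat)) : seq token :=
  put_tokens slot_token b.1 ++
  put_tokens (fun d => slot_token d.1 ++ slot_token d.2) b.2.

Definition code_tokens (P : seq nat) (H : nat -> nat -> bool) : seq token :=
  let L := labels P 5 H in
  put_tokens (fun sl => slot_token sl.1 ++ put_tokens slot_token sl.2)
    [seq (s, slot_rotation P 5 H s) | s <- iota 0 5] ++
  boundary_tokens (slot_boundary P 5 H L 0) ++
  put_tokens boundary_tokens [seq slot_boundary P 5 H L c | c <- inner_roots P 5 H].

Definition window_tokens first b := code_tokens (place first b) (graph_of b).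

Definition emit_window first := decide (window_tokens first) pairs5 [::].

Definition embed_story : cmd :=
  Seq (emit_window true) (Seq (Store (register 1) (Lit 1))
    (WhileLt (Plus (Fetch (register 1)) (Lit 4)) input_size
      (Seq (emit_window false)
        (Store (register 1) (Plus (Fetch (register 1)) (Lit 1)))))).

Section PutTokens.
Variables (n : nat) (nm : nat -> 'I_n).

Definition token_value (x : token) : nat :=
  match x with inl k => k | inr s => val (nm s) end.

Lemma put_tokens_seq (T U : Type) (f : T -> U) (put : U -> seq nat)
    (puts : T -> seq token) s :
  (forall x, map token_value (puts x) = put (f x)) ->
  map token_value (put_tokens puts s) = put_seq put (map f s).
Proof.
move=> h; rewrite /put_tokens /put_seq /= size_map map_flatten -!map_comp.
by congr (_ :: flatten _); apply: eq_map => x /=.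
Qed.

Lemma boundary_tokensE b :
  map token_value (boundary_tokens b) = put_boundary (name_boundary nm b).
Proof.
rewrite map_cat; congr (_ ++ _); last exact: put_tokens_seq.
exact: put_tokens_seq.
Qed.

Lemma code_tokensE P H :
  map token_value (code_tokens P H) = put_code (slot_code nm P H).
Proof.
rewrite /code_tokens /put_code map_cat; congr (_ ++ _).
  have -> : code_rotation (slot_code nm P H) =
      [seq (nm sl.1, map nm sl.2) | sl <- [seq (s, slot_rotation P 5 H s) | s <- iota 0 5]].
    by rewrite -map_comp.
  apply: put_tokens_seq => -[s l] /=; congr (_ :: _).
  exact: put_tokens_seq.
rewrite map_cat; congr (_ ++ _); first exact: boundary_tokensE.
have -> : code_internal (slot_code nm P H) = map (name_boundary nm)
    [seq slot_boundary P 5 H (labels P 5 H) c | c <- inner_roots P 5 H].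
  by rewrite -map_comp.
by apply: put_tokens_seq => b; exact: boundary_tokensE.
Qed.
End PutTokens.

Lemma nth_flatten_blocks (T : Type) (x0 : T) d (ss : seq (seq T)) i j :
  all (fun s => size s == d) ss -> i < size ss -> j < d ->
  nth x0 (flatten ss) (d * i + j) = nth x0 (nth [::] ss i) j.
Proof.
elim: ss i => //= s ss IH [|i] /andP[/eqP sd hs] lt_i jd; rewrite nth_cat sd.
  by rewrite muln0 add0n jd.
rewrite ltnNge mulnS -addnA leq_addr /= addKn; exact: IH.
Qed.

(** The constants written are lengths of lists, at most 25 since there are 25 ordered pairs of
    slots. *)
Definition token_ok (x : token) :=
  match x with inl k => k <= 25 | inr s => s < 5 end.

Lemma put_tokens_ok (T : Type) (puts : T -> seq token) s : size s <= 25 ->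
  all (fun x => all token_ok (puts x)) s -> all token_ok (put_tokens puts s).
Proof.
move=> s25 hs; rewrite /= s25 /=; elim: s hs {s25} => //= x s IH /andP[? ?].
by rewrite all_cat; apply/andP; split=> //; exact: IH.
Qed.

Lemma slots_ok s : size s <= 25 -> all (gtn 5) s ->
  all token_ok (put_tokens slot_token s).
Proof.
move=> s25 hs; apply: put_tokens_ok => //; apply: sub_all hs => x x5.
by rewrite /= andbT.
Qed.

Lemma window_tokens_ok first b : all token_ok (window_tokens first b).
Proof.
rewrite /window_tokens /code_tokens; set P := place _ _; set H := graph_of b.
have bd L c : all token_ok (boundary_tokens (slot_boundary P 5 H L c)).
  rewrite all_cat; apply/andP; split.
    apply: slots_ok; first by rewrite size_filter (leq_trans (count_size _ _)).
    by apply/allP => s; rewrite mem_filter mem_iota => /andP[_ /=].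
  apply: put_tokens_ok; first by rewrite size_filter (leq_trans (count_size _ _)).
  apply/allP => d; rewrite mem_filter => /andP[_ /allpairsP[[s t]]].
  by rewrite !mem_iota /= => -[s5 t5 ->] /=; rewrite s5 t5.
rewrite !all_cat; apply/and3P; split=> //.
- apply: put_tokens_ok => //; apply/allP => _ /mapP[s s5 ->]; rewrite mem_iota in s5.
  rewrite all_cat /= andbT; apply/andP; split=> //.
  have h : all (gtn 5) (slot_rotation P 5 H s).
    by apply/allP => t; rewrite mem_filter => /andP[/andP[]].
  apply: (@slots_ok (slot_rotation P 5 H s)) => //.
  rewrite size_filter (leq_trans (count_size _ _)) // size_map.
  by case: (nth 0 P s) => [|[|[|[|[|k]]]]].
- by have := bd (labels P 5 H) 0; rewrite /boundary_tokens all_cat.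
- apply: put_tokens_ok; last by apply/allP => _ /mapP[c _ ->].
  by rewrite size_map size_filter (leq_trans (count_size _ _)).
Qed.

(** * Correctness and running time of the program *)

Section Execution.
Variables (n : nat) (S : graph_story 'I_n) (nbrs : 'I_n -> seq 'I_n) (v0 : 'I_n).
Hypothesis Gc : cubic (story_graph S).
Hypothesis omega5 : omega S = 5.
Hypothesis nbrsP : adjacency_lists (story_graph S) nbrs.
Variable W : nat.
Hypothesis W_big : 5 * n + 25 <= W.
Let input := story_input S nbrs.
Let vtx := vtx S v0.

Lemma size_nbrs v : size (nbrs v) = 3.
Proof.
have [uv mv] := nbrsP v; rewrite -(Gc v) -(card_uniqP uv).
by apply: eq_card => u; rewrite mv !inE.
Qed.

Lemma size_order : size (story_order S) = n.
Proof. by rewrite size_ord card_ord. Qed.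

Lemma input_vertex j : j < n -> nth 0 input j.+1 = val (vtx j).
Proof.
move=> jn; rewrite /input /story_input /= nth_cat size_map size_order jn.
by rewrite (nth_map v0) // size_order.
Qed.

Lemma input_neighbour (v : 'I_n) k : k < 3 ->
  nth 0 input (v + v + (v + v) + (n + k.+2)) = val (nth v0 (nbrs v) k).
Proof.
move=> k3; have -> : v + v + (v + v) + (n + k.+2) = (n + (4 * v + k.+1)).+1 by lia.
rewrite /input /story_input /= nth_cat size_map size_order ltnNge leq_addr /= addKn.
rewrite nth_flatten_blocks ?size_map ?size_enum_ord //.
  rewrite (nth_map v) ?size_enum_ord // nth_ord_enum /=.
  have -> : flatten (map (@put_vertex n) (nbrs v)) = map val (nbrs v).
    by elim: (nbrs v) => //= a s ->.
  by rewrite (nth_map v0) // size_nbrs.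
apply/allP => _ /mapP[u _ ->]; rewrite /= size_flatten /shape -map_comp.
by rewrite -[X in _ == X.+1](size_nbrs u) eqSS; elim: (nbrs u) => //= a s /eqP ->.
by rewrite -enumT size_enum_ord.
Qed.

Definition reg k := n + (n + (n + (n + n))) + k.

(* The input is intact, register 1 holds [w]. *)
Definition holds m w :=
  (forall a, a <= 5 * n -> m a = nth 0 input a) /\ m (reg 1) = w.

Lemma holds_size m w : holds m w -> m 0 = n.
Proof. by case=> h _; rewrite h. Qed.

Lemma fits_register m w k : holds m w -> k <= 2 ->
  fits W m (register k) /\ Defs.eval m (register k) = reg k.
Proof.
move=> hm k2; rewrite /= !(holds_size hm) /reg; split=> //.
by rewrite ?leq0n /=; do ?[apply/andP; split]; lia.
Qed.

Lemma slot_vertexE m w s : holds m w -> w + s < n ->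
  fits W m (slot_vertex s) /\ Defs.eval m (slot_vertex s) = val (vtx (w + s)).
Proof.
move=> hm ws; have [f1 e1] := @fits_register m w 1 hm isT.
have e : Defs.eval m (slot_expr s) = (w + s).+1.
  by rewrite -[LHS]/(m (Defs.eval m (register 1)) + s.+1) e1 hm.2 addnS.
have ev : m (w + s).+1 = val (vtx (w + s)).
  by rewrite hm.1 ?input_vertex //; lia.
have fe : fits W m (slot_expr s).
  rewrite -[fits W m _]/((Defs.eval m (slot_expr s) <= W) &&
    (((m (Defs.eval m (register 1)) <= W) && fits W m (register 1)) &&
     ((s.+1 <= W) && true))) e e1 hm.2 f1 !andbT.
  by apply/and3P; split; lia.
split; last by rewrite -ev -e.
rewrite -[fits W m _]/((m (Defs.eval m (slot_expr s)) <= W) && fits W m (slot_expr s)).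
rewrite fe andbT e ev; have := ltn_ord (vtx (w + s)); rewrite /=; lia.
Qed.

Lemma neighbour_exprE m w s k : holds m w -> w + s < n -> k < 3 ->
  fits W m (neighbour_expr s k) /\
  Defs.eval m (neighbour_expr s k) = val (nth v0 (nbrs (vtx (w + s))) k).
Proof.
move=> hm ws k3; have [fv ev] := slot_vertexE hm ws.
have m0 := holds_size hm; have vn := ltn_ord (vtx (w + s)).
pose A := Plus (Plus (Plus (slot_vertex s) (slot_vertex s))
  (Plus (slot_vertex s) (slot_vertex s))) (Plus input_size (Lit k.+2)).
have eA : Defs.eval m A = vtx (w + s) + vtx (w + s) +
    (vtx (w + s) + vtx (w + s)) + (n + k.+2).
  rewrite -[Defs.eval m A]/(Defs.eval m (slot_vertex s) + Defs.eval m (slot_vertex s) +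
    (Defs.eval m (slot_vertex s) + Defs.eval m (slot_vertex s)) + (m 0 + k.+2)).
  by rewrite ev m0.
have emA : m (Defs.eval m A) = val (nth v0 (nbrs (vtx (w + s))) k).
  by rewrite eA -input_neighbour // hm.1 //; lia.
have fA : fits W m A.
  rewrite -[fits W m A]/((Defs.eval m A <= W) &&
    (((Defs.eval m (slot_vertex s) + Defs.eval m (slot_vertex s) +
      (Defs.eval m (slot_vertex s) + Defs.eval m (slot_vertex s)) <= W) &&
     (((Defs.eval m (slot_vertex s) + Defs.eval m (slot_vertex s) <= W) &&
       (fits W m (slot_vertex s) && fits W m (slot_vertex s))) &&
      ((Defs.eval m (slot_vertex s) + Defs.eval m (slot_vertex s) <= W) &&
       (fits W m (slot_vertex s) && fits W m (slot_vertex s))))) &&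
     ((m 0 + k.+2 <= W) && (((m 0 <= W) && ((0 <= W) && true)) && ((k.+2 <= W) && true))))).
  by rewrite eA fv ev m0 /= !andbT; do ?[apply/andP; split]; lia.
split; last exact: emA.
rewrite -[fits W m _]/((m (Defs.eval m A) <= W) && fits W m A) fA andbT emA.
by have := ltn_ord (nth v0 (nbrs (vtx (w + s))) k); rewrite /=; lia.
Qed.

Lemma holds_update m w x : holds m w -> holds (update m (reg 2) x) w.
Proof.
move=> [h1 h2]; split=> [a an|]; rewrite /update.
  by rewrite ltn_eqF ?h1 // /reg; lia.
by rewrite h2 ltn_eqF // /reg; lia.
Qed.

Lemma set_flag m w out x : holds m w -> x <= 1 ->
  exists m', [/\ runs W (Store (register 2) (Lit x)) m out m' out,
    holds m' w & m' (reg 2) = x].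
Proof.
move=> hm x1; have [f2 e2] := @fits_register m w 2 hm isT.
exists (update m (reg 2) x); split; [|exact: holds_update|].
  rewrite -e2; apply: (@runs_store W (register 2) (Lit x)) => //.
  by rewrite /= andbT; lia.
by rewrite /update eqxx.
Qed.

Lemma adjacency_flagE m w s t out : holds m w -> w + s < n -> w + t < n ->
  exists m', [/\ runs W (adjacency_flag s t) m out m' out, holds m' w &
    m' (reg 2) = story_graph S (vtx (w + s)) (vtx (w + t))].
Proof.
move=> hm ws wt; have [m1 [r1 h1 e1]] := set_flag out hm (isT : 0 <= 1).
pose v := vtx (w + s); pose u := vtx (w + t).
have loop ks m2 (b : bool) : all (gtn 3) ks -> holds m2 w -> m2 (reg 2) = b ->
    exists m', [/\ runs W (seqs [seq if_eq (neighbour_expr s k) (slot_vertex t)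
      (Store (register 2) (Lit 1)) | k <- ks]) m2 out m' out, holds m' w &
      m' (reg 2) = b || has (fun k => nth v0 (nbrs v) k == u) ks].
  elim: ks m2 b => [|k ks IH] m2 b /=.
    by move=> _ h2 e2; exists m2; split=> //; [exact: runs_skip | rewrite orbF].
  move=> /andP[k3 hks] h2 e2.
  have [fa ea] := neighbour_exprE h2 ws k3; have [fb eb] := slot_vertexE h2 wt.
  have [m3 [r3 h3 e3]] : exists m3,
      [/\ runs W (if_eq (neighbour_expr s k) (slot_vertex t)
            (Store (register 2) (Lit 1))) m2 out m3 out, holds m3 w &
          m3 (reg 2) = b || (nth v0 (nbrs v) k == u)].
    case: (ltngtP (val (nth v0 (nbrs v) k)) (val u)) => h.
    - exists m2; split=> //.
        by apply: runs_if => //; rewrite ea eb h; exact: runs_skip.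
      by rewrite e2 -val_eqE ltn_eqF ?orbF.
    - exists m2; split=> //.
        apply: runs_if => //; rewrite ea eb ltnNge (ltnW h).
        by apply: runs_if => //; rewrite ea eb h; exact: runs_skip.
      by rewrite e2 -val_eqE gtn_eqF ?orbF.
    - have [m3 [r3 h3 e3]] := set_flag out h2 (isT : 1 <= 1).
      exists m3; split=> //.
        apply: runs_if => //; rewrite ea eb h ltnn.
        by apply: runs_if => //; rewrite ea eb h ltnn.
      by rewrite e3 -val_eqE h eqxx orbT.
  have [m4 [r4 h4 e4]] := IH m3 _ hks h3 e3.
  exists m4; split=> //; first exact: runs_seq r3 r4.
  by rewrite e4 orbA.
have [m4 [r4 h4 e4]] := loop (iota 0 3) m1 false isT h1 e1.
exists m4; split=> //; first exact: runs_seq r1 r4.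
rewrite e4 orFb; congr nat_of_bool; have [_ mv] := nbrsP v.
have -> : story_graph S v u = (u \in nbrs v) by rewrite mv.
apply/hasP/idP => [[k]|/(nthP v0)[k ks <-]].
  by rewrite mem_iota => k3 /eqP <-; rewrite mem_nth ?size_nbrs.
by exists k => //; rewrite mem_iota -(size_nbrs v).
Qed.

Lemma emit_tokens m w toks out : holds m w -> w + 5 <= n -> all token_ok toks ->
  runs W (seqs (map emit_token toks)) m out m
    (out ++ map (token_value (fun s => vtx (w + s))) toks).
Proof.
move=> hm wn; elim: toks out => [|x toks IH] out /=.
  by rewrite cats0 => _; exact: runs_skip.
move=> /andP[hx htoks]; rewrite -cat_rcons.
apply: runs_seq (IH _ htoks); case: x hx => [k|s] /= hx.
  by apply: (@runs_emit W (Lit k)); rewrite /= andbT; lia.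
have ws : w + s < n by apply: leq_trans wn; rewrite ltn_add2l.
have [f <-] := slot_vertexE hm ws.
exact: runs_emit.
Qed.

Lemma decideE leaf m w ps acc out : holds m w -> w + 5 <= n ->
  all (fun p => (p.1 < 5) && (p.2 < 5)) ps ->
  (forall b, all token_ok (leaf b)) ->
  exists m', runs W (decide leaf ps acc) m out m'
    (out ++ map (token_value (fun s => vtx (w + s)))
      (leaf (acc ++ [seq adj S v0 (w + p.1) (w + p.2) | p <- ps]))) /\ holds m' w.
Proof.
move=> + wn + leaf_ok; elim: ps m acc => [|[s t] ps IH] m acc hm /=.
  by rewrite cats0 => _; exists m; split=> //; exact: emit_tokens.
move=> /andP[/andP[s5 t5] hps].
have ws : w + s < n by lia.
have wt : w + t < n by lia.
have [m1 [r1 h1 e1]] := adjacency_flagE out hm ws wt.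
have -> : adj S v0 (w + s) (w + t) = story_graph S (vtx (w + s)) (vtx (w + t)).
  by rewrite /adj card_ord ws wt.
have [f2 e2] := @fits_register m1 w 2 h1 isT.
set g := story_graph S _ _ in e1 *.
have [m2 [r2 h2]] := IH m1 (rcons acc g) h1 hps.
exists m2; split=> //; rewrite -cat_rcons; apply: runs_seq r1 _.
have ev : Defs.eval m1 (Fetch (register 2)) = g.
  by rewrite -e1 -e2.
have f3 : fits W m1 (Fetch (register 2)).
  rewrite -[fits W m1 _]/((Defs.eval m1 (Fetch (register 2)) <= W) && fits W m1 (register 2)).
  by rewrite f2 ev andbT; case: (g) => /=; lia.
apply: runs_if => //; first by rewrite /= andbT; lia.
by rewrite ev; case: (g) r2.
Qed.

Lemma emit_windowE first m w out : holds m w -> w + 5 <= n -> first = (w == 0) ->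
  exists m', runs W (emit_window first) m out m'
    (out ++ put_code (window_code S v0 (w + 5))) /\ holds m' w.
Proof.
move=> hm wn fw; have := @decideE (window_tokens first) m w pairs5 [::] out hm wn isT.
move=> /(_ (window_tokens_ok first))[m' [r h]]; exists m'; split=> //.
rewrite -/(emit_window first) cat0s -/(window_bits S v0 w) in r.
have e : w + 5 - 5 = w by rewrite addnK.
have f5 : (w + 5 == 5) = (w == 0) by rewrite -[X in _ == X]add0n eqn_add2r.
rewrite /window_code /window_place /window_name e f5 -fw.
by rewrite -code_tokensE.
Qed.

Definition iteration := Seq (emit_window false)
  (Store (register 1) (Plus (Fetch (register 1)) (Lit 1))).

Lemma set_counter e m w w' out : holds m w -> fits W m e -> Defs.eval m e = w' ->
  exists m', runs W (Store (register 1) e) m out m' out /\ holds m' w'.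
Proof.
move=> hm fe ee; have [f1 e1] := @fits_register m w 1 hm isT.
exists (update m (reg 1) w'); split.
  by rewrite -e1 -ee; exact: runs_store.
case: hm => [h1 h2]; split=> [a an|]; rewrite /update ?eqxx //.
by rewrite ltn_eqF ?h1 // /reg; lia.
Qed.

Lemma fetch_counter m w : holds m w -> w <= n ->
  fits W m (Fetch (register 1)) /\ Defs.eval m (Fetch (register 1)) = w.
Proof.
move=> hm wn; have [f1 e1] := @fits_register m w 1 hm isT.
have ev : Defs.eval m (Fetch (register 1)) = w by rewrite -hm.2 -e1.
split=> //.
rewrite -[fits W m _]/((Defs.eval m (Fetch (register 1)) <= W) && fits W m (register 1)).
by rewrite f1 ev andbT; lia.
Qed.

Lemma fits_plus_counter m w k : holds m w -> w + k <= n -> k <= 4 ->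
  fits W m (Plus (Fetch (register 1)) (Lit k)) /\
  Defs.eval m (Plus (Fetch (register 1)) (Lit k)) = w + k.
Proof.
move=> hm wk k4; have [f e] := @fetch_counter m w hm (leq_trans (leq_addr _ _) wk).
have ev : Defs.eval m (Plus (Fetch (register 1)) (Lit k)) = w + k.
  by rewrite -[LHS]/(Defs.eval m (Fetch (register 1)) + k) e.
split=> //; rewrite -[fits W m _]/((Defs.eval m (Plus (Fetch (register 1)) (Lit k)) <= W) &&
  (fits W m (Fetch (register 1)) && ((k <= W) && true))).
by rewrite ev f; do ?[apply/andP; split]; lia.
Qed.

Definition output_upto w := flatten [seq put_code (window_code S v0 i) | i <- iota 5 w].

Lemma output_uptoS w :
  output_upto w.+1 = output_upto w ++ put_code (window_code S v0 (w + 5)).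
Proof.
by rewrite /output_upto -[w.+1]addn1 iotaD map_cat flatten_cat [5 + w]addnC /= cats0.
Qed.

Let counter4 := Plus (Fetch (register 1)) (Lit 4).
Let round_time := (cost counter4 + cost input_size + max_time iteration).+1.

(* Keeps unification from computing the running time in unary. *)
#[local] Opaque emit_window.

(** Here [d] is the number of rounds left; the additional [round_time] pays for the final test. *)
Lemma whileE d w m : holds m w -> 0 < w -> w + d + 4 = n ->
  exists m' t, exec W (WhileLt counter4 input_size iteration) m (output_upto w)
    t m' (output_upto (w + d)) /\ t <= d.+1 * round_time.
Proof.
elim: d w m => [|d IH] w m hm w0 wd.
  have w4n : w + 4 <= n by lia.
  have [f e] := @fits_plus_counter m w 4 hm w4n isT.
  exists m, (cost counter4 + cost input_size).+1; rewrite addn0; split.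
    apply: ExecWhileStop => //.
      by rewrite /= (holds_size hm) !andbT; lia.
    by rewrite e /= (holds_size hm); lia.
  by rewrite mul1n /round_time ltnS leq_addr.
have w4n : w + 4 <= n by lia.
have w5n : w + 5 <= n by lia.
have [f e] := @fits_plus_counter m w 4 hm w4n isT.
have [m1 [[t1 ht1 r1] h1]] := @emit_windowE false m w (output_upto w) hm w5n
  (esym (gtn_eqF w0)).
have [f' e'] := @fits_plus_counter m1 w 1 h1 (leq_trans (leq_add (leqnn w) (isT : 1 <= 5)) w5n) isT.
rewrite addn1 in e'.
have [m2 [[t2 ht2 r2] h2]] := set_counter
  (output_upto w ++ put_code (window_code S v0 (w + 5))) h1 f' e'.
have [||m3 [t3 [r3 ht3]]] := IH w.+1 m2 h2; [by [] | lia |].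
exists m3, (cost counter4 + cost input_size + (t1 + t2) + t3).+1; split.
  rewrite -addSnnS; apply: ExecWhileStep r3 => //.
  - by rewrite /= (holds_size hm) !andbT; lia.
  - by rewrite e /= (holds_size hm); lia.
  - by rewrite output_uptoS; apply: ExecSeq r1 r2.
have it : t1 + t2 <= max_time iteration by exact: leq_add ht1 ht2.
by rewrite mulSn -addSn; apply: leq_add ht3; rewrite /round_time ltnS leq_add2l.
Qed.

Lemma embed_storyE : 5 < n -> exists m' t,
  exec W embed_story (nth 0 input) [::] t m' (output_upto (n - 4)) /\
  t <= max_time (emit_window true) + max_time (Store (register 1) (Lit 1)) +
       n * round_time.
Proof.
(* The input has [5 * n + 1] entries, so register 1 is the first address behind it and initially
   reads as the default 0, the start of the first window. *)
move=> n5; have h0 : holds (nth 0 input) 0.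
  split=> //; apply: nth_default; rewrite /input /story_input /= size_cat size_map.
  rewrite size_order size_flatten /shape -map_comp.
  have -> : sumn [seq (size \o (fun v => put_seq (@put_vertex n) (nbrs v))) v
      | v <- enum 'I_n] = 4 * n.
    have -> : 4 * n = 4 * size (enum 'I_n) by rewrite size_enum_ord.
    elim: (enum 'I_n) => //= v s ->.
    rewrite size_flatten /shape -map_comp mulnS; congr (_.+1 + _).
    by rewrite -[RHS](size_nbrs v); elim: (nbrs v) => //= a l ->.
  by rewrite /reg; lia.
have n5' : 0 + 5 <= n by lia.
have [m1 [[t1 ht1 r1] h1]] := @emit_windowE true _ 0 [::] h0 n5' erefl.
have f : fits W m1 (Lit 1) by rewrite /= andbT; lia.
have [m2 [[t2 ht2 r2] h2]] := set_counter
  ([::] ++ put_code (window_code S v0 (0 + 5))) h1 f erefl.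
have o1 : [::] ++ put_code (window_code S v0 (0 + 5)) = output_upto 1.
  by rewrite output_uptoS.
rewrite o1 in r1 r2.
have [||m3 [t3 [r3 ht3]]] := @whileE (n - 5) 1 m2 h2; [by [] | lia |].
exists m3, (t1 + (t2 + t3)); split.
  have -> : n - 4 = 1 + (n - 5) by lia.
  by apply: ExecSeq r1 _; apply: ExecSeq r2 _; exact: r3.
rewrite addnA; apply: leq_add; first exact: leq_add.
by apply: leq_trans ht3 _; rewrite leq_mul2r; apply/orP; right; lia.
Qed.
End Execution.

Lemma embeddings_computed (R : realType) :
  exists (p : cmd) (c : nat),
     forall (n : nat) (S : graph_story 'I_n) (adj : 'I_n -> seq 'I_n),
       triconnected (story_graph S) ->
       cubic (story_graph S) -> omega S = 5 ->
       adjacency_lists (story_graph S) adj ->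
       exists (t : nat) (output : seq nat)
              (phi : nat -> set (drawing R 'I_n)) (cs : nat -> embedding_code 'I_n),
         [/\ computes_in (n ^ c) p (story_input S adj) t output,
             t <= c * n,
             output = sequence_output S cs,
             compatible_sequence S phi &
             forall i, 5 <= i <= n ->
               encodes_embedding (story_graph S) (window S i) (cs i) (phi i)].
Proof.
(* The constants are hidden behind variables, which prevents their evaluation in unary. *)
have bound a : exists k, a <= k by exists a; exact: leqnn.
have [k1 le1] := bound
  (max_time (emit_window true) + max_time (Store (register 1) (Lit 1))).
have [k2 le2] := bound ((cost (Plus (Fetch (register 1)) (Lit 4)) +
  cost input_size + max_time iteration).+1).
exists embed_story, (k1 + k2 + 3).
move=> n S nbrs G3 Gc omega5 nbrsP.
have n_gt0 : 0 < n by have := omega_le S; rewrite omega5 card_ord; case: (n).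
pose v0 : 'I_n := Ordinal n_gt0.
have n5 : 5 < n by have := n_gt5 v0 Gc omega5; rewrite card_ord.
(* The summand 3 of the constant serves here: as [n] is at least 6, [n ^ 3] is at least [36 * n]. *)
have wide : 5 * n + 25 <= n ^ (k1 + k2 + 3).
  apply: (@leq_trans (n ^ 3)); last by rewrite leq_pexp2l // leq_addl.
  apply: (@leq_trans (n * 36)); first by clear -n5; lia.
  by rewrite expnS leq_pmul2l // (@leq_trans (6 ^ 2)) // leq_exp2r.
have [m' [t [run ht]]] := embed_storyE v0 Gc omega5 nbrsP wide n5.
exists t, (output_upto S v0 (n - 4)), (@window_embedding R _ S v0), (window_code S v0).
split.
- by exists m'.
- have linear a b : a <= k1 -> b <= k2 -> a + n * b <= (k1 + k2 + 3) * n.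
    move=> a1 b2; rewrite !mulnDl -addnA leq_add //.
      by apply: leq_trans a1 _; rewrite leq_pmulr.
    by apply: leq_trans (leq_addr _ _); rewrite mulnC leq_mul2r b2 orbT.
  exact: leq_trans ht (linear _ _ le1 le2).
- by rewrite /sequence_output omega5 /output_upto subnSK // ltnW.
- split=> i; rewrite omega5 => hi.
    exact: (window_embeddingP R v0 G3 Gc omega5 hi).
  exact: (windows_compatible R v0 G3 Gc omega5 hi).
- move=> i hi; have hi' : 5 <= i <= #|'I_n| by rewrite card_ord.
  exists (window_drawing R S v0 i).
    exact: (window_drawing_in R v0 G3 Gc omega5 hi').
  exact: (window_describes R v0 G3 Gc omega5 hi').
Qed.

(** * Drawing strategy *)

Delimit Scope dec_uint_scope with uint.

(* Distances from the origin at which the [k]-th kind of arc crosses the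
   successive rays; vertices are at distance 4. *)
Definition arc_kinds : seq (seq nat) :=
  [:: [:: 4; 4]; [:: 4; 6; 4]; [:: 4; 2; 4]; [:: 4; 3; 5; 4]; [:: 4; 5; 3; 4]].

Definition arc := (nat * seq nat)%type.

(* The arc of the [k]-th kind between the vertices [p.1 < p.2] goes
   counterclockwise around the origin, from one or the other. *)
Definition arc_of (p : nat * nat) (k : nat) : arc :=
  let ks := nth [::] arc_kinds k in
  (if p.2 - p.1 == (size ks).-1 then p.1 else p.2, ks).

(** The arc goes from [p.1] to [p.2] or the other way around the origin. Points on consecutive rays
    have one arc, all other pairs four: two kinds in each direction. *)
Definition fitting (p : nat * nat) (k : nat) : bool :=
  if k < 5 then
    let l := (size (nth [::] arc_kinds k)).-1 in
    (p.2 - p.1 == l) || (p.2 - p.1 + l == 5)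
  else false.

Definition knot_end (ks : seq nat) j := (j == 0) || (j.+1 == size ks).

Definition knots_apart (A B : arc) j i : bool :=
  let a := nth 0 A.2 j in let b := nth 0 B.2 i in
  if a == b then if knot_end A.2 j then knot_end B.2 i else false else true.

(** In a common sector both arcs are segments between the two rays; they are apart if their order is
    not reversed. Equality on the second ray is judged by [knots_apart] at the next knots. *)
Definition sides_apart (A B : arc) j i : bool :=
  if (j.+1 < size A.2) && (i.+1 < size B.2) then
    let a := nth 0 A.2 j in let b := nth 0 A.2 j.+1 in
    let c := nth 0 B.2 i in let d := nth 0 B.2 i.+1 in
    if a < c then b <= d else if c < a then d <= b else b != d
  else true.

Definition arcs_apart (A B : arc) : bool :=
  all (fun j => all (fun i =>
    if (A.1 + j) %% 5 == (B.1 + i) %% 5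
    then if knots_apart A B j i then sides_apart A B j i else false
    else true) (iota 0 (size B.2))) (iota 0 (size A.2)).

(* A colouring gives for each pair of slots the number of the arc drawn for it
   plus one, or zero if there is no edge. *)
Definition drawn_arcs (C : seq nat) : seq arc :=
  [seq arc_of pc.1 pc.2.-1 | pc <- zip pairs5 C & 0 < pc.2].

Definition good_colouring C : bool :=
  if all (fun pc => (pc.2 == 0) || fitting pc.1 pc.2.-1) (zip pairs5 C)
  then pairwise arcs_apart (drawn_arcs C) else false.

(** [pairs5] starts with the four pairs containing slot 0, so forgetting the oldest vertex is a
    [drop]; here the colours [d] of the edges to the new vertex are interleaved. *)
Definition extend (c d : seq nat) : seq nat :=
  [:: nth 0 c 0; nth 0 c 1; nth 0 c 2; nth 0 d 0; nth 0 c 3; nth 0 c 4;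
      nth 0 d 1; nth 0 c 5; nth 0 d 2; nth 0 d 3].
Definition restrict (C : seq nat) : seq nat := drop 4 C.

(** [has] with a conditional: under call-by-value evaluation, [||] would traverse the whole list
    even after a hit. *)
Fixpoint exists_in (T : Type) (a : pred T) (s : seq T) : bool :=
  if s is x :: s' then if a x then true else exists_in a s' else false.

Lemma exists_inP (T : eqType) (a : pred T) s :
  reflect (exists2 x, x \in s & a x) (exists_in a s).
Proof.
have -> : exists_in a s = has a s by elim: s => //= x s ->; case: (a x).
exact: hasP.
Qed.

Fixpoint decimal_digits (d : Decimal.uint) : seq nat :=
  match d with
  | Decimal.Nil => [::]
  | Decimal.D0 d => 0 :: decimal_digits d
  | Decimal.D1 d => 1 :: decimal_digits d
  | Decimal.D2 d => 2 :: decimal_digits d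
  | Decimal.D3 d => 3 :: decimal_digits d
  | Decimal.D4 d => 4 :: decimal_digits d
  | Decimal.D5 d => 5 :: decimal_digits d
  | Decimal.D6 d => 6 :: decimal_digits d
  | Decimal.D7 d => 7 :: decimal_digits d
  | Decimal.D8 d => 8 :: decimal_digits d
  | Decimal.D9 d => 9 :: decimal_digits d
  end.

(* Number literals are used as strings of digits. *)
Definition digits (x : Number.uint) : seq nat :=
  if x is Number.UIntDecimal d then decimal_digits d else [::].

(* The first six digits of a code colour the pairs 01, 02, 03, 12, 13, 23 of
   the last four vertices.  Each group of four digits after them gives possible
   numbers of later neighbours of these vertices. *)
Definition state_codes : seq Number.uint :=
  [:: 0000000112012202120222032210121022111211131122112311321133121212131222;
    0000001223123213121313132213231332201220222112211321222123213222122213;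
    0000002222222322322312231323223022311231133122312331323212321332223223;
    000000323233133322;
    0000010111021103111011110111021111111211211122120112021211121212211301;
    0000011302131113121321201121012102211121122121220122022211221222212301;
    000001230223113011310131023111311231213201320232113212322133023311;
    0000201011101210211022103110321111111211211122113112121221123120112012;
    000020202120222111211221212122301230223122;
    0000211011102111011110111111201201201121012110211130113111;
    0000300111012102211012102110221111111211211122121112121222202120222031;
    00003021122131221122122221;
    0000311011110111101111120112101211122020112101212022012210;
    0000402011201221112121212230113012302130223031311131123121313132123221;
    00004121102111301131013110312032013210;
    0001000112021210121022110211121113112212021212121312222012202221022112;
    00010021132122220222123012302231023112311331223212;
    0001011011110111021111120112021211201121012102211122013011310131023111;
    0001013201; 00012010111012102111111121201120123012;
    00013001111011101211011112201220212111; 00013111011110;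
    00014020112101301130213111;
    0020000111011201210122013101320211021202210222031103120321033110111021;
    00200011121121112211311211122112221311131213212021;
    00200101110121110111101111112012101211122013011310;
    0020200111012110111021; 002030121012111220; 0020311110;
    002100011101120121021102211011102111011111111211211211; 0021011101;
    0021301011;
    0030000112012101220131021102120221022203110312032211111112112111221221;
    00300012222111211221212122221122122312;
    00300101111101111011111210121121012110211122012301;
    00303001110121021102211011102111101130; 0030311110;
    003040201120212110211121202211;
    0031000111011202121011102111011111111212012011202121012111211221212211;
    0031011101111021012110; 00312010112011; 00313001111110; 0031402110;
    004000011202311021111211221131121212312112212221312221222222312321;
    00400102111111112012012101211121202210221122202310;
    004020021110211110111111201121201120212121; 00402111102110;
    00404021302220; 005000112212111212; 0050010211031111111201;
    0050301021111111201121;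
    0200000112012202120222031203221012110211121113112212021212121312221312;
    02000020122113212222122312;
    02000101110211031111011102111112011202121113012102211122012301;
    0200300111012102110221101110121021110111111112112112112012202121112211;
    02003111011110; 0201000112021210121102111212022012; 0201011101;
    020130011110111101; 0220000111011201210211021210111112112112111311;
    02200111011110; 0220301011; 023000021202210311; 02303011101210;
    02310001111011; 0250000112; 0250300111;
    0300000112012202120222101211021112111311221202121212131222130221022112;
    03000021132122220222132222;
    0300010111021111011102111112011202121121012102211122022211;
    030020011101211011101210211101111111121121120120122112;
    030021110111102101; 0300402011202121012121; 0300412110;
    030100011210121102110311122012210221122202; 03010111012101; 0301201011;
    03014020112101; 03200002120221;
    033000011101120121021102121101111112011221; 03310001111011110111111201;
    0340000112111211211212; 0340011101111012011210; 0340200111101111111120;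
    1000000112012201320212022210121022103211121113112211231132121212131222;
    100000201220222112211321222123213222132222;
    1000010111012102111011102111011102111111121121120112021211201121012102;
    10000121112112212122022211; 1000200111101110121021102210312022;
    10002110112011; 100030011101211011101210211022111111121121;
    100031101111011110; 100040201120122021203121122121; 10004121012110;
    100100011210121013102211021112201220222112; 1001011011110120112101;
    1001301011; 1001402011; 102000011201210122; 1020010111;
    103000011101120121012201310211021202211111111212121221;
    103001011111011201; 1030300111101111111120; 1031000111101110211111;
    1040000111011210111021112111221131; 1040011110111111201210; 1040201021;
    12000001120122021211121212; 120001011111011201; 120030011110111111;
    12300001110211; 1300000112011301221012110211131122; 130001011111021111;
    13002010121021; 13010010121102; 13400001120121]%uint.

Definition decode (code : Number.uint) : seq (seq nat) :=
  let d := digits code in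
  [seq take 6 d ++ q | q <- reshape (nseq (size d %/ 4) 4) (drop 6 d)].

Definition states := Eval vm_compute in flatten (map decode state_codes).

Fixpoint choices (ss : seq (seq nat)) : seq (seq nat) :=
  if ss is s :: ss' then [seq x :: l | x <- s, l <- choices ss'] else [:: [::]].

Definition options (p : nat * nat) (edge : bool) : seq nat :=
  if edge then [seq k.+1 | k <- iota 0 5 & fitting p k] else [:: 0].

Definition new_colours (N : seq bool) : seq (seq nat) :=
  choices [seq options (q, 4) (nth false N q) | q <- iota 0 4].

(* [s] is a state and [N] tells which of the last four vertices are adjacent to
   the next one. *)
Definition step_ok (s : seq nat) (N : seq bool) : bool :=
  let c := take 6 s in let dem := drop 6 s in
  let left q := nth 0 dem q - nth false N q in
  let dem' := [:: left 1; left 2; left 3; 3 - count id N] in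
  let m := count (leq 1) c + count id N in
  if all (fun q => nth false N q <= nth 0 dem q) (iota 0 4) then
    if (left 0 == 0) && (count id N <= 3) then
      if (m <= 4) && (3 <= count (leq 1) dem') then
        exists_in (fun d => let C := extend c d in
          if good_colouring C then exists_in (eq_op (restrict C ++ dem')) states
          else false) (new_colours N)
      else if (m <= 6) && (count id N == 3) && all (pred1 0) dem' then
        exists_in (fun d => good_colouring (extend c d)) (new_colours N)
      else true
    else true
  else true.

Definition first_ok (b : seq bool) : bool :=
  let M := adjacency_matrix b in
  if end_window 0 M then
    exists_in (fun C => if map (leq 1) C == b then
      if good_colouring C then
        exists_in (eq_op (restrict C ++ [seq 3 - slot_degree M s | s <- iota 1 4])) states
      else false else false)
      (choices [seq options pe.1 pe.2 | pe <- zip pairs5 b])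
  else true.

Lemma first_checked : all first_ok (bit_lists 10).
Proof. vm_compute; reflexivity. Qed.

(** The listed positions are closed under the game: each admissible set of edges to a new vertex has
    an answer leading to a listed position, or merely a legal answer if the story ends there. *)
Lemma steps_checked : all (fun s => all (step_ok s) (bit_lists 4)) states.
Proof. vm_compute; reflexivity. Qed.

Local Open Scope classical_set_scope.
Local Open Scope ring_scope.

(** * Polygonal arcs around the origin *)

Section Polylines.
Variable R : realType.
Implicit Types (a b f g x t : R) (k s j i : nat) (ks : seq nat) (p : R * R).

(** Only the cyclic order matters, so a distorted pentagon with entries 0, 1 and -1 is taken;
    consecutive directions have determinant 1. *)
Definition directions : seq (R * R) :=
  [:: (1, 0); (0, 1); (- 1, 1); (- 1, 0); (0, - 1)].
Definition direction k : R * R := nth (0, 0) directions (k %% 5).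

Definition mix k a b : R * R :=
  (a * (direction k).1 + b * (direction k.+1).1, a * (direction k).2 + b * (direction k.+1).2).

Lemma direction_mod k : direction (k %% 5) = direction k.
Proof. by rewrite /direction modn_mod. Qed.

Lemma mix_mod k a b : mix (k %% 5) a b = mix k a b.
Proof.
rewrite /mix direction_mod -(direction_mod (k %% 5).+1) -[(k %% 5).+1]addn1.
by rewrite modnDml addn1 direction_mod.
Qed.

(* The five sectors, each with its first side only, partition the plane without
   the origin. *)
Lemma mix_inj k k' a b a' b' : 0 < a -> 0 <= b -> 0 < a' -> 0 <= b' ->
  mix k a b = mix k' a' b' -> [/\ k = k' %[mod 5], a = a' & b = b'].
Proof.
move=> a0 b0 a0' b0'; rewrite -[LHS]mix_mod -[RHS]mix_mod.
have := ltn_pmod k (isT : 0 < 5)%N; have := ltn_pmod k' (isT : 0 < 5)%N.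
move: (k %% 5)%N (k' %% 5)%N => {k k'} k' k.
case: k => [|[|[|[|[|k]]]]] //; case: k' => [|[|[|[|[|k']]]]] // _ _;
  rewrite /mix /direction /= !(mulr0, mulr1, mulrN1, addr0, add0r) => -[e1 e2];
  first [by exfalso; lra | split=> //; lra].
Qed.

(** Hat functions: a polygonal arc is a sum of hats at its knots, so its continuity needs no gluing,
    and between two knots only two hats are nonzero. *)
Definition tent x : R := Num.max 0 (1 - `|x|).

Lemma tent_left f : 0 <= f <= 1 -> tent f = 1 - f.
Proof. by move=> /andP[f0 f1]; rewrite /tent ger0_norm // max_r // subr_ge0. Qed.

Lemma tent_right f : 0 <= f <= 1 -> tent (f - 1) = f.
Proof.
move=> /andP[f0 f1]; rewrite /tent ler0_norm ?subr_le0 // opprB subKr max_r //.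
Qed.

Lemma tent_out x : 1 <= `|x| -> tent x = 0.
Proof. by move=> h; rewrite /tent max_l // subr_le0. Qed.

Lemma addf_continuous (u v : R -> R) : continuous u -> continuous v ->
  continuous (fun x => u x + v x).
Proof. by move=> cu cv x; apply: (@cvgD _ _ _ _ _ u v _ _ (cu x) (cv x)). Qed.

Lemma mulfr_continuous (u : R -> R) a : continuous u -> continuous (fun x => u x * a).
Proof. by move=> cu x; apply: (@cvgM _ _ _ _ u (fun=> a) _ _ (cu x) (cvg_cst a)). Qed.

Lemma tent_continuous : continuous tent.
Proof.
move=> x; apply: (@continuous_max _ _ (fun=> 0) (fun x => 1 - `|x|)).
  exact: cvg_cst.
apply: (@addf_continuous (fun=> 1) (fun x => - `|x|)); first exact: cst_continuous.
by move=> y; apply: cvgN; exact: norm_continuous.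
Qed.

Lemma tent_knot j i f : 0 <= f <= 1 ->
  tent (j%:R + f - i%:R) = if i == j then 1 - f else if i == j.+1 then f else 0.
Proof.
move=> f01; have /andP[f0 f1] := f01; case: eqP => [->|ij].
  by rewrite addrAC subrr add0r tent_left.
case: eqP => [->|ij1].
  by rewrite -natr1 opprD addrACA subrr add0r tent_right.
apply: tent_out; case: (ltngtP i j) => h; last by case: ij.
  have : i%:R + 1 <= j%:R :> R by rewrite natr1 ler_nat.
  move=> ?; rewrite ger0_norm; lra.
have : j%:R + 2 <= i%:R :> R by rewrite -natrD ler_nat addn2; lia.
move=> ?; rewrite ler0_norm; lra.
Qed.

Definition knot ks j : R := (nth 0%N ks j)%:R.

Definition polyline s ks x : R * R :=
  let c j := tent (x - j%:R) * knot ks j in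
  (c 0%N * (direction s).1 + c 1%N * (direction s.+1).1 +
     c 2%N * (direction s.+2).1 + c 3%N * (direction s.+3).1,
   c 0%N * (direction s).2 + c 1%N * (direction s.+1).2 +
     c 2%N * (direction s.+2).2 + c 3%N * (direction s.+3).2).

Lemma polylineE s ks j f : (size ks <= 4)%N -> (j < size ks)%N -> 0 <= f <= 1 ->
  polyline s ks (j%:R + f) = mix (s + j) ((1 - f) * knot ks j) (f * knot ks j.+1).
Proof.
move=> ks4 jk f01; rewrite /polyline !tent_knot //.
have k4 : knot ks 4 = 0 by rewrite /knot nth_default.
have : (j < 4)%N by exact: leq_trans ks4.
by case: j jk => [|[|[|[|j]]]] // _ _; rewrite /mix /= ?addn0 ?addn1 ?addn2 ?addn3 ?k4;
  congr (_, _); ring.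
Qed.

Lemma locate l x : 0 <= x <= l%:R -> exists j f,
  [/\ x = j%:R + f, (j <= l)%N, 0 <= f < 1 & j = l -> f = 0].
Proof.
move=> /andP[x0 xl]; exists (Num.truncn x), (x - (Num.truncn x)%:R).
have /andP[h1 h2] := truncn_itv x0; split.
- by rewrite subrKC.
- by rewrite -(ler_nat R) (le_trans h1).
- by rewrite subr_ge0 h1 /= ltrBlDl natr1.
- by move=> e; apply/eqP; rewrite subr_eq0 eq_le h1 e xl.
Qed.

End Polylines.

Definition proper_knots (ks : seq nat) : bool :=
  [&& 1 < size ks <= 4, all (leq 1) ks &
      all (fun j => (nth 0 ks j == 4) == knot_end ks j) (iota 0 (size ks))]%N.

Section Arcs.
Variable R : realType.
Implicit Types (f g x t : R) (r j i k : nat) (A B : arc) (p : R * R).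

Definition vertex_point k : R * R := mix k 4 0.

Definition arc_at r A x : R * R := polyline (r + A.1) A.2 x.

Definition arc_points r A : set (R * R) :=
  arc_at r A @` `[0, (size A.2).-1%:R].

Lemma vertex_point_inj k k' : vertex_point k = vertex_point k' -> k = k' %[mod 5].
Proof. by move/mix_inj => /(_ _ _ _ _)[]. Qed.

Lemma vertex_point_mod k : vertex_point (k %% 5) = vertex_point k.
Proof. exact: mix_mod. Qed.

Lemma knot_gt0 ks j : proper_knots ks -> (j < size ks)%N -> 0 < knot R ks j.
Proof. by move=> /and3P[_ /allP h _] js; rewrite ltr0n; apply/h/mem_nth. Qed.

Lemma knot_endE ks j : proper_knots ks -> (j < size ks)%N ->
  (nth 0%N ks j == 4%N) = knot_end ks j.
Proof.
by move=> /and3P[_ _ /allP h] js; have /h/eqP-> : j \in iota 0 (size ks) by rewrite mem_iota.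
Qed.

Lemma arc_atE r A x : proper_knots A.2 -> 0 <= x <= (size A.2).-1%:R ->
  exists j f, [/\ x = j%:R + f, (j < size A.2)%N, 0 <= f < 1,
    j.+1 = size A.2 -> f = 0 &
    arc_at r A x = mix (r + A.1 + j) ((1 - f) * knot R A.2 j) (f * knot R A.2 j.+1)].
Proof.
move=> /and3P[/andP[s1 s4] _ _] /locate[j [f [-> jl /andP[f0 f1] jf]]].
have s0 : (0 < size A.2)%N by exact: ltnW.
have js : (j < size A.2)%N by rewrite -(prednK s0) ltnS.
exists j, f; split=> //; first by rewrite f0.
  by move=> e; apply: jf; rewrite -e.
by apply: polylineE; rewrite // f0 ltW.
Qed.

Lemma mix_knots_inj A B r r' j i f g : proper_knots A.2 -> proper_knots B.2 ->
  (j < size A.2)%N -> (i < size B.2)%N -> 0 <= f < 1 -> 0 <= g < 1 ->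
  mix (r + A.1 + j) ((1 - f) * knot R A.2 j) (f * knot R A.2 j.+1) =
  mix (r' + B.1 + i) ((1 - g) * knot R B.2 i) (g * knot R B.2 i.+1) ->
  [/\ r + A.1 + j = r' + B.1 + i %[mod 5],
      (1 - f) * knot R A.2 j = (1 - g) * knot R B.2 i &
      f * knot R A.2 j.+1 = g * knot R B.2 i.+1].
Proof.
move=> pA pB jA iB /andP[f0 f1] /andP[g0 g1].
by apply: mix_inj; rewrite ?mulr_gt0 ?subr_gt0 ?knot_gt0 ?mulr_ge0 // ler0n.
Qed.

Lemma arc_at_inj r A x y : proper_knots A.2 -> 0 <= x <= (size A.2).-1%:R ->
  0 <= y <= (size A.2).-1%:R -> arc_at r A x = arc_at r A y -> x = y.
Proof.
move=> pA hx hy.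
have [j [f [-> js f01 _ ->]]] := arc_atE r pA hx.
have [i [g [-> iS g01 _ ->]]] := arc_atE r pA hy.
move=> /(mix_knots_inj pA pA js iS f01 g01)[ji fg _].
have ij : j = i.
  have /and3P[/andP[_ s4] _ _] := pA.
  move/eqP: ji; rewrite eqn_modDl => /eqP.
  by rewrite !modn_small //; apply: ltnW; rewrite ltnS (leq_trans _ s4).
rewrite -ij in fg *; congr (_ + _).
have /lt0r_neq0 k0 := knot_gt0 pA js.
by move/(mulIf k0): fg => /(congr1 (fun z => 1 - z)); rewrite !subKr.
Qed.

Lemma arc_at_continuous r A : continuous (arc_at r A).
Proof.
have term j a : continuous (fun x => tent (x - j%:R) * knot R A.2 j * a).
  apply: mulfr_continuous; apply: mulfr_continuous => x.
  apply: (@continuous_comp _ _ _ (fun x => x - j%:R) (@tent R)).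
    apply: (@addf_continuous _ id (fun=> - j%:R)); last exact: cst_continuous.
    by move=> y; exact: cvg_id.
  exact: tent_continuous.
by apply: pair_continuous; do 3![apply: addf_continuous; last exact: term]; exact: term.
Qed.

Lemma arc_jordan r A : proper_knots A.2 ->
  let l := (size A.2).-1 in
  jordan_arc (arc_points r A) (vertex_point (r + A.1)) (vertex_point (r + A.1 + l)) /\
  jordan_arc (arc_points r A) (vertex_point (r + A.1 + l)) (vertex_point (r + A.1)).
Proof.
move=> pA l; have /and3P[/andP[s1 s4] _ _] := pA.
have l0 : 0 < l%:R :> R by rewrite ltr0n /l -subn1 subn_gt0.
have s0 : (0 < size A.2)%N by exact: ltnW.
have v k j : (j < size A.2)%N -> knot_end A.2 j ->
    mix (k + j) ((1 - 0) * knot R A.2 j) (0 * knot R A.2 j.+1) = vertex_point (k + j).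
  by move=> js; rewrite -knot_endE // => /eqP e; rewrite /knot e subr0 mul1r mul0r.
have f01 : 0 <= (0 : R) <= 1 by rewrite lexx ler01.
have at0 : arc_at r A 0 = vertex_point (r + A.1).
  by have := polylineE (r + A.1) s4 s0 f01; rewrite addr0 v // addn0.
have ls : (l < size A.2)%N by rewrite prednK.
have atl : arc_at r A l%:R = vertex_point (r + A.1 + l).
  have := polylineE (r + A.1) s4 ls f01; rewrite addr0 v //.
  by rewrite /knot_end prednK // eqxx orbT.
have jordan (h h' : R -> R) : continuous h -> cancel h h' -> cancel h' h ->
    (forall t, (0 <= t <= 1) = (0 <= h t <= l%:R)) ->
    jordan_arc (arc_points r A) (arc_at r A (h 0)) (arc_at r A (h 1)).
  move=> ch hK h'K h01; exists (arc_at r A \o h); split=> //.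
  - apply: continuous_subspaceT => x.
    by apply: continuous_comp; [exact: ch | exact: arc_at_continuous].
  - move=> x y; rewrite !inE /= !in_itv /= !h01 => hx hy /(arc_at_inj pA hx hy).
    exact: can_inj hK _ _.
  - apply/seteqP; split=> [_ [x /= x01 <-]|_ [t /= t01 <-]].
      by exists (h' x); rewrite /= ?h'K // in_itv /= h01 h'K; move: x01; rewrite in_itv.
    by exists (h t) => //; rewrite /= in_itv /= -h01; move: t01; rewrite in_itv.
split.
  have := jordan (fun t => t * l%:R) (fun x => x / l%:R).
  rewrite mul0r mul1r at0 atl; apply.
  - exact: mulrr_continuous.
  - by move=> x; rewrite mulfK // gt_eqF.
  - by move=> x; rewrite divfK // gt_eqF.
  - by move=> t; rewrite pmulr_lge0 // ger_pMl.
have := jordan (fun t => (1 - t) * l%:R) (fun x => 1 - x / l%:R).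
rewrite subr0 subrr mul0r mul1r at0 atl; apply.
- apply: mulfr_continuous; apply: (@addf_continuous _ (fun=> 1) (fun x => - x)).
    exact: cst_continuous.
  exact: opp_continuous.
- by move=> x; rewrite mulfK ?gt_eqF // subKr.
- by move=> x; rewrite subKr divfK // gt_eqF.
- by move=> t; rewrite pmulr_lge0 // subr_ge0 ger_pMl // gerBl andbC.
Qed.

End Arcs.

Local Close Scope ring_scope.
Local Close Scope classical_set_scope.
Local Open Scope nat_scope.

(** * Colourings of a story *)

Lemma choicesP ss l : l \in choices ss ->
  size l = size ss /\ forall q, q < size ss -> nth 0 l q \in nth [::] ss q.
Proof.
elim: ss l => [|s ss IH] l /=; first by rewrite inE => /eqP ->.
case/allpairsP => -[x k] /= [xs /IH[sk hk] ->] /=; rewrite sk; split=> //.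
by case=> [|q] //=; exact: hk.
Qed.

Lemma new_coloursP N d : size N = 4 -> d \in new_colours N ->
  map (leq 1) d = N.
Proof.
move=> sN /choicesP; rewrite size_map size_iota => -[sd hd].
apply: (@eq_from_nth _ false); rewrite size_map ?sd ?sN // => q q4.
rewrite (nth_map 0) ?sd //; have := hd q q4.
rewrite (nth_map 0) ?size_iota // nth_iota // add0n.
case: (nth false N q) => /=; last by rewrite inE => /eqP ->.
by case/mapP => k _ ->.
Qed.

(* The bits of a window, from those of the pairs without its newest vertex and
   those of the pairs with it. *)
Definition join_bits (b N : seq bool) : seq bool :=
  [:: nth false b 0; nth false b 1; nth false b 2; nth false N 0;
      nth false b 3; nth false b 4; nth false N 1; nth false b 5;
      nth false N 2; nth false N 3].

Lemma count_join_bits b N : size b = 6 -> size N = 4 ->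
  count id (join_bits b N) = count id b + count id N.
Proof.
case: b => [|b0 [|b1 [|b2 [|b3 [|b4 [|b5 [|]]]]]]] // _.
case: N => [|c0 [|c1 [|c2 [|c3 [|]]]]] //= _; lia.
Qed.

Lemma extend_bits c d : size c = 6 -> size d = 4 ->
  map (leq 1) (extend c d) = join_bits (map (leq 1) c) (map (leq 1) d).
Proof.
case: c => [|b0 [|b1 [|b2 [|b3 [|b4 [|b5 [|]]]]]]] // _.
by case: d => [|c0 [|c1 [|c2 [|c3 [|]]]]].
Qed.

Section Colouring.
Variables (V : finType) (S : graph_story V) (v0 : V).
Let G := story_graph S.
Let n := #|V|.
Hypothesis G3 : triconnected G.
Hypothesis Gc : cubic G.
Hypothesis omega5 : omega S = 5.
Let adj := adj S v0.
Let deg := degree_in S v0.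
Let bits w := window_bits S v0 w.

Definition demands w := [seq deg (w + s) (w + 5) n | s <- iota 1 4].

Definition coloured w C :=
  [/\ map (leq 1) C = bits w, good_colouring C &
      w + 5 < n -> restrict C ++ demands w \in states].

Lemma coloured_size w C : coloured w C -> size C = 10.
Proof. by case=> /(congr1 size); rewrite !size_map. Qed.

Lemma first_coloured : exists C, coloured 0 C.
Proof.
have n5 : 0 + 5 < n by exact: (n_gt5 v0 Gc omega5).
have b10 : bits 0 \in bit_lists 10 by rewrite mem_bit_lists.
have := allP first_checked _ b10; rewrite /first_ok.
have -> : end_window 0 (adjacency_matrix (bits 0)).
  by apply: (first_windowP v0 G3 Gc omega5); rewrite // ltnW.
case/exists_inP => C _; case: eqP => // Cb; case: ifP => // gC.
case/exists_inP => s sin /eqP e; exists C; split=> // _.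
suff -> : demands 0 = [seq 3 - slot_degree (adjacency_matrix (bits 0)) s | s <- iota 1 4].
  by rewrite e.
apply/eq_in_map => t; rewrite mem_iota => /andP[_ s5].
have := degree_sum v0 Gc omega5 (ltnW n5) s5.
have z : deg (0 + t) 0 0 = 0 by [].
rewrite -/(deg _ _ _) z add0n => h.
by rewrite -[LHS](addKn (slot_degree (adjacency_matrix (bits 0)) t)) h.
Qed.

(** The counting lemmas exclude all moves for which [step_ok] holds vacuously. If vertices remain,
    the middle-window counts hold; otherwise the last-window counts hold and no demand is left. *)
Lemma next_coloured w C : w + 5 < n -> coloured w C ->
  exists C', coloured w.+1 C' /\
    restrict C = [:: nth 0 C' 0; nth 0 C' 1; nth 0 C' 2; nth 0 C' 4; nth 0 C' 5; nth 0 C' 7].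
Proof.
move=> wn cC; have s10 := coloured_size cC; have [Cb gC /(_ wn) st] := cC.
pose N := [seq adj (w.+1 + q) (w + 5) | q <- iota 0 4].
have N4 : N \in bit_lists 4 by rewrite mem_bit_lists.
have := allP (allP steps_checked _ st) _ N4; rewrite /step_ok.
have cs : size (restrict C) = 6 by rewrite size_drop s10.
have -> : take 6 (restrict C ++ demands w) = restrict C by rewrite take_cat cs ltnn take0 cats0.
have -> : drop 6 (restrict C ++ demands w) = demands w by rewrite drop_cat cs ltnn drop0.
have wS5 : w.+1 + 5 <= n by rewrite addSn.
(* The later neighbours of an old vertex are the new vertex and those after it. *)
have dem q : q < 4 -> nth 0 (demands w) q = nth false N q + deg (w.+1 + q) (w.+1 + 5) n.
  move=> q4; rewrite (nth_map 0) ?size_iota // nth_iota //.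
  rewrite (nth_map 0) ?size_iota // nth_iota // add0n addnA addn1.
  have -> : deg (w.+1 + q) (w + 5) n =
      deg (w.+1 + q) (w + 5) (w.+1 + 5) + deg (w.+1 + q) (w.+1 + 5) n.
    by apply: (degree_split v0 omega5); rewrite addSn leqnSn.
  congr (_ + _); rewrite /deg /degree_in addSn subSnn /= addn0.
  by [].
have all_le : all (fun q => nth false N q <= nth 0 (demands w) q) (iota 0 4).
  by apply/allP => q; rewrite mem_iota => /= q4; rewrite dem // leq_addr.
rewrite all_le.
have left q : q < 4 -> nth 0 (demands w) q - nth false N q = deg (w.+1 + q) (w.+1 + 5) n.
  by move=> q4; rewrite dem // addKn.
have old : map (leq 1) (restrict C) = drop 4 (bits w) by rewrite map_drop Cb.
have bitsS : bits w.+1 = join_bits (drop 4 (bits w)) N.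
  by rewrite /bits /window_bits /join_bits /N /= !addSnnS.
have newE : slot_degree (adjacency_matrix (bits w.+1)) 4 = count id N.
  by rewrite bitsS.
have edgesE : slot_edges (adjacency_matrix (bits w.+1)) =
    (count (leq 1) (restrict C) + count id N).*2.
  by rewrite slot_edgesE // bitsS count_join_bits // -old count_map.
have sum4 := degree_sum v0 Gc omega5 wS5 (isT : 4 < 5).
rewrite -/(bits _) newE -/(deg _ _ _) in sum4.
have far4 : deg (w.+1 + 4) 0 w.+1 = 0.
  by apply: (degree_far_left v0 omega5); rewrite leqnn.
rewrite -/(deg _ _ _) far4 add0n in sum4.
have new4 : 3 - count id N = deg (w.+1 + 4) (w.+1 + 5) n.
  by rewrite -[RHS](addKn (count id N)) sum4.
have left0 : deg (w.+1 + 0) (w.+1 + 5) n = 0.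
  by apply: (degree_far_right v0 omega5); rewrite addn0.
have -> : count id N <= 3 by rewrite -[3]sum4 leq_addr.
rewrite !left // new4 left0 eqxx andbT.
set D := [:: deg (w.+1 + 1) (w.+1 + 5) n; _; _; _].
have DE : demands w.+1 = D by [].
have take_colour d : d \in new_colours N -> good_colouring (extend (restrict C) d) ->
    (w.+1 + 5 < n -> restrict (extend (restrict C) d) ++ D \in states) ->
    exists C', coloured w.+1 C' /\ restrict C = [:: nth 0 C' 0; nth 0 C' 1;
      nth 0 C' 2; nth 0 C' 4; nth 0 C' 5; nth 0 C' 7].
  move=> dN gd hs; exists (extend (restrict C) d); split.
    split=> //; have [d4 _] := choicesP dN; rewrite size_map size_iota in d4.
    by rewrite extend_bits // old bitsS (new_coloursP _ dN).
  by case: (restrict C) cs => [|c0 [|c1 [|c2 [|c3 [|c4 [|c5 [|]]]]]]].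
case: (ltnP (w.+1 + 5) n) => [more|full].
  have -> : count (leq 1) (restrict C) + count id N <= 4.
    have := middle_windowP v0 G3 Gc omega5 wS5 (ltn0Sn w) more.
    case/andP=> _; rewrite -/(bits _) edgesE.
    by rewrite -[8]/(4.*2) leq_double.
  have -> : 2 < count (leq 1) D.
    have := right_ends v0 G3 omega5 wS5 more.
    by rewrite /= -/(deg _ _ _) left0.
  rewrite andbT; case/exists_inP => d dN; case: ifP => // gd /exists_inP[s sin /eqP e].
  by apply: (take_colour d) => // _; rewrite e.
have nE : w.+1 + 5 = n by apply/eqP; rewrite eqn_leq wS5.
have D0 : D = [:: 0; 0; 0; 0] by rewrite /D nE /deg /degree_in subnn.
case/and4P: (last_windowP v0 G3 Gc omega5 wS5 nE (ltn0Sn w)) => _.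
rewrite -/(bits _) edgesE newE -[12]/(6.*2) leq_double => -> -> _.
rewrite D0 /= andbF => /exists_inP[d dN gd].
by apply: (take_colour d) => //; rewrite nE ltnn.
Qed.

Lemma colouring_exists : exists f : nat -> seq nat,
  (forall w, w + 5 <= n -> coloured w (f w)) /\
  (forall w, w + 5 < n -> restrict (f w) =
     [:: nth 0 (f w.+1) 0; nth 0 (f w.+1) 1; nth 0 (f w.+1) 2;
         nth 0 (f w.+1) 4; nth 0 (f w.+1) 5; nth 0 (f w.+1) 7]).
Proof.
suff: forall k, k + 5 <= n -> exists f : nat -> seq nat,
    (forall w, w <= k -> coloured w (f w)) /\
    (forall w, w < k -> restrict (f w) =
     [:: nth 0 (f w.+1) 0; nth 0 (f w.+1) 1; nth 0 (f w.+1) 2;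
         nth 0 (f w.+1) 4; nth 0 (f w.+1) 5; nth 0 (f w.+1) 7]).
  move=> /(_ (n - 5)); have n5 := ltnW (n_gt5 v0 Gc omega5).
  rewrite subnK // leqnn => /(_ isT)[f [h1 h2]].
  exists f; split=> w; first by rewrite addnC -leq_subRL //; exact: h1.
  by rewrite addnC -ltn_subRL; exact: h2.
elim=> [|k IH] kn.
  by have [C hC] := first_coloured; exists (fun=> C); split=> // w; rewrite leqn0 => /eqP ->.
have [f [h1 h2]] := IH (ltnW kn).
have [C' [hC' cC']] := next_coloured kn (h1 k (leqnn k)).
exists (fun w => if w == k.+1 then C' else f w); split=> w.
  rewrite leq_eqVlt ltnS; case: eqP => [-> //|_ /=]; exact: h1.
rewrite ltnS leq_eqVlt eqSS; case: eqP => [-> _|wk /= hw]; first by rewrite ltn_eqF.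
by rewrite ltn_eqF; [exact: h2 | exact: leq_trans hw (leqnSn k)].
Qed.

End Colouring.

Local Open Scope classical_set_scope.
Local Open Scope ring_scope.

(** * Realizability *)

Lemma pairwise_mem (T : eqType) (r : rel T) s x y : pairwise r s ->
  x \in s -> y \in s -> x != y -> r x y || r y x.
Proof.
elim: s => //= z s IH /andP[/allP hz hs]; rewrite !inE.
move=> /predU1P[->|xs] /predU1P[->|ys] xy; last exact: IH.
- by rewrite eqxx in xy.
- by rewrite hz.
- by rewrite hz ?orbT.
Qed.

Lemma arc_of_proper p k : fitting p k -> proper_knots (arc_of p k).2.
Proof.
rewrite /fitting; case: ltnP => // k5 _.
by apply: (allP (isT : all proper_knots arc_kinds)); exact: mem_nth.
Qed.

Lemma arc_of_ends p k : fitting p k -> (p.1 < p.2)%N ->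
  let A := arc_of p k in
  (A.1 = p.1 /\ A.1 + (size A.2).-1 = p.2)%N \/
  (A.1 = p.2 /\ A.1 + (size A.2).-1 = p.1 + 5)%N.
Proof.
rewrite /fitting /arc_of; case: ifP => // _; case: eqP => [e _|_ /= /eqP e] p12 /=.
  by left; split=> //; rewrite -e subnKC // ltnW.
by right; split=> //; rewrite -[in RHS]e addnA subnKC // ltnW.
Qed.

Section Meetings.
Variable R : realType.
Implicit Types (a b c d f g : R) (A B : arc) (r j i k : nat) (p : R * R).

(** The equation on the second ray forces [g <= f], which contradicts the equation on the first,
    where [a < c]. *)
Lemma sides_meet f g a b c d : 0 <= a -> 0 < b -> 0 < f < 1 -> 0 < g < 1 ->
  a < c -> b <= d -> (1 - f) * a = (1 - g) * c -> f * b = g * d -> False.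
Proof.
move=> a0 b0 /andP[f0 f1] /andP[g0 g1] ac bd e1 e2.
have h1 : (1 - g) * a < (1 - g) * c by rewrite ltr_pM2l // subr_gt0.
have h2 : g * b <= g * d by rewrite ler_pM2l.
have h3 : g <= f by rewrite -(ler_pM2r b0) e2.
have h4 : (1 - f) * a <= (1 - g) * a by rewrite ler_wpM2r // lerB.
by move: (le_lt_trans h4 h1); rewrite e1 ltxx.
Qed.

Lemma arc_pointsP r A p : proper_knots A.2 -> arc_points r A p ->
  exists j f, [/\ (j < size A.2)%N, 0 <= f < 1, j.+1 = size A.2 -> f = 0 &
    p = mix (r + A.1 + j) ((1 - f) * knot R A.2 j) (f * knot R A.2 j.+1)].
Proof.
move=> pA [x /=]; rewrite in_itv /= => hx <-.
by have [j [f [_ *]]] := arc_atE r pA hx; exists j, f.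
Qed.

Lemma knot_vertex A k j : (nth 0%N A.2 j = 4)%N ->
  mix k ((1 - 0) * knot R A.2 j) (0 * knot R A.2 j.+1) = vertex_point R k.
Proof. by move=> e; rewrite /knot e subr0 mul1r mul0r. Qed.

Lemma arc_meets_vertex r A k : proper_knots A.2 ->
  arc_points r A (vertex_point R k) ->
  exists j, [/\ (j < size A.2)%N, knot_end A.2 j & k = r + A.1 + j %[mod 5]].
Proof.
move=> pA /(arc_pointsP pA)[j [f [js /andP[f0 f1] jf]]].
have kj := knot_gt0 R pA js.
move=> /mix_inj[]; rewrite ?mulr_gt0 ?mulr_ge0 ?subr_gt0 ?ler0n // => kE e1 e2.
exists j; split=> //; rewrite -knot_endE //; have [j1|j1] := eqVneq j.+1 (size A.2).
  by apply/eqP; move: e1; rewrite (jf j1) subr0 mul1r => /(@mulrIn R 1 (oner_neq0 R))/esym.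
have j1s : (j.+1 < size A.2)%N by rewrite ltn_neqAle j1.
move/esym/eqP: e2; rewrite mulf_eq0 [knot R _ _ == 0]gt_eqF ?knot_gt0 // orbF.
move=> /eqP e2; apply/eqP; move: e1; rewrite e2 subr0 mul1r.
by move=> /(@mulrIn R 1 (oner_neq0 R))/esym.
Qed.

Lemma arcs_meet r A B p : proper_knots A.2 -> proper_knots B.2 -> arcs_apart A B ->
  arc_points r A p -> arc_points r B p ->
  exists j i, [/\ (j < size A.2)%N /\ knot_end A.2 j,
    (i < size B.2)%N /\ knot_end B.2 i & p = vertex_point R (r + A.1 + j) /\
    p = vertex_point R (r + B.1 + i)].
Proof.
move=> pA pB AB /(arc_pointsP pA)[j [f [js f01 jf pE]]].
move=> /(arc_pointsP pB)[i [g [is_ g01 ig pE']]].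
have [ji e1 e2] := mix_knots_inj pA pB js is_ f01 g01 (etrans (esym pE) pE').
have aj := knot_gt0 R pA js; have ci := knot_gt0 R pB is_.
have /allP/(_ j) := AB; rewrite mem_iota => /(_ js)/allP/(_ i).
rewrite mem_iota => /(_ is_); have -> : ((A.1 + j) %% 5 == (B.1 + i) %% 5)%N.
  by rewrite -(eqn_modDl r) !addnA; apply/eqP.
case: ifP => // knots sides; move/andP: (f01) => [f0 f1]; move/andP: (g01) => [g0 g1].
have bgt0 : f != 0 -> (j.+1 < size A.2)%N.
  by rewrite ltn_neqAle js andbT; apply: contraNneq => /jf ->.
have dgt0 : g != 0 -> (i.+1 < size B.2)%N.
  by rewrite ltn_neqAle is_ andbT; apply: contraNneq => /ig ->.
(* Both descriptions of the point agree on whether it lies on a ray or strictly inside a sector. *)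
have fg0 : (f == 0) = (g == 0).
  apply/idP/idP => /eqP z; rewrite z mul0r in e2.
    apply: contraT => gn; move/esym/eqP: e2.
    by rewrite mulf_eq0 (negbTE gn) gt_eqF // knot_gt0 // dgt0.
  apply: contraT => fn; move/eqP: e2.
  by rewrite mulf_eq0 (negbTE fn) gt_eqF // knot_gt0 // bgt0.
have [f_0|fn] := eqVneq f 0.
  have g_0 : g = 0 by apply/eqP; rewrite -fg0 f_0.
  move: e1; rewrite f_0 g_0 !subr0 !mul1r => /eqP; rewrite eqr_nat => /eqP e1.
  move: knots; rewrite /knots_apart e1 eqxx.
  case: ifP => // jend iend.
  have i4 : nth 0%N B.2 i = 4%N by apply/eqP; rewrite knot_endE.
  exists j, i; split=> //; split.
    by rewrite pE f_0 knot_vertex // e1.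
  by rewrite pE' g_0 knot_vertex.
exfalso; have gn : g != 0 by rewrite -fg0.
have jb := bgt0 fn; have id_ := dgt0 gn.
have b0 := knot_gt0 R pA jb; have d0 := knot_gt0 R pB id_.
have f01' : 0 < f < 1 by rewrite lt_neqAle eq_sym fn f0 f1.
have g01' : 0 < g < 1 by rewrite lt_neqAle eq_sym gn g0 g1.
move: sides; rewrite /sides_apart jb id_ /=.
case: ltnP => [ac bd|]; last rewrite leq_eqVlt => /orP[/eqP ca|ca].
- by apply: (sides_meet (ltW aj) b0 f01' g01' _ _ e1 e2); rewrite ?ltr_nat ?ler_nat.
- rewrite ca ltnn => /eqP; apply.
  move: e1; rewrite /knot ca => /(mulIf (lt0r_neq0 aj)).
  move=> /(congr1 (fun z => 1 - z)); rewrite !subKr => fg.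
  by move/eqP: e2; rewrite fg (inj_eq (mulfI gn)) eqr_nat => /eqP.
rewrite ca => db.
by apply: (sides_meet (ltW ci) d0 g01' f01' _ _ (esym e1) (esym e2)); rewrite ?ltr_nat ?ler_nat.
Qed.

End Meetings.

Local Close Scope ring_scope.
Local Close Scope classical_set_scope.
Local Open Scope nat_scope.

Definition colour (C : seq nat) s t := nth 0 C (index (s, t) pairs5).

Lemma colour_restrict C C' s t : s < t < 4 ->
  restrict C = [:: nth 0 C' 0; nth 0 C' 1; nth 0 C' 2; nth 0 C' 4; nth 0 C' 5; nth 0 C' 7] ->
  colour C' s t = colour C s.+1 t.+1.
Proof.
move=> st e; have eq q : nth 0 C (4 + q) = nth 0 [:: nth 0 C' 0; nth 0 C' 1;
    nth 0 C' 2; nth 0 C' 4; nth 0 C' 5; nth 0 C' 7] q by rewrite -e nth_drop.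
case/andP: st; case: t => [|[|[|[|t]]]] //; case: s => [|[|[|s]]] // _ _;
  rewrite /colour /=;
  by [rewrite (eq 0) | rewrite (eq 1) | rewrite (eq 2) | rewrite (eq 3)
     | rewrite (eq 4) | rewrite (eq 5)].
Qed.

Lemma mem_pairs5 s t : ((s, t) \in pairs5) = (s < t < 5).
Proof.
have [t5|t5] := leqP 5 t; last by case: t t5 => [|[|[|[|[|t]]]]] // _; case: s => [|[|[|[|[|s]]]]].
by rewrite andbF; case: t t5 => [|[|[|[|[|t]]]]] // _; case: s => [|[|[|[|[|s]]]]].
Qed.

Lemma colour_mem C s t : size C = 10 -> s < t < 5 ->
  ((s, t), colour C s t) \in zip pairs5 C.
Proof.
rewrite -mem_pairs5 => C10 st; rewrite /colour.
have lt : index (s, t) pairs5 < size C by rewrite C10 -[10]/(size pairs5) index_mem.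
rewrite -[X in (X, _)](nth_index (0, 0) st) -nth_zip; last by rewrite C10.
by apply: mem_nth; rewrite size_zip C10 -[minn _ _]/10 -C10.
Qed.

Lemma mod5_inj w i j : w <= i < w + 5 -> w <= j < w + 5 -> i = j %[mod 5] -> i = j.
Proof.
move=> /andP[wi iw] /andP[wj jw] /eqP.
rewrite -[i](subnKC wi) -[j](subnKC wj) eqn_modDl => /eqP.
by rewrite !modn_small ?ltn_subLR // => ->.
Qed.

Section Realization.
Variables (R : realType) (V : finType) (S : graph_story V) (v0 : V).
Let G := story_graph S.
Let n := #|V|.
Let ix v := index v (story_order S).
Hypothesis omega5 : omega S = 5.
Variable f : nat -> seq nat.
Hypothesis f_ok : forall w, w + 5 <= n -> coloured S v0 w (f w).
Hypothesis f_shared : forall w, w + 5 < n -> restrict (f w) =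
  [:: nth 0 (f w.+1) 0; nth 0 (f w.+1) 1; nth 0 (f w.+1) 2;
      nth 0 (f w.+1) 4; nth 0 (f w.+1) 5; nth 0 (f w.+1) 7].

(** For [i < j] the earliest window with [j] starts at [j - 4], truncated to 0; by [edge_colourE]
    every other window containing both agrees with it. *)
Definition edge_colour i j := colour (f (j - 4)) (i - (j - 4)) (j - (j - 4)).

Lemma edge_colourE w i j : w + 5 <= n -> w <= i -> i < j -> j < w + 5 ->
  edge_colour i j = colour (f w) (i - w) (j - w).
Proof.
move=> wn wi ij jw; have [d wE] : exists d, w = j - 4 + d.
  by exists (w - (j - 4)); rewrite subnKC //; lia.
elim: d w wE wn wi jw => [|d IH] w wE wn wi jw; first by rewrite wE addn0.
have wS : w = (j - 4 + d).+1 by rewrite wE addnS.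
rewrite (IH (j - 4 + d) erefl); [|lia..].
rewrite wS in wn wi jw *; rewrite (colour_restrict _ (f_shared _)) //; last by lia.
by congr colour; lia.
Qed.

Definition lower u v := minn (ix u) (ix v).
Definition upper u v := maxn (ix u) (ix v).

(* A single drawing of the whole story serves for all windows. *)
Definition story_drawing : drawing R V := Drawing
  (fun v => vertex_point R (ix v))
  (fun u v => @arc_points R 0
     (arc_of (lower u v, upper u v) (edge_colour (lower u v) (upper u v)).-1)).

Lemma window_start i : i <= n -> exists2 w, w + 5 <= n &
  forall v, v \in window S i -> w <= ix v < w + 5.
Proof.
move=> iN; have n5 : 5 <= n by rewrite -omega5; exact: omega_le.
exists (i - 5); first by lia.
by move=> v; rewrite inE omega5 -/(ix v); lia.
Qed.

Lemma ix_inj : injective ix.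
Proof. by move=> u v e; rewrite -(vtx_ix S v0 u) -/(ix u) e /ix vtx_ix. Qed.

Variable w : nat.
Hypothesis w5 : w + 5 <= n.
Variable W : {set V}.
Hypothesis W_in : forall v, v \in W -> w <= ix v < w + 5.

Let slot_pair u v := (lower u v - w, upper u v - w).
Let slot_arc u v := arc_of (slot_pair u v) (edge_colour (lower u v) (upper u v)).-1.

Lemma lower_upper u v : G u v -> u \in W -> v \in W ->
  w <= lower u v /\ lower u v < upper u v < w + 5.
Proof.
move=> uv /W_in hu /W_in hv; have : ix u != ix v.
  by apply: contraTneq uv => /ix_inj ->; rewrite adjacent_irr.
by rewrite /lower /upper; lia.
Qed.

(** The shape of an arc depends only on the difference of the indices, so passing to slots is a
    rotation by [w] rays, and the checks made on slots apply to the one global drawing. *)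
Lemma story_curveE u v : G u v -> u \in W -> v \in W ->
  curve story_drawing u v = @arc_points R w (slot_arc u v).
Proof.
move=> uv uW vW; have [wl /andP[lu uw]] := lower_upper uv uW vW.
rewrite /= /arc_points /arc_at /slot_arc /slot_pair /arc_of /=.
have -> : upper u v - w - (lower u v - w) = upper u v - lower u v by lia.
have e : 0 + (if upper u v - lower u v ==
      (size (nth [::] arc_kinds (edge_colour (lower u v) (upper u v)).-1)).-1
    then lower u v else upper u v) =
  w + (if upper u v - lower u v ==
      (size (nth [::] arc_kinds (edge_colour (lower u v) (upper u v)).-1)).-1
    then lower u v - w else upper u v - w) by case: ifP => _; lia.
by rewrite e.
Qed.

Lemma slot_pair_in u v : G u v -> u \in W -> v \in W ->
  (slot_pair u v, edge_colour (lower u v) (upper u v)) \in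
    [seq pc <- zip pairs5 (f w) | 0 < pc.2].
Proof.
move=> uv uW vW; have [wl /andP[lu uw]] := lower_upper uv uW vW.
have cw := f_ok w5; have s10 := coloured_size cw.
have st : lower u v - w < upper u v - w < 5 by lia.
rewrite mem_filter /= (edge_colourE w5 wl lu uw) colour_mem // andbT.
have [bE _ _] := cw.
have lt : index (slot_pair u v) pairs5 < size pairs5 by rewrite index_mem mem_pairs5.
rewrite /colour -/(slot_pair u v) -[0 < _]/(1 <= nth 0 (f w) (index (slot_pair u v) pairs5)).
have -> : (1 <= nth 0 (f w) (index (slot_pair u v) pairs5)) =
    nth false (map (leq 1) (f w)) (index (slot_pair u v) pairs5).
  by rewrite (nth_map 0) // s10.
rewrite bE (nth_map (0, 0)) // nth_index ?mem_pairs5 // !subnKC ?(leq_trans wl (ltnW lu)) //.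
rewrite /adj !(leq_trans _ w5) // ?(ltn_trans lu) //=.
rewrite /lower /upper.
case: (leqP (ix u) (ix v)) => _; rewrite /vtx !nth_index ?story_order_full //.
by rewrite adjacent_sym.
Qed.

Lemma edge_fitting u v : G u v -> u \in W -> v \in W ->
  fitting (slot_pair u v) (edge_colour (lower u v) (upper u v)).-1.
Proof.
move=> uv uW vW; have := slot_pair_in uv uW vW; rewrite mem_filter /= => /andP[c0 cz].
have [_ + _] := f_ok w5; rewrite /good_colouring; case: ifP => // /allP/(_ _ cz) /=.
by rewrite -[_ == 0]negbK -lt0n c0.
Qed.

(** The arcs were compared pairwise in the order of [pairs5], hence the disjunction. *)
Lemma edges_apart u v x y : G u v -> u \in W -> v \in W ->
  G x y -> x \in W -> y \in W -> [set u; v]%SET <> [set x; y]%SET ->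
  arcs_apart (slot_arc u v) (slot_arc x y) || arcs_apart (slot_arc x y) (slot_arc u v).
Proof.
move=> uv uW vW xy xW yW ne.
have [_ + _] := f_ok w5; rewrite /good_colouring; case: ifP => // _.
rewrite /drawn_arcs pairwise_map => /pairwise_mem.
move=> /(_ _ _ (slot_pair_in uv uW vW) (slot_pair_in xy xW yW)); apply.
apply/eqP => -[e1 e2 _]; apply: ne.
have [wl /andP[lu uw]] := lower_upper uv uW vW.
have [wl' /andP[lu' uw']] := lower_upper xy xW yW.
have {}e1 : lower u v = lower x y by clear -e1 wl wl'; lia.
have {}e2 : upper u v = upper x y by clear -e2 wl wl' lu lu'; lia.
have [[/ix_inj-> /ix_inj->]|[/ix_inj-> /ix_inj->]] :
    (ix u = ix x /\ ix v = ix y) \/ (ix u = ix y /\ ix v = ix x).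
- by move: e1 e2; rewrite /lower /upper; clear; lia.
- by [].
by rewrite finset.setUC.
Qed.

Lemma slot_arc_end u v j : G u v -> u \in W -> v \in W ->
  j < size (slot_arc u v).2 -> knot_end (slot_arc u v).2 j ->
  exists2 x, x \in [set u; v]%SET & w + (slot_arc u v).1 + j = ix x %[mod 5].
Proof.
move=> uv uW vW js jend; have [wl /andP[lu uw]] := lower_upper uv uW vW.
have st : (slot_pair u v).1 < (slot_pair u v).2 by rewrite /=; lia.
have ends x : x = lower u v \/ x = upper u v -> exists2 y, y \in [set u; v]%SET & x = ix y.
  rewrite /lower /upper; case: (leqP (ix u) (ix v)) => _ [] ->;
    by [exists u; rewrite ?inE ?eqxx | exists v; rewrite ?inE ?eqxx ?orbT].
have j_ends : j = 0 \/ j = (size (slot_arc u v).2).-1.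
  by move: jend => /orP[/eqP|/eqP <-]; [left | right].
suff [x hx e] : exists2 x, x = lower u v \/ x = upper u v &
    w + (slot_arc u v).1 + j = x %[mod 5].
  by have [y yuv xy] := ends x hx; exists y => //; rewrite e xy.
have := arc_of_ends (edge_fitting uv uW vW) st; rewrite -/(slot_arc u v) /=.
move=> [] [e1 e2]; case: j_ends => ->; rewrite -addnA.
- by exists (lower u v); [left | rewrite addn0 e1 subnKC].
- by exists (upper u v); [right | rewrite e2 subnKC // (leq_trans wl (ltnW lu))].
- by exists (upper u v); [right | rewrite addn0 e1 subnKC // (leq_trans wl (ltnW lu))].
- by exists (lower u v); [left | rewrite e2 addnA subnKC // modnDr].
Qed.

Lemma slot_arc_jordan u v : G u v -> u \in W -> v \in W ->
  jordan_arc (arc_points w (slot_arc u v)) (vertex_point R (ix u)) (vertex_point R (ix v)).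
Proof.
move=> uv uW vW; have [wl /andP[lu uw]] := lower_upper uv uW vW.
have wu := leq_trans wl (ltnW lu).
have st : (slot_pair u v).1 < (slot_pair u v).2 by rewrite /=; lia.
have fit := edge_fitting uv uW vW.
have [j1 j2] := @arc_jordan R w _ (arc_of_proper fit).
have vp5 k : vertex_point R (k + 5) = vertex_point R k.
  by rewrite -(vertex_point_mod R (k + 5)) modnDr vertex_point_mod.
have jl : jordan_arc (arc_points w (slot_arc u v))
      (vertex_point R (lower u v)) (vertex_point R (upper u v)) /\
    jordan_arc (arc_points w (slot_arc u v))
      (vertex_point R (upper u v)) (vertex_point R (lower u v)).
  move: j1 j2; rewrite -addnA -/(slot_arc u v).
  by case: (arc_of_ends fit st) => -[-> ->] /=; rewrite ?addnA !subnKC // ?vp5.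
by case: jl; rewrite /lower /upper; case: (leqP (ix u) (ix v)).
Qed.

Lemma story_planar : planar_drawing G W story_drawing.
Proof.
split.
- move=> u v /W_in hu /W_in hv /vertex_point_inj e.
  exact: ix_inj (mod5_inj hu hv e).
- move=> u v uW vW uv; split; last by rewrite /= /lower /upper minnC maxnC.
  by rewrite story_curveE //; exact: slot_arc_jordan.
- move=> u v x uW vW xW uv; rewrite story_curveE //.
  move=> /(arc_meets_vertex (arc_of_proper (edge_fitting uv uW vW))).
  move=> [j [js jend e]]; have [y yuv e'] := slot_arc_end uv uW vW js jend.
  have yW : y \in W by move: yuv; rewrite !inE => /orP[] /eqP ->.
  have -> : x = y by apply: ix_inj; apply: (mod5_inj (W_in xW) (W_in yW)); rewrite -e'.
  by move: yuv; rewrite !inE => /orP[] /eqP; [left | right].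
- move=> u v x y uW vW xW yW uv xy ne p; rewrite !story_curveE // => h1 h2.
  have pA := arc_of_proper (edge_fitting uv uW vW).
  have pB := arc_of_proper (edge_fitting xy xW yW).
  have [j [i [[js jend] [is_ iend] [e1 e2]]]] : exists j i,
      [/\ j < size (slot_arc u v).2 /\ knot_end (slot_arc u v).2 j,
        i < size (slot_arc x y).2 /\ knot_end (slot_arc x y).2 i &
        p = vertex_point R (w + (slot_arc u v).1 + j) /\
        p = vertex_point R (w + (slot_arc x y).1 + i)].
    case/orP: (edges_apart uv uW vW xy xW yW ne) => ap.
      exact: arcs_meet pA pB ap h1 h2.
    have [i [j [hi hj [e1 e2]]]] := arcs_meet pB pA ap h2 h1.
    by exists j, i; split.
  have [a auv ea] := slot_arc_end uv uW vW js jend.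
  have [b bxy eb] := slot_arc_end xy xW yW is_ iend.
  have aW : a \in W by move: auv; rewrite !inE => /orP[] /eqP ->.
  have bW : b \in W by move: bxy; rewrite !inE => /orP[] /eqP ->.
  have pa : p = vertex_point R (ix a).
    by rewrite e1 -vertex_point_mod ea vertex_point_mod.
  exists a; split; [exact: auv | | exact: pa]; suff -> : a = b by [].
  apply: ix_inj; apply: (mod5_inj (W_in aW) (W_in bW)).
  by rewrite -ea -eb; apply: (@vertex_point_inj R); rewrite -e1 -e2.
Qed.

End Realization.

Lemma stories_realizable (R : realType) (V : finType) (S : graph_story V) :
  triconnected (story_graph S) -> cubic (story_graph S) -> minimal_story S ->
  omega S = 5 -> realizable R S.
Proof.
move=> G3 Gc min omega5.
have [v0] : exists v0 : V, true.
  have : 0 < #|V| by apply: leq_trans (omega_le S); exact: omega_gt0.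
  by case/card_gt0P => v0 _; exists v0.
move=> _; have [f [f_ok f_shared]] := colouring_exists v0 G3 Gc omega5.
exists [seq vertex_point R k | k <- iota 0 5]; split.
- rewrite map_inj_in_uniq ?iota_uniq // => i j; rewrite !mem_iota => hi hj.
  by move/vertex_point_inj; exact: (@mod5_inj 0).
- by rewrite size_map size_iota omega5 min.
exists (fun=> story_drawing R S f); split=> // i /andP[i1 iN].
have [w w5 W_in] := window_start omega5 iN; split.
  exact: (story_planar R omega5 f_ok f_shared w5 W_in).
move=> v _; rewrite -[pos _ _]/(vertex_point R (index v (story_order S))).
rewrite -vertex_point_mod; apply: map_f.
by rewrite mem_iota ltn_pmod.
Qed.

Theorem theorem5 (R : realType) :
  (forall (V : finType) (S : graph_story V),
     planar R (story_graph S) -> triconnected (story_graph S) ->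
     cubic (story_graph S) -> minimal_story S -> omega S = 5 ->
     realizable R S) /\
  (exists (p : cmd) (c : nat),
     forall (n : nat) (S : graph_story 'I_n) (adj : 'I_n -> seq 'I_n),
       planar R (story_graph S) -> triconnected (story_graph S) ->
       cubic (story_graph S) -> minimal_story S -> omega S = 5 ->
       adjacency_lists (story_graph S) adj ->
       exists (t : nat) (output : seq nat)
              (phi : nat -> set (drawing R 'I_n)) (cs : nat -> embedding_code 'I_n),
         [/\ computes_in (n ^ c) p (story_input S adj) t output,
             t <= c * n,
             output = sequence_output S cs,
             compatible_sequence S phi &
             forall i, 5 <= i <= n ->
               encodes_embedding (story_graph S) (window S i) (cs i) (phi i)]).
Proof.
split=> [V S _|]; first exact: stories_realizable.
have [p [c h]] := embeddings_computed R; exists p, c => n S adj _ G3 Gc _.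
exact: h.
Qed.
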